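(* Over $\mathsf{RCA}_0$, $\mathsf{LL}_{\bm{\Delta}^0_1}$ implies $\mathsf{ACA}_0$. Moreover, over $\mathsf{RCA}_0+\bm{\Sigma}^1_1\text{-}\mathsf{IND}$, $\mathsf{LL}_{\bm{\Delta}^0_1}$ implies $\bm{\Delta}^1_1\text{-}\mathsf{CA}_0$ and $\mathsf{LL}_{\bm{\Sigma}^0_1}$ implies $\bm{\Sigma}^1_1\text{-}\mathsf{AC}_0$.
   Context: We work in the language of second order arithmetic; $\mathbb{N}$ is the first order part. A tree is a prefix-closed subset of $\mathbb{N}^{<\mathbb{N}}$, with body $[T]=\{f\in\mathbb{N}^{\mathbb{N}} : \forall n\ f\upharpoonright n\in T\}$. A Laver tree (always with empty stem) is a tree $T$ with $\langle\rangle\in T$ such that every $\sigma\in T$ has infinitely many immediate successors $\sigma^{\frown} n$ in $T$. A set $A\subseteq\mathbb{N}^{<\mathbb{N}}$ codes the open set $\{f:\exists\tau\prec f\ (\tau\in A)\}$; a clopen set is coded by a pair of codes for open sets which are complements of each other. $\mathsf{LL}_{\bm{\Sigma}^0_1}$ (resp. $\mathsf{LL}_{\bm{\Delta}^0_1}$) is the statement: for every (coded) open (resp. clopen) set $A\subseteq\mathbb{N}^{\mathbb{N}}$ there is a Laver tree $T$ such that either $[T]\subseteq A$ or $[T]\cap A=\emptyset$. $\bm{\Sigma}^1_1\text{-}\mathsf{IND}$ is the induction schema for $\bm{\Sigma}^1_1$ formulas; $\bm{\Delta}^1_1\text{-}\mathsf{CA}_0$ is $\mathsf{RCA}_0$ plus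 $\bm{\Delta}^1_1$-comprehension; $\bm{\Sigma}^1_1\text{-}\mathsf{AC}_0$ is $\mathsf{RCA}_0$ plus the schema $(\forall i\,\exists f\,\varphi(f,i))\rightarrow(\exists f\,\forall i\,\varphi((f)_i,i))$ for all $\bm{\Sigma}^1_1$ formulas $\varphi$. *)

(* Defs.v *)
(** Second order arithmetic, following Simpson, "Subsystems of Second Order
    Arithmetic".  Theories are given by their classes of models: "T implies U
    over B" is read as "every model of B and T is a model of U".  Models are
    arbitrary L2-structures: neither the number part nor the set part is
    required to be standard, and all quantifiers of the theories below range
    over the number part and the set part of the structure at hand. *)

(** * L2-structures *)

(* By [mem_ext], the sets of a structure may be identified with a nonempty
   family of subsets of its number part. *)
Record L2_structure : Type := {
  num : Type;
  nset : Type;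
  zero : num;
  one : num;
  add : num -> num -> num;
  mul : num -> num -> num;
  lt : num -> num -> Prop;
  mem : num -> nset -> Prop;
  nset_inhabited : inhabited nset;
  mem_ext : forall X Y : nset, (forall n, mem n X <-> mem n Y) -> X = Y
}.

Arguments zero {_}.
Arguments one {_}.
Arguments add {_} _ _.
Arguments mul {_} _ _.
Arguments lt {_} _ _.
Arguments mem {_} _ _.

Declare Scope L2_scope.
Delimit Scope L2_scope with L2.
Bind Scope L2_scope with num.
Notation "0" := zero : L2_scope.
Notation "1" := one : L2_scope.
Infix "+" := add : L2_scope.
Infix "*" := mul : L2_scope.
Infix "<" := lt : L2_scope.
Notation "n '\in' X" := (mem n X) (at level 70, no associativity) : L2_scope.

(** * Formulas of L2 *)

(* De Bruijn indices, counted separately for number and for set variables. *)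
Inductive term : Type :=
| TVar (k : nat)
| TZero
| TOne
| TAdd (s t : term)
| TMul (s t : term).

Inductive form : Type :=
| FEq (s t : term)
| FLt (s t : term)
| FMem (t : term) (k : nat)
| FNot (p : form)
| FAnd (p q : form)
| FOr (p q : form)
| FImp (p q : form)
| FAllN (p : form)
| FExN (p : form)
| FAllS (p : form)
| FExS (p : form).

Definition scons {A : Type} (a : A) (e : nat -> A) (k : nat) : A :=
  match k with O => a | S k' => e k' end.

Fixpoint eval {M : L2_structure} (e : nat -> num M) (t : term) : num M :=
  match t with
  | TVar k => e k
  | TZero => zero
  | TOne => one
  | TAdd s t => add (eval e s) (eval e t)
  | TMul s t => mul (eval e s) (eval e t)
  end.

Fixpoint sat {M : L2_structure} (e : nat -> num M) (E : nat -> nset M)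
    (p : form) : Prop :=
  match p with
  | FEq s t => eval e s = eval e t
  | FLt s t => lt (eval e s) (eval e t)
  | FMem t k => mem (eval e t) (E k)
  | FNot p => ~ sat e E p
  | FAnd p q => sat e E p /\ sat e E q
  | FOr p q => sat e E p \/ sat e E q
  | FImp p q => sat e E p -> sat e E q
  | FAllN p => forall n, sat (scons n e) E p
  | FExN p => exists n, sat (scons n e) E p
  | FAllS p => forall X, sat e (scons X E) p
  | FExS p => exists X, sat e (scons X E) p
  end.

Fixpoint lift (t : term) : term :=
  match t with
  | TVar k => TVar (S k)
  | TZero => TZero
  | TOne => TOne
  | TAdd s t => TAdd (lift s) (lift t)
  | TMul s t => TMul (lift s) (lift t)
  end.

(* The quantified variable does not occur in the bound: hence [lift t]. *)
Inductive Delta00 : form -> Prop :=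
| D00_eq s t : Delta00 (FEq s t)
| D00_lt s t : Delta00 (FLt s t)
| D00_mem t k : Delta00 (FMem t k)
| D00_not p : Delta00 p -> Delta00 (FNot p)
| D00_and p q : Delta00 p -> Delta00 q -> Delta00 (FAnd p q)
| D00_or p q : Delta00 p -> Delta00 q -> Delta00 (FOr p q)
| D00_imp p q : Delta00 p -> Delta00 q -> Delta00 (FImp p q)
| D00_all t p :
    Delta00 p -> Delta00 (FAllN (FImp (FLt (TVar 0) (lift t)) p))
| D00_ex t p :
    Delta00 p -> Delta00 (FExN (FAnd (FLt (TVar 0) (lift t)) p)).

Definition Sigma01 (p : form) : Prop := exists q, Delta00 q /\ p = FExN q.
Definition Pi01 (p : form) : Prop := exists q, Delta00 q /\ p = FAllN q.

Fixpoint arithmetical (p : form) : Prop :=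
  match p with
  | FEq _ _ | FLt _ _ | FMem _ _ => True
  | FNot p | FAllN p | FExN p => arithmetical p
  | FAnd p q | FOr p q | FImp p q => arithmetical p /\ arithmetical q
  | FAllS _ | FExS _ => False
  end.

Definition Sigma11 (p : form) : Prop := exists q, arithmetical q /\ p = FExS q.
Definition Pi11 (p : form) : Prop := exists q, arithmetical q /\ p = FAllS q.

(** * Schemas *)

(* In each instance of a schema all number and set parameters are allowed:
   they are the values of the environments [e] and [E]. *)

Definition induction_schema (G : form -> Prop) (M : L2_structure) : Prop :=
  forall p, G p -> forall (e : nat -> num M) (E : nat -> nset M),
    sat (scons zero e) E p ->
    (forall n, sat (scons n e) E p -> sat (scons (add n one) e) E p) ->
    forall n, sat (scons n e) E p.

Definition comprehension_schema (G : form -> Prop) (M : L2_structure) : Prop :=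
  forall p, G p -> forall (e : nat -> num M) (E : nat -> nset M),
    exists X : nset M, forall n, mem n X <-> sat (scons n e) E p.

Definition delta_comprehension_schema (G G' : form -> Prop)
    (M : L2_structure) : Prop :=
  forall p q, G p -> G' q -> forall (e : nat -> num M) (E : nat -> nset M),
    (forall n, sat (scons n e) E p <-> sat (scons n e) E q) ->
    exists X : nset M, forall n, mem n X <-> sat (scons n e) E p.

(** * Theories axiomatized by comprehension and induction *)

Definition basic_axioms (M : L2_structure) : Prop :=
  (forall n : num M, n + 1 <> 0)%L2 /\
  (forall m n : num M, m + 1 = n + 1 -> m = n)%L2 /\
  (forall m : num M, m + 0 = m)%L2 /\
  (forall m n : num M, m + (n + 1) = (m + n) + 1)%L2 /\
  (forall m : num M, m * 0 = 0)%L2 /\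
  (forall m n : num M, m * (n + 1) = (m * n) + m)%L2 /\
  (forall m : num M, ~ (m < 0))%L2 /\
  (forall m n : num M, m < n + 1 <-> (m < n \/ m = n))%L2.

Definition RCA0 (M : L2_structure) : Prop :=
  basic_axioms M /\
  induction_schema Sigma01 M /\
  delta_comprehension_schema Sigma01 Pi01 M.

Definition ACA0 (M : L2_structure) : Prop :=
  RCA0 M /\ comprehension_schema arithmetical M.

Definition Sigma11_IND (M : L2_structure) : Prop := induction_schema Sigma11 M.

Definition Delta11_CA0 (M : L2_structure) : Prop :=
  RCA0 M /\ delta_comprehension_schema Sigma11 Pi11 M.

(** * Coding of functions and of finite sequences *)

Section Coding.
Context {M : L2_structure}.
Local Open Scope L2_scope.

Definition pair (i j : num M) : num M := (i + j) * (i + j) + i.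

(* Functions from numbers to numbers are sets which are graphs. *)
Definition is_fun (F : nset M) : Prop :=
  (forall p, p \in F -> exists n m, p = pair n m) /\
  (forall n, exists! m, pair n m \in F).

(* [G] is the function (F)_i, that is, G(n) = F(n, i). *)
Definition fun_section (F : nset M) (i : num M) (G : nset M) : Prop :=
  forall p, p \in G <-> exists n m, p = pair n m /\ pair (pair n i) m \in F.

Definition remainder (a d x : num M) : Prop := x < d /\ exists q, a = q * d + x.

(* Goedel's beta function: the number (l, (a, b)) describes the sequence of
   length l whose i-th entry is the remainder of b modulo a(i+1)+1. *)
Definition seq_len (s l : num M) : Prop := exists a b, s = pair l (pair a b).

Definition seq_entry (s i x : num M) : Prop :=
  exists l a b, s = pair l (pair a b) /\ i < l /\
    remainder b (a * (i + 1) + 1) x.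

Definition same_seq (s t : num M) : Prop :=
  (forall l, seq_len s l <-> seq_len t l) /\
  (forall i x, seq_entry s i x <-> seq_entry t i x).

(* Finite sequences are identified with the least numbers describing them, so
   that each sequence has exactly one code. *)
Definition is_seq (s : num M) : Prop :=
  (exists l, seq_len s l) /\ forall t, t < s -> ~ same_seq s t.

Definition is_empty_seq (s : num M) : Prop := is_seq s /\ seq_len s 0.

(* [t] is the concatenation of [s] with the one-term sequence <n>. *)
Definition is_snoc (s n t : num M) : Prop :=
  is_seq s /\ is_seq t /\
  exists l, seq_len s l /\ seq_len t (l + 1) /\ seq_entry t l n /\
    forall i x, i < l -> (seq_entry t i x <-> seq_entry s i x).

Definition seq_initial (s t : num M) : Prop :=
  is_seq s /\ is_seq t /\
  exists l k, seq_len s l /\ seq_len t k /\ (l < k \/ l = k) /\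
    forall i x, i < l -> (seq_entry t i x <-> seq_entry s i x).

(* [s] is the restriction of the function [F] to the numbers below [n]. *)
Definition is_restriction (F : nset M) (n s : num M) : Prop :=
  is_seq s /\ seq_len s n /\
  forall i x, i < n -> (seq_entry s i x <-> pair i x \in F).

(** * Laver trees and codes for open and clopen sets *)

Definition is_tree (T : nset M) : Prop :=
  (forall s, s \in T -> is_seq s) /\
  (forall s t, t \in T -> seq_initial s t -> s \in T).

Definition is_laver_tree (T : nset M) : Prop :=
  is_tree T /\
  (exists s, is_empty_seq s /\ s \in T) /\
  (forall s, s \in T ->
     forall k, exists n t, k < n /\ is_snoc s n t /\ t \in T).

Definition in_body (F T : nset M) : Prop :=
  forall n, exists s, is_restriction F n s /\ s \in T.

Definition is_open_code (A : nset M) : Prop := forall s, s \in A -> is_seq s.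

Definition in_open (F A : nset M) : Prop :=
  exists n s, is_restriction F n s /\ s \in A.

Definition is_clopen_code (A B : nset M) : Prop :=
  is_open_code A /\ is_open_code B /\
  forall F, is_fun F -> (in_open F A <-> ~ in_open F B).

Definition laver_homogeneous (A T : nset M) : Prop :=
  (forall F, is_fun F -> in_body F T -> in_open F A) \/
  (forall F, is_fun F -> in_body F T -> ~ in_open F A).

End Coding.

Definition LL_Sigma01 (M : L2_structure) : Prop :=
  forall A : nset M, is_open_code A ->
  exists T : nset M, is_laver_tree T /\ laver_homogeneous A T.

Definition LL_Delta01 (M : L2_structure) : Prop :=
  forall A B : nset M, is_clopen_code A B ->
  exists T : nset M, is_laver_tree T /\ laver_homogeneous A T.

(** * Choice *)

(* In phi(f, i), the function f is set variable 0 and i is number variable 0.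
   The sections (f)_i exist in every model of RCA_0. *)
Definition choice_schema (G : form -> Prop) (M : L2_structure) : Prop :=
  forall p, G p -> forall (e : nat -> num M) (E : nat -> nset M),
    (forall i, exists F, is_fun F /\ sat (scons i e) (scons F E) p) ->
    exists F, is_fun F /\
      forall i, exists H, fun_section F i H /\ sat (scons i e) (scons H E) p.

Definition Sigma11_AC0 (M : L2_structure) : Prop :=
  RCA0 M /\ choice_schema Sigma11 M.

(* Main.v *)
From Stdlib Require Import Arith Lia Classical ClassicalEpsilon FunctionalExtensionality Ring.
Require Import Defs.

(** A Laver tree contains paths that dominate any given function beyond any
    given node, so homogeneity turns guesses that are correct along
    dominating functions into guesses that are correct along all paths.

    For a Sigma01 set K, colour f according to whether some i < f(0) enters K
    at a stage in (f(1), f(2)].  On a homogeneous T no such i exists, so every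
    node (n, m) of T decides the part of K below n at stage m.

    Over ACA_0, a Sigma11 predicate says that a tree T_i has a path, and by
    Koenig's lemma T_i has a path bounded by x unless the part of T_i below x
    dies at some finite level.  If exactly one of T_i and T'_i has a path, read
    f(0) = n and wait for a stage k at which, for every i <= n, one of the two
    trees has died below f(1), f(2), ...; then start again with f(k), f(k+1),
    ... and colour f according to whether both readings agree about which tree
    survives.  Sigma11 induction yields a g dominating paths for all i <= n at
    once.  Any first reading along T can be continued by a dominating, hence
    correct, second one; so all first readings along T are correct, and they
    decide which tree has a path.  For choice, the open colouring "some T_i
    with i < f(0) dies below f(1), f(2), ..." has a homogeneous T avoiding it,
    and paths of T with f(0) > i bound paths of T_i uniformly in i. *)

(** * Definability with parameters *)

(** The number part may be nonstandard, so every induction, minimum and comprehension needs a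
    formula of the right class; predicates on environments with a proof of definability take the
    place of formulas. A clopen code must be complementary on every function of the model, so no
    colouring may mention the truth that it is meant to settle. The first colouring therefore
    compares two stages of an enumeration, the second two guesses made from disjoint blocks of one
    function. The second block starts where the first ends because a Laver tree lets the values
    beyond a node be enlarged at will, but not those of the node. A reading always ends: by Koenig's
    lemma two trees that never die would both have paths. Since n may be nonstandard, a dominating
    function for all i <= n cannot be assembled by finitely many maxima outside the model. The
    passage from Sigma01 comprehension to ACA_0 is an induction on formulas outside the model: a
    function coding Skolem functions for all subformulas makes the formula Delta00. The same code
    later turns the matrix of a Sigma11 formula into a Pi01 condition, hence into a tree. *)

Fixpoint tren (f : nat -> nat) (t : term) : term :=
  match t with
  | TVar k => TVar (f k)
  | TZero => TZero
  | TOne => TOne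
  | TAdd s t => TAdd (tren f s) (tren f t)
  | TMul s t => TMul (tren f s) (tren f t)
  end.

Definition up (f : nat -> nat) (k : nat) : nat :=
  match k with O => O | S k => S (f k) end.

Fixpoint ren (f g : nat -> nat) (p : form) : form :=
  match p with
  | FEq s t => FEq (tren f s) (tren f t)
  | FLt s t => FLt (tren f s) (tren f t)
  | FMem t k => FMem (tren f t) (g k)
  | FNot p => FNot (ren f g p)
  | FAnd p q => FAnd (ren f g p) (ren f g q)
  | FOr p q => FOr (ren f g p) (ren f g q)
  | FImp p q => FImp (ren f g p) (ren f g q)
  | FAllN p => FAllN (ren (up f) g p)
  | FExN p => FExN (ren (up f) g p)
  | FAllS p => FAllS (ren f (up g) p)
  | FExS p => FExS (ren f (up g) p)
  end.

Lemma scons_up {A} (a : A) (e : nat -> A) f :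
  (fun k => scons a e (up f k)) = scons a (fun k => e (f k)).
Proof. apply functional_extensionality; intros [|k]; reflexivity. Qed.

Lemma eval_tren {M : L2_structure} f t (e : nat -> num M) :
  eval e (tren f t) = eval (fun k => e (f k)) t.
Proof. induction t; simpl; congruence. Qed.

Lemma tren_lift f t : tren (up f) (lift t) = lift (tren f t).
Proof. induction t; simpl; congruence. Qed.

Lemma eval_lift {M : L2_structure} t (e : nat -> num M) x :
  eval (scons x e) (lift t) = eval e t.
Proof. induction t; simpl; congruence. Qed.

Lemma sat_ren {M : L2_structure} p : forall f g (e : nat -> num M) E,
  sat e E (ren f g p) <-> sat (fun k => e (f k)) (fun k => E (g k)) p.
Proof.
  induction p; intros f g e E; simpl; rewrite ?eval_tren;
    rewrite ?IHp, ?IHp1, ?IHp2; try reflexivity.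
  - split; intros H n; specialize (H n);
      [rewrite IHp, scons_up in H | rewrite IHp, scons_up]; exact H.
  - split; intros [n H]; exists n;
      [rewrite IHp, scons_up in H | rewrite IHp, scons_up]; exact H.
  - split; intros H n; specialize (H n);
      [rewrite IHp, scons_up in H | rewrite IHp, scons_up]; exact H.
  - split; intros [n H]; exists n;
      [rewrite IHp, scons_up in H | rewrite IHp, scons_up]; exact H.
Qed.

(** The closure properties shared by [Delta00] and [arithmetical], so that each definability lemma
    is proved once for both. *)
Class form_class (C : form -> Prop) : Prop := {
  fc_eq : forall s t, C (FEq s t);
  fc_lt : forall s t, C (FLt s t);
  fc_mem : forall t k, C (FMem t k);
  fc_not : forall p, C p -> C (FNot p);
  fc_and : forall p q, C p -> C q -> C (FAnd p q);
  fc_or : forall p q, C p -> C q -> C (FOr p q);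
  fc_imp : forall p q, C p -> C q -> C (FImp p q);
  fc_ball : forall t p, C p -> C (FAllN (FImp (FLt (TVar 0) (lift t)) p));
  fc_bex : forall t p, C p -> C (FExN (FAnd (FLt (TVar 0) (lift t)) p));
  fc_ren : forall f g p, C p -> C (ren f g p)
}.

#[export] Instance form_class_Delta00 : form_class Delta00.
Proof.
  split; try (intros; constructor; auto; fail).
  intros f g p Hp; revert f; induction Hp; intros f; simpl; rewrite ?tren_lift;
    constructor; auto.
Qed.

#[export] Instance form_class_arithmetical : form_class arithmetical.
Proof.
  split; try (simpl; auto; fail).
  intros f g p; revert f; induction p; simpl; intuition.
Qed.

(* Even positions hold the variables, odd positions the parameters. *)
Definition join {A} (a b : nat -> A) (k : nat) : A :=
  if Nat.even k then a (Nat.div2 k) else b (Nat.div2 k).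

Lemma even_or_odd k : (exists j, k = 2 * j) \/ (exists j, k = S (2 * j)).
Proof. destruct (Nat.Even_or_Odd k) as [[j ->]|[j ->]]; [left|right]; exists j; lia. Qed.

Lemma even_double j : Nat.even (2 * j) = true.
Proof. rewrite Nat.even_mul; reflexivity. Qed.

Lemma even_succ_double j : Nat.even (S (2 * j)) = false.
Proof. rewrite Nat.even_succ, <- Nat.negb_even, even_double; reflexivity. Qed.

Lemma join_even {A} (a b : nat -> A) k : join a b (2 * k) = a k.
Proof. unfold join; rewrite even_double, Nat.div2_double; reflexivity. Qed.

Lemma join_odd {A} (a b : nat -> A) k : join a b (S (2 * k)) = b k.
Proof. unfold join; rewrite even_succ_double, Nat.div2_succ_double; reflexivity. Qed.

(** Two formulas with parameter lists [a] and [b] need a common list before a connective can join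
    them; [ren_left] and [ren_right] move them to [join a b]. *)
Definition ren_left (k : nat) : nat :=
  if Nat.even k then k else S (2 * (2 * Nat.div2 k)).
Definition ren_right (k : nat) : nat :=
  if Nat.even k then k else S (2 * S (2 * Nat.div2 k)).
(** Splits off variable 0 from the interleaved variables and parameters, so that a quantifier can
    bind it. *)
Definition ren_open (k : nat) : nat :=
  if Nat.even k then match Nat.div2 k with O => O | S j => S (2 * j) end else S k.

Lemma join_left {A} (e a b : nat -> A) :
  (fun k => join e (join a b) (ren_left k)) = join e a.
Proof.
  apply functional_extensionality; intros k; unfold ren_left.
  destruct (even_or_odd k) as [[j ->]|[j ->]].
  - rewrite even_double, !join_even; reflexivity.
  - rewrite even_succ_double, Nat.div2_succ_double, !join_odd, join_even; reflexivity.
Qed.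

Lemma join_right {A} (e a b : nat -> A) :
  (fun k => join e (join a b) (ren_right k)) = join e b.
Proof.
  apply functional_extensionality; intros k; unfold ren_right.
  destruct (even_or_odd k) as [[j ->]|[j ->]].
  - rewrite even_double, !join_even; reflexivity.
  - rewrite even_succ_double, Nat.div2_succ_double, !join_odd; reflexivity.
Qed.

Lemma join_open {A} (x : A) (e a : nat -> A) :
  (fun k => scons x (join e a) (ren_open k)) = join (scons x e) a.
Proof.
  apply functional_extensionality; intros k; unfold ren_open.
  destruct (even_or_odd k) as [[j ->]|[j ->]].
  - rewrite even_double, Nat.div2_double, join_even; destruct j as [|j]; [reflexivity|].
    exact (join_even e a j).
  - rewrite even_succ_double, join_odd; exact (join_odd e a j).
Qed.

Section Definability.
Context {M : L2_structure}.

Local Notation env := (nat -> num M).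
Local Notation senv := (nat -> nset M).

Definition Term (f : env -> num M) : Prop :=
  exists t a, forall e, f e = eval (join e a) t.

Definition STerm (f : senv -> nset M) : Prop :=
  exists k B, forall E, f E = join E B k.

(** A formula is replaced by the predicate that it defines, with its parameters hidden. Any element
    or set of the model may thus occur in a definition as a Rocq constant. *)
Definition Def (C : form -> Prop) (P : env -> senv -> Prop) : Prop :=
  exists p a B, C p /\ forall e E, P e E <-> sat (join e a) (join E B) p.

Definition Sig (P : env -> senv -> Prop) : Prop :=
  exists Q, Def Delta00 Q /\ forall e E, P e E <-> exists x, Q (scons x e) E.

Lemma Term_var k : Term (fun e => e k).
Proof. exists (TVar (2 * k)), (fun _ => zero); intros e; symmetry; exact (join_even e _ k). Qed.

Lemma Term_const c : Term (fun _ => c).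
Proof. exists (TVar 1), (fun _ => c); reflexivity. Qed.

Lemma Term2 f g : Term f -> Term g -> exists s t a, forall e,
  f e = eval (join e a) s /\ g e = eval (join e a) t.
Proof.
  intros (s & a & Hs) (t & b & Ht).
  exists (tren ren_left s), (tren ren_right t), (join a b); intros e.
  rewrite !eval_tren, join_left, join_right; auto.
Qed.

Lemma Term_add f g : Term f -> Term g -> Term (fun e => add (f e) (g e)).
Proof.
  intros Hf Hg; destruct (Term2 f g Hf Hg) as (s & t & a & H).
  exists (TAdd s t), a; intros e; destruct (H e) as [-> ->]; reflexivity.
Qed.

Lemma Term_mul f g : Term f -> Term g -> Term (fun e => mul (f e) (g e)).
Proof.
  intros Hf Hg; destruct (Term2 f g Hf Hg) as (s & t & a & H).
  exists (TMul s t), a; intros e; destruct (H e) as [-> ->]; reflexivity.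
Qed.

Lemma Term_pair f g : Term f -> Term g -> Term (fun e => pair (f e) (g e)).
Proof. intros; unfold pair; repeat first [apply Term_add | apply Term_mul]; assumption. Qed.

Lemma Term_subst f r : Term f -> (forall k, Term (fun e => r e k)) -> Term (fun e => f (r e)).
Proof.
  intros (t & a & Ht) Hr.
  enough (H : Term (fun e => eval (join (r e) a) t)).
  { destruct H as (t' & a' & H); exists t', a'; intros e; rewrite Ht; apply H. }
  clear Ht; induction t as [k| | |s IHs t IHt|s IHs t IHt]; simpl.
  - destruct (even_or_odd k) as [[j ->]|[j ->]].
    + destruct (Hr j) as (t & b & H); exists t, b; intros e; rewrite join_even; auto.
    + destruct (Term_const (a j)) as (t & b & H); exists t, b; intros e; rewrite join_odd; auto.
  - apply Term_const.
  - apply Term_const.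
  - apply Term_add; assumption.
  - apply Term_mul; assumption.
Qed.

Lemma STerm_var k : STerm (fun E => E k).
Proof. destruct (nset_inhabited M) as [X]. exists (2 * k), (fun _ => X); intros E; rewrite join_even; reflexivity. Qed.

Lemma STerm_const X : STerm (fun _ => X).
Proof. exists 1, (fun _ => X); reflexivity. Qed.

Section Class.
Context (C : form -> Prop) {HC : form_class C}.

Lemma Def_ext P Q : (forall e E, P e E <-> Q e E) -> Def C Q -> Def C P.
Proof.
  intros H (p & a & B & Hp & Hs); exists p, a, B; split; [exact Hp|].
  intros e E; rewrite H; apply Hs.
Qed.

Lemma Def2 P Q : Def C P -> Def C Q -> exists p q a B, C p /\ C q /\
  forall e E, (P e E <-> sat (join e a) (join E B) p) /\ (Q e E <-> sat (join e a) (join E B) q).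
Proof.
  intros (p & a & A & Hp & HP) (q & b & B & Hq & HQ).
  exists (ren ren_left ren_left p), (ren ren_right ren_right q), (join a b), (join A B).
  repeat split; try (apply fc_ren; assumption); intros H;
    rewrite ?sat_ren, ?join_left, ?join_right in *; apply HP || apply HQ; exact H.
Qed.

Lemma Def_not P : Def C P -> Def C (fun e E => ~ P e E).
Proof.
  intros (p & a & B & Hp & HP); exists (FNot p), a, B; split; [apply fc_not; exact Hp|].
  intros e E; simpl; rewrite HP; reflexivity.
Qed.

Lemma Def_and P Q : Def C P -> Def C Q -> Def C (fun e E => P e E /\ Q e E).
Proof.
  intros HP HQ; destruct (Def2 P Q HP HQ) as (p & q & a & B & Hp & Hq & H).
  exists (FAnd p q), a, B; split; [apply fc_and; assumption|].
  intros e E; simpl; destruct (H e E) as [-> ->]; reflexivity.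
Qed.

Lemma Def_or P Q : Def C P -> Def C Q -> Def C (fun e E => P e E \/ Q e E).
Proof.
  intros HP HQ; destruct (Def2 P Q HP HQ) as (p & q & a & B & Hp & Hq & H).
  exists (FOr p q), a, B; split; [apply fc_or; assumption|].
  intros e E; simpl; destruct (H e E) as [-> ->]; reflexivity.
Qed.

Lemma Def_imp P Q : Def C P -> Def C Q -> Def C (fun e E => P e E -> Q e E).
Proof.
  intros HP HQ; destruct (Def2 P Q HP HQ) as (p & q & a & B & Hp & Hq & H).
  exists (FImp p q), a, B; split; [apply fc_imp; assumption|].
  intros e E; simpl; destruct (H e E) as [-> ->]; reflexivity.
Qed.

Lemma Def_iff P Q : Def C P -> Def C Q -> Def C (fun e E => P e E <-> Q e E).
Proof. intros; apply Def_and; apply Def_imp; assumption. Qed.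

Lemma Def_eq f g : Term f -> Term g -> Def C (fun e _ => f e = g e).
Proof.
  intros Hf Hg; destruct (Term2 f g Hf Hg) as (s & t & a & H).
  destruct (nset_inhabited M) as [X].
  exists (FEq s t), a, (fun _ => X); split; [apply fc_eq|].
  intros e E; simpl; destruct (H e) as [-> ->]; reflexivity.
Qed.

Lemma Def_lt f g : Term f -> Term g -> Def C (fun e _ => lt (f e) (g e)).
Proof.
  intros Hf Hg; destruct (Term2 f g Hf Hg) as (s & t & a & H).
  destruct (nset_inhabited M) as [X].
  exists (FLt s t), a, (fun _ => X); split; [apply fc_lt|].
  intros e E; simpl; destruct (H e) as [-> ->]; reflexivity.
Qed.

Lemma Def_mem f X : Term f -> STerm X -> Def C (fun e E => mem (f e) (X E)).
Proof.
  intros (t & a & Ht) (k & B & HX); exists (FMem t k), a, B; split; [apply fc_mem|].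
  intros e E; simpl; rewrite Ht, HX; reflexivity.
Qed.

Lemma Def_True : Def C (fun _ _ => True).
Proof.
  eapply Def_ext; [|apply (Def_eq (fun _ => zero) (fun _ => zero)); apply Term_const].
  intuition.
Qed.

Lemma Def_False : Def C (fun _ _ => False).
Proof. eapply Def_ext; [|apply Def_not, Def_True]. intuition. Qed.

(** Excluded middle outside the model turns [P] into a true or a false formula, even if [P] itself
    is not expressible. *)
Lemma Def_const (P : Prop) : Def C (fun _ _ => P).
Proof.
  destruct (classic P) as [H|H]; [apply (Def_ext _ (fun _ _ => True))
    | apply (Def_ext _ (fun _ _ => False))]; try intuition.
  - apply Def_True.
  - apply Def_False.
Qed.

Lemma Def_open P : Def C P -> exists p a B, C p /\ forall x e E,
  P (scons x e) E <-> sat (scons x (join e a)) (join E B) p.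
Proof.
  intros (p & a & B & Hp & HP); exists (ren ren_open (fun k => k) p), a, B.
  split; [apply fc_ren; exact Hp|].
  intros x e E; rewrite HP, sat_ren, join_open; reflexivity.
Qed.

Lemma Def_open2 P : Def C P -> exists p a B, C p /\ forall x y e E,
  P (scons x (scons y e)) E <-> sat (scons x (scons y (join e a))) (join E B) p.
Proof.
  intros (p & a & B & Hp & HP)%Def_open.
  exists (ren (up ren_open) (fun k => k) p), a, B.
  split; [apply fc_ren; exact Hp|].
  intros x y e E; rewrite HP, sat_ren, scons_up, join_open; reflexivity.
Qed.

(** Delta comprehension evaluates its two formulas in the same environment, so their parameters must
    be common. *)
Lemma Def2_open2 P Q : Def C P -> Def C Q -> exists p q a B, C p /\ C q /\
  forall x y e E,
    (P (scons x (scons y e)) E <-> sat (scons x (scons y (join e a))) (join E B) p) /\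
    (Q (scons x (scons y e)) E <-> sat (scons x (scons y (join e a))) (join E B) q).
Proof.
  intros HP HQ; destruct (Def2 P Q HP HQ) as (p & q & a & B & Hp & Hq & H).
  exists (ren (up ren_open) (fun k => k) (ren ren_open (fun k => k) p)),
    (ren (up ren_open) (fun k => k) (ren ren_open (fun k => k) q)), a, B.
  split; [apply fc_ren, fc_ren; exact Hp|]; split; [apply fc_ren, fc_ren; exact Hq|].
  assert (Hr : forall r x y e E, sat (join (scons x (scons y e)) a) E r <->
    sat (scons x (scons y (join e a))) E (ren (up ren_open) (fun k => k) (ren ren_open (fun k => k) r))).
  { intros r x y e E; rewrite sat_ren, scons_up, join_open, sat_ren, join_open; reflexivity. }
  intros x y e E; rewrite <- !Hr; apply H.
Qed.

Lemma Def_bound f P : Term f -> Def C P -> exists t p a B, C p /\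
  (forall e, f e = eval (join e a) t) /\
  forall x e E, P (scons x e) E <-> sat (scons x (join e a)) (join E B) p.
Proof.
  intros (t & b & Ht) (p & a & B & Hp & HP).
  exists (tren ren_right t), (ren ren_open (fun k => k) (ren ren_left ren_left p)),
    (join a b), (join B B).
  split; [apply fc_ren, fc_ren; exact Hp|]; split.
  - intros e; rewrite eval_tren, join_right; apply Ht.
  - intros x e E; rewrite HP, !sat_ren.
    rewrite <- (join_left (scons x e) a b), <- (join_left E B B).
    rewrite <- (join_open x e (join a b)); reflexivity.
Qed.

Lemma Def_ball f P : Term f -> Def C (fun e E => P (e 0) (fun k => e (S k)) E) ->
  Def C (fun e E => forall x, lt x (f e) -> P x e E).
Proof.
  intros Hf HP; destruct (Def_bound _ _ Hf HP) as (t & p & a & B & Hp & Ht & H).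
  exists (FAllN (FImp (FLt (TVar 0) (lift t)) p)), a, B; split; [apply fc_ball; exact Hp|].
  intros e E; simpl; split; intros HH x Hx.
  - apply H; apply HH; rewrite eval_lift, <- Ht in Hx; exact Hx.
  - apply (H x e E), HH; rewrite eval_lift, <- Ht; exact Hx.
Qed.

Lemma Def_bex f P : Term f -> Def C (fun e E => P (e 0) (fun k => e (S k)) E) ->
  Def C (fun e E => exists x, lt x (f e) /\ P x e E).
Proof.
  intros Hf HP; destruct (Def_bound _ _ Hf HP) as (t & p & a & B & Hp & Ht & H).
  exists (FExN (FAnd (FLt (TVar 0) (lift t)) p)), a, B; split; [apply fc_bex; exact Hp|].
  intros e E; simpl; split; intros (x & Hx & HH); exists x; split.
  - rewrite eval_lift, <- Ht; exact Hx.
  - apply H; exact HH.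
  - rewrite eval_lift, <- Ht in Hx; exact Hx.
  - apply (H x e E); exact HH.
Qed.

End Class.

Lemma Def_allN P : Def arithmetical (fun e E => P (e 0) (fun k => e (S k)) E) ->
  Def arithmetical (fun e E => forall x, P x e E).
Proof.
  intros (p & a & B & Hp & H)%Def_open; [|exact _].
  exists (FAllN p), a, B; split; [exact Hp|].
  intros e E; simpl; split; intros HH x; apply (H x e E); apply HH.
Qed.

Lemma Def_exN P : Def arithmetical (fun e E => P (e 0) (fun k => e (S k)) E) ->
  Def arithmetical (fun e E => exists x, P x e E).
Proof.
  intros (p & a & B & Hp & H)%Def_open; [|exact _].
  exists (FExN p), a, B; split; [exact Hp|].
  intros e E; simpl; split; intros [x HH]; exists x; apply (H x e E); apply HH.
Qed.

(** A set substituted for a set variable needs only a definable membership relation, which replaces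
    the atoms [FMem]; the set may depend on number variables. *)
Definition SDef (C : form -> Prop) (G : env -> senv -> senv) : Prop :=
  forall k f r, Term f -> (forall j, Term (fun e => r e j)) ->
    Def C (fun e E => mem (f e) (G (r e) E k)).

Lemma Term_shift f : Term f -> Term (fun e => f (fun k => e (S k))).
Proof. intros H; apply Term_subst; [exact H|]; intros k; apply Term_var. Qed.

Lemma Term_joined r a k : (forall j, Term (fun e => r e j)) -> Term (fun e => join (r e) a k).
Proof.
  intros Hr; destruct (even_or_odd k) as [[j ->]|[j ->]].
  - destruct (Hr j) as (t & b & H); exists t, b; intros e; rewrite join_even; auto.
  - destruct (Term_const (a j)) as (t & b & H); exists t, b; intros e; rewrite join_odd; auto.
Qed.

Lemma Term_eval t r : (forall k, Term (fun e => r e k)) -> Term (fun e => eval (r e) t).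
Proof.
  intros Hr; induction t; simpl; auto using Term_const, Term_add, Term_mul.
Qed.

Lemma sat_subst_Delta00 C {HC : form_class C} p : Delta00 p -> forall r G s,
  (forall k, Term (fun e => r e k)) -> (forall k, Term (fun e => s e k)) -> SDef C G ->
  Def C (fun e E => sat (r e) (G (s e) E) p).
Proof.
  induction 1; intros r G u Hr Hu HG; simpl.
  - apply Def_eq; try exact _; apply Term_eval; exact Hr.
  - apply Def_lt; try exact _; apply Term_eval; exact Hr.
  - apply HG; [apply Term_eval; exact Hr | exact Hu].
  - apply Def_not; auto.
  - apply Def_and; auto.
  - apply Def_or; auto.
  - apply Def_imp; auto.
  - eapply Def_ext; [|apply (Def_ball C (fun e => eval (r e) t)
      (fun x e E => sat (scons x (r e)) (G (u e) E) p))].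
    + intros e E; split; intros HH x Hx; apply HH; rewrite eval_lift in *; exact Hx.
    + apply Term_eval; exact Hr.
    + apply IHDelta00; [|intros k; apply (Term_shift (fun e => u e k)); auto|exact HG].
      intros [|k]; simpl; [apply Term_var|apply (Term_shift (fun e => r e k)); auto].
  - eapply Def_ext; [|apply (Def_bex C (fun e => eval (r e) t)
      (fun x e E => sat (scons x (r e)) (G (u e) E) p))].
    + intros e E; split; intros (x & Hx & HH); exists x; rewrite eval_lift in *; auto.
    + apply Term_eval; exact Hr.
    + apply IHDelta00; [|intros k; apply (Term_shift (fun e => u e k)); auto|exact HG].
      intros [|k]; simpl; [apply Term_var|apply (Term_shift (fun e => r e k)); auto].
Qed.

Lemma sat_subst_arith p : arithmetical p -> forall r G s,
  (forall k, Term (fun e => r e k)) -> (forall k, Term (fun e => s e k)) -> SDef arithmetical G ->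
  Def arithmetical (fun e E => sat (r e) (G (s e) E) p).
Proof.
  induction p; intros Hp r G u Hr Hu HG; simpl in Hp |- *; try tauto.
  - apply Def_eq; try exact _; apply Term_eval; exact Hr.
  - apply Def_lt; try exact _; apply Term_eval; exact Hr.
  - apply HG; [apply Term_eval; exact Hr | exact Hu].
  - apply Def_not; try exact _; auto.
  - apply Def_and; try exact _; intuition.
  - apply Def_or; try exact _; intuition.
  - apply Def_imp; try exact _; intuition.
  - apply (Def_allN (fun x e E => sat (scons x (r e)) (G (u e) E) p)).
    apply IHp; [exact Hp| |intros k; apply (Term_shift (fun e => u e k)); auto|exact HG].
    intros [|k]; simpl; [apply Term_var|apply (Term_shift (fun e => r e k)); auto].
  - apply (Def_exN (fun x e E => sat (scons x (r e)) (G (u e) E) p)).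
    apply IHp; [exact Hp| |intros k; apply (Term_shift (fun e => u e k)); auto|exact HG].
    intros [|k]; simpl; [apply Term_var|apply (Term_shift (fun e => r e k)); auto].
Qed.

Lemma SDef_join C {HC : form_class C} G B : SDef C G -> SDef C (fun e E => join (G e E) B).
Proof.
  intros HG k f r Hf Hr; destruct (even_or_odd k) as [[j ->]|[j ->]].
  - eapply Def_ext; [|apply (HG j f r Hf Hr)]; intros; rewrite join_even; reflexivity.
  - eapply Def_ext; [|apply (Def_mem C f (fun _ => B j) Hf), STerm_const].
    intros; rewrite join_odd; reflexivity.
Qed.

Lemma Def_subst_Delta00 C {HC : form_class C} P r G : Def Delta00 P ->
  (forall k, Term (fun e => r e k)) -> SDef C G ->
  Def C (fun e E => P (r e) (G e E)).
Proof.
  intros (p & a & B & Hp & HP) Hr HG.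
  eapply Def_ext; [intros e E; apply HP|].
  apply (sat_subst_Delta00 C p Hp (fun e => join (r e) a) (fun e E => join (G e E) B) (fun e => e)).
  - intros k; apply Term_joined; exact Hr.
  - intros k; apply Term_var.
  - apply SDef_join; assumption.
Qed.

Lemma Def_subst_arith P r G : Def arithmetical P ->
  (forall k, Term (fun e => r e k)) -> SDef arithmetical G ->
  Def arithmetical (fun e E => P (r e) (G e E)).
Proof.
  intros (p & a & B & Hp & HP) Hr HG.
  eapply Def_ext; [intros e E; apply HP|].
  apply (sat_subst_arith p Hp (fun e => join (r e) a) (fun e E => join (G e E) B) (fun e => e)).
  - intros k; apply Term_joined; exact Hr.
  - intros k; apply Term_var.
  - apply SDef_join; [exact _|assumption].
Qed.

Lemma SDef_STerm C {HC : form_class C} (G : senv -> senv) :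
  (forall k, STerm (fun E => G E k)) -> SDef C (fun _ E => G E).
Proof. intros H k f r Hf Hr; apply (Def_mem C f (fun E => G E k)); auto. Qed.

Lemma Def_subst0 P r G : Def Delta00 P -> (forall k, Term (fun e => r e k)) ->
  (forall k, STerm (fun E => G E k)) -> Def Delta00 (fun e E => P (r e) (G E)).
Proof.
  intros HP Hr HG; apply (Def_subst_Delta00 _ P r (fun _ E => G E)); try assumption.
  apply SDef_STerm; [exact _|assumption].
Qed.

Lemma Term_scons x r k : Term x -> (forall j, Term (fun e => r e j)) ->
  Term (fun e => scons (x e) (r e) k).
Proof. destruct k; simpl; auto. Qed.

Lemma STerm_scons X G k : STerm X -> (forall j, STerm (fun E => G E j)) ->
  STerm (fun E => scons (X E) (G E) k).
Proof. destruct k; simpl; auto. Qed.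

Lemma eval_agree t : exists N, forall e e' : env,
  (forall k, k < N -> e k = e' k) -> eval e t = eval e' t.
Proof.
  induction t as [k| | |s [N1 H1] t [N2 H2]|s [N1 H1] t [N2 H2]]; simpl.
  - exists (S k); auto.
  - exists 0; auto.
  - exists 0; auto.
  - exists (N1 + N2); intros e e' H; rewrite (H1 e e'), (H2 e e'); auto; intros; apply H; lia.
  - exists (N1 + N2); intros e e' H; rewrite (H1 e e'), (H2 e e'); auto; intros; apply H; lia.
Qed.

Lemma sat_agree p : exists N, forall (e e' : env) E,
  (forall k, k < N -> e k = e' k) -> sat e E p <-> sat e' E p.
Proof.
  induction p as [s t|s t|s k|p [N H]|p [N1 H1] q [N2 H2]|p [N1 H1] q [N2 H2]
    |p [N1 H1] q [N2 H2]|p [N H]|p [N H]|p [N H]|p [N H]]; simpl.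
  - destruct (eval_agree s) as [N1 H1], (eval_agree t) as [N2 H2]; exists (N1 + N2).
    intros e e' E H; rewrite (H1 e e'), (H2 e e'); try reflexivity; intros; apply H; lia.
  - destruct (eval_agree s) as [N1 H1], (eval_agree t) as [N2 H2]; exists (N1 + N2).
    intros e e' E H; rewrite (H1 e e'), (H2 e e'); try reflexivity; intros; apply H; lia.
  - destruct (eval_agree s) as [N1 H1]; exists N1; intros e e' E H; rewrite (H1 e e'); tauto.
  - exists N; intros e e' E HH; rewrite (H e e'); tauto.
  - exists (N1 + N2); intros e e' E H; rewrite (H1 e e'), (H2 e e'); try tauto; intros; apply H; lia.
  - exists (N1 + N2); intros e e' E H; rewrite (H1 e e'), (H2 e e'); try tauto; intros; apply H; lia.
  - exists (N1 + N2); intros e e' E H; rewrite (H1 e e'), (H2 e e'); try tauto; intros; apply H; lia.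
  - exists N; intros e e' E HH; split; intros Hs n; specialize (Hs n);
      eapply H; try exact Hs; intros [|k] Hk; simpl; auto; rewrite HH; auto; lia.
  - exists N; intros e e' E HH; split; intros [n Hs]; exists n;
      eapply H; try exact Hs; intros [|k] Hk; simpl; auto; rewrite HH; auto; lia.
  - exists N; intros e e' E HH; split; intros Hs n; specialize (Hs n);
      eapply H; try exact Hs; intros; auto; rewrite HH; auto.
  - exists N; intros e e' E HH; split; intros [n Hs]; exists n;
      eapply H; try exact Hs; intros; auto; rewrite HH; auto.
Qed.

(** The bound is a standard number read off the formula; it later fixes the arity of a Skolem
    function. *)
Lemma Def_agree C P : Def C P -> exists N, forall e e' E,
  (forall k, k < N -> e k = e' k) -> P e E <-> P e' E.
Proof.
  intros (p & a & B & _ & HP); destruct (sat_agree p) as [N HN]; exists N.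
  intros e e' E H; rewrite !HP; apply HN; intros k Hk.
  destruct (even_or_odd k) as [[j ->]|[j ->]]; rewrite ?join_even, ?join_odd; auto.
  apply H; lia.
Qed.

End Definability.

(** * Arithmetic in a model of RCA0 *)

Existing Class RCA0.

Ltac term :=
  cbv beta;
  first
    [ apply Term_var | apply Term_const | apply Term_add; term | apply Term_mul; term
    | apply Term_pair; term | assumption
    | match goal with
      | |- Term (fun e => ?f (fun k => @?r e k)) =>
          apply (Term_subst f r); [|intros ?]; term
      end ].

Ltac sterm := cbv beta; first [ apply STerm_var | apply STerm_const | assumption ].

Ltac def_user := fail.

Ltac def :=
  cbv beta;
  lazymatch goal with
  | |- form_class _ => exact _
  | |- Term _ => try term
  | |- STerm _ => try sterm
  | |- forall _, _ => intros; def
  | |- _ =>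
  first
  [ assumption
  | match goal with
    | |- Def _ (fun e E => exists x, lt x _ /\ _) => apply Def_bex; def
    | |- Def _ (fun e E => forall x, lt x _ -> _) => apply Def_ball; def
    | |- Def _ (fun e E => ~ _) => apply Def_not; def
    | |- Def _ (fun e E => (@?A e E) <-> (@?B e E)) => apply (Def_iff _ A B); def
    | |- Def _ (fun e E => (@?A e E) /\ (@?B e E)) => apply (Def_and _ A B); def
    | |- Def _ (fun e E => (@?A e E) \/ (@?B e E)) => apply (Def_or _ A B); def
    | |- Def _ (fun e E => (@?A e E) -> (@?B e E)) => apply (Def_imp _ A B); def
    | |- Def _ (fun e E => @eq (num _) _ _) => apply Def_eq; def
    | |- Def _ (fun e E => lt _ _) => apply Def_lt; def
    | |- Def _ (fun e E => mem _ _) => apply Def_mem; def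
    | |- Def arithmetical (fun e E => forall x : num _, _) => apply Def_allN; def
    | |- Def arithmetical (fun e E => exists x : num _, _) => apply Def_exN; def
    end
  | def_user
  | apply Def_const; exact _
  | idtac ]
  end.

Section Arithmetic.
Context {M : L2_structure} {HM : RCA0 M}.
Local Open Scope L2_scope.
Local Notation env := (nat -> num M).
Local Notation senv := (nat -> nset M).
Local Notation "x <= y" := (lt x (add y one)) : L2_scope.
Implicit Types (x y z a b c d i l m n q s t u v w : num M).

Lemma ind_sig (P : num M -> Prop) : Sig (fun e _ => P (e O)) ->
  P 0 -> (forall n, P n -> P (n + 1)) -> forall n, P n.
Proof.
  intros (Q & HQ & H) H0 HS n.
  destruct (Def_open2 _ _ HQ) as (p & a & B & Hp & Hs).
  destruct HM as (_ & Hind & _).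
  assert (Hp' : forall x, sat (scons x (join (fun _ => 0) a)) (join B B) (FExN p) <-> P x).
  { intros x; rewrite (H (scons x (fun _ => 0)) B); simpl.
    split; intros [y Hy]; exists y; apply Hs; exact Hy. }
  apply Hp', (Hind (FExN p)); [exists p; auto| |].
  - apply Hp'; exact H0.
  - intros m Hm; apply Hp', HS, Hp', Hm.
Qed.

Lemma Sig_Def P : Def Delta00 P -> Sig (M := M) P.
Proof.
  intros H; exists (fun e E => P (fun k => e (S k)) E); split.
  - apply (Def_subst0 P (fun e k => e (S k)) (fun E => E)); [exact H| |]; intros k.
    + apply Term_var.
    + apply STerm_var.
  - intros e E; split; [intros HP; exists 0; exact HP|intros [? HP]; exact HP].
Qed.

Lemma ind0 (P : num M -> Prop) : Def Delta00 (fun e _ => P (e O)) ->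
  P 0 -> (forall n, P n -> P (n + 1)) -> forall n, P n.
Proof. intros H; apply ind_sig, Sig_Def, H. Qed.

Lemma succ_neq0 n : n + 1 <> 0. Proof. apply HM. Qed.
Lemma succ_inj m n : m + 1 = n + 1 -> m = n. Proof. apply HM. Qed.
Lemma add_0r m : m + 0 = m. Proof. apply HM. Qed.
Lemma add_succr m n : m + (n + 1) = (m + n) + 1. Proof. apply HM. Qed.
Lemma mul_0r m : m * 0 = 0. Proof. apply HM. Qed.
Lemma mul_succr m n : m * (n + 1) = m * n + m. Proof. apply HM. Qed.
Lemma nlt_0 m : ~ m < 0. Proof. apply HM. Qed.
Lemma lt_succ m n : m <= n <-> (m < n \/ m = n). Proof. apply HM. Qed.

Lemma add_assoc x y z : x + (y + z) = (x + y) + z.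
Proof.
  revert z; apply ind0; [def| |].
  - rewrite !add_0r; reflexivity.
  - intros n H; rewrite !add_succr, H; reflexivity.
Qed.

Lemma add_0l x : 0 + x = x.
Proof.
  revert x; apply ind0; [def| |].
  - apply add_0r.
  - intros n H; rewrite add_succr, H; reflexivity.
Qed.

Lemma add_1l x : 1 + x = x + 1.
Proof.
  revert x; apply ind0; [def| |].
  - rewrite add_0r, add_0l; reflexivity.
  - intros n H; rewrite add_succr, H; reflexivity.
Qed.

Lemma add_comm x y : x + y = y + x.
Proof.
  revert y; apply ind0; [def| |].
  - rewrite add_0r, add_0l; reflexivity.
  - intros n H; rewrite add_succr, H, <- !add_assoc, add_1l; reflexivity.
Qed.

Lemma mul_0l x : 0 * x = 0.
Proof.
  revert x; apply ind0; [def| |].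
  - apply mul_0r.
  - intros n H; rewrite mul_succr, H; apply add_0r.
Qed.

Lemma mul_succl x y : (x + 1) * y = x * y + y.
Proof.
  revert y; apply ind0; [def| |].
  - rewrite !mul_0r, add_0r; reflexivity.
  - intros n H; rewrite !mul_succr, H, <- !add_assoc; f_equal.
    rewrite !add_assoc, (add_comm n x); reflexivity.
Qed.

Lemma mul_comm x y : x * y = y * x.
Proof.
  revert y; apply ind0; [def| |].
  - rewrite mul_0r, mul_0l; reflexivity.
  - intros n H; rewrite mul_succr, mul_succl, H; reflexivity.
Qed.

Lemma mul_addr x y z : x * (y + z) = x * y + x * z.
Proof.
  revert z; apply ind0; [def| |].
  - rewrite mul_0r, !add_0r; reflexivity.
  - intros n H; rewrite add_succr, !mul_succr, H, <- add_assoc; reflexivity.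
Qed.

Lemma mul_assoc x y z : x * (y * z) = (x * y) * z.
Proof.
  revert z; apply ind0; [def| |].
  - rewrite !mul_0r; reflexivity.
  - intros n H; rewrite !mul_succr, mul_addr, H; reflexivity.
Qed.

Lemma mul_1l x : 1 * x = x.
Proof. rewrite <- (add_0l 1), mul_succl, mul_0l; apply add_0l. Qed.

Lemma num_semiring : semi_ring_theory 0 1 (@add M) (@mul M) eq.
Proof.
  split; intros.
  - apply add_0l.
  - apply add_comm.
  - apply add_assoc.
  - apply mul_1l.
  - apply mul_0l.
  - apply mul_comm.
  - apply mul_assoc.
  - rewrite mul_comm, mul_addr, !(mul_comm p); reflexivity.
Qed.

Add Ring num_ring : num_semiring.

Lemma add_cancel x y z : x + z = y + z -> x = y.
Proof.
  revert z; apply (ind0 (fun z => x + z = y + z -> x = y)); [def| |].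
  - rewrite !add_0r; auto.
  - intros n H; rewrite !add_succr; intros HH%succ_inj; auto.
Qed.

Lemma add_cancel_l x y z : z + x = z + y -> x = y.
Proof. rewrite !(add_comm z); apply add_cancel. Qed.

Lemma lt_iff x y : x < y <-> exists k, y = x + k + 1.
Proof.
  split.
  - revert y; apply (ind_sig (fun y => x < y -> exists k, y = x + k + 1)).
    (* The witness is quantified in front of the implication to obtain a Sigma01 formula; where the
       premise fails, any witness serves. *)
    + exists (fun e _ => x < e 1%nat -> e 1%nat = x + e O + 1); split; [def|].
      intros e E; simpl; split; [|intros [k H] Hx; eauto].
      intros H; destruct (classic (x < e O)) as [Hx|Hx].
      * destruct (H Hx) as [k Hk]; exists k; auto.
      * exists 0; tauto.
    + intros []%nlt_0.
    + intros n IH [H| ->]%lt_succ.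
      * destruct (IH H) as [k ->]; exists (k + 1); ring.
      * exists 0; ring.
  - intros [k ->]; revert k; apply ind0; [def| |].
    + rewrite add_0r; apply lt_succ; auto.
    + intros n H; apply lt_succ; left; rewrite add_assoc; exact H.
Qed.

Lemma le_iff x y : x <= y <-> exists k, y = x + k.
Proof.
  rewrite lt_iff; split; intros [k H]; exists k.
  - apply succ_inj; exact H.
  - rewrite H; reflexivity.
Qed.

Lemma lt_irrefl x : ~ x < x.
Proof.
  intros [k H]%lt_iff; apply (succ_neq0 k); symmetry; apply (add_cancel _ _ x).
  rewrite add_0l; rewrite H at 1; ring.
Qed.

Lemma lt_trans x y z : x < y -> y < z -> x < z.
Proof.
  rewrite !lt_iff; intros [k ->] [k' ->]; exists (k + k' + 1); ring.
Qed.

Lemma le_refl x : x <= x.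
Proof. apply lt_succ; auto. Qed.

Lemma lt_le x y : x < y -> x <= y.
Proof. intros; apply lt_succ; auto. Qed.

Lemma le_trans x y z : x <= y -> y <= z -> x <= z.
Proof. rewrite !le_iff; intros [k ->] [k' ->]; exists (k + k'); ring. Qed.

Lemma lt_le_trans x y z : x < y -> y <= z -> x < z.
Proof. intros H [H'| ->]%lt_succ; eauto using lt_trans. Qed.

Lemma le_lt_trans x y z : x <= y -> y < z -> x < z.
Proof. intros [H'| ->]%lt_succ H; eauto using lt_trans. Qed.

Lemma le_lt_succ x y : x < y <-> x + 1 <= y.
Proof. rewrite le_iff, lt_iff; split; intros [k ->]; exists k; ring. Qed.

Lemma le_0l x : 0 <= x.
Proof. apply le_iff; exists x; ring. Qed.

Lemma lt_0_1 : (0 : num M) < 1.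
Proof. rewrite <- (add_0l 1); apply le_refl. Qed.

Lemma trichotomy x y : x < y \/ x = y \/ y < x.
Proof.
  revert y; apply ind0; [def| |].
  - destruct (proj1 (lt_succ 0 x) (le_0l x)); auto.
  - intros n [H|[->|H]].
    + left; apply lt_succ; auto.
    + left; apply le_refl.
    + apply le_lt_succ, lt_succ in H; destruct H; auto.
Qed.

Lemma nlt_le x y : ~ x < y <-> y <= x.
Proof.
  split.
  - intros H; apply lt_succ; destruct (trichotomy x y) as [?|[->|?]]; tauto.
  - intros H H'; exact (lt_irrefl _ (lt_le_trans _ _ _ H' H)).
Qed.

Lemma le_lt_dec x y : x <= y \/ y < x.
Proof. rewrite lt_succ; destruct (trichotomy x y) as [?|[?|?]]; auto. Qed.

Lemma le_antisym x y : x <= y -> y <= x -> x = y.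
Proof. intros [H| ->]%lt_succ H'; [|reflexivity]; apply nlt_le in H'; tauto. Qed.

Lemma le_addr x y : x <= x + y.
Proof. apply le_iff; eauto. Qed.

Lemma le_addl x y : x <= y + x.
Proof. rewrite (add_comm y x); apply le_addr. Qed.

Lemma add_lt_mono x y z : x < y -> x + z < y + z.
Proof. rewrite !lt_iff; intros [k ->]; exists k; ring. Qed.

Lemma add_le_mono x y u v : x <= y -> u <= v -> x + u <= y + v.
Proof. rewrite !le_iff; intros [k ->] [k' ->]; exists (k + k'); ring. Qed.

Lemma mul_le_mono x y u v : x <= y -> u <= v -> x * u <= y * v.
Proof. rewrite !le_iff; intros [k ->] [k' ->]; exists (x * k' + k * u + k * k'); ring. Qed.

Lemma zero_or_succ x : x = 0 \/ exists y, x = y + 1.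
Proof.
  destruct (proj1 (lt_succ 0 x) (le_0l x)) as [[k ->]%lt_iff|<-]; [right|left; reflexivity].
  exists k; ring.
Qed.

Lemma lt_0_neq x : 0 < x <-> x <> 0.
Proof.
  split.
  - intros H ->; exact (lt_irrefl _ H).
  - intros H; destruct (zero_or_succ x) as [->|[y ->]]; [tauto|].
    apply le_0l.
Qed.

Lemma strong_ind0 (P : num M -> Prop) : Def Delta00 (fun e _ => P (e O)) ->
  (forall n, (forall m, m < n -> P m) -> P n) -> forall n, P n.
Proof.
  intros HP H n; apply H.
  revert n; apply (ind0 (fun n => forall m, m < n -> P m)).
  - def.
  - intros m []%nlt_0.
  - intros n IH m [Hm| ->]%lt_succ; auto.
Qed.

Lemma least0 (P : num M -> Prop) : Def Delta00 (fun e _ => P (e O)) ->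
  forall n, P n -> exists m, P m /\ m <= n /\ forall k, k < m -> ~ P k.
Proof.
  intros HP n Hn; apply NNPP; intros Hno.
  assert (H : forall m, m <= n -> ~ P m).
  { apply (strong_ind0 (fun m => m <= n -> ~ P m)); [def|].
    intros m IH Hm HPm; apply Hno; exists m; repeat split; auto.
    intros k Hk; apply IH; [exact Hk|]; eapply lt_trans; [exact Hk|exact Hm]. }
  exact (H n (le_refl n) Hn).
Qed.

(** * Closure properties of Sigma01 predicates and the collection principle *)

Lemma Sig_ext (P Q : env -> senv -> Prop) : (forall e E, P e E <-> Q e E) -> Sig Q -> Sig P.
Proof. intros H (R & HR & HQ); exists R; split; [exact HR|]; intros; rewrite H; apply HQ. Qed.

Lemma Sig_subst P r G : Sig P -> (forall k, Term (fun e : env => r e k)) ->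
  (forall k, STerm (M := M) (fun E => G E k)) -> Sig (fun e E => P (r e) (G E)).
Proof.
  intros (Q & HQ & H) Hr HG.
  exists (fun e E => Q (scons (e O) (r (fun k => e (S k)))) (G E)); split.
  - apply (Def_subst0 Q (fun e => scons (e O) (r (fun k => e (S k)))) G); [exact HQ| |exact HG].
    intros k; apply (Term_scons (fun e => e O) (fun e => r (fun k => e (S k)))); [term|].
    intros j; apply (Term_shift (fun e => r e j)), Hr.
  - intros e E; apply H.
Qed.

(** Two unbounded witnesses are replaced by one common bound, for which their sum serves. *)
Lemma Sig_ex (P : num M -> env -> senv -> Prop) :
  Sig (fun e E => P (e O) (fun k => e (S k)) E) -> Sig (fun e E => exists x, P x e E).
Proof.
  intros (Q & HQ & H).
  exists (fun e E => exists x, x <= e O /\ exists y, y <= e O /\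
    Q (scons y (scons x (fun k => e (S k)))) E); split.
  - def.
    apply (Def_subst0 Q (fun e => scons (e O) (scons (e 1%nat) (fun k => e (S (S (S k)))))) (fun E => E));
      [exact HQ| |intros; sterm].
    intros [|[|k]]; simpl; term.
  - intros e E; split.
    + intros [x Hx]; apply (H (scons x e) E) in Hx; destruct Hx as [y Hy].
      exists (x + y), x; split; [apply le_addr|]; exists y; split; [apply le_addl|exact Hy].
    + intros (w & x & _ & y & _ & Hy); exists x; apply (H (scons x e) E); exists y; exact Hy.
Qed.

Lemma Sig_or (P Q : env -> senv -> Prop) : Sig P -> Sig Q -> Sig (fun e E => P e E \/ Q e E).
Proof.
  intros (P' & HP & H) (Q' & HQ & H').
  exists (fun e E => P' e E \/ Q' e E); split; [def|].
  intros e E; rewrite H, H'; split.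
    + intros [[x Hx]|[x Hx]]; exists x; auto.
    + intros [x [Hx|Hx]]; [left|right]; exists x; exact Hx.
Qed.

Lemma Sig_bex f (P : num M -> env -> senv -> Prop) : Term f ->
  Sig (fun e E => P (e O) (fun k => e (S k)) E) -> Sig (fun e E => exists x, x < f e /\ P x e E).
Proof.
  intros Hf (Q & HQ & H).
  exists (fun e E => exists x, x < f (fun k => e (S k)) /\ Q (scons (e O) (scons x (fun k => e (S k)))) E); split.
  - def.
    apply (Def_subst0 Q (fun e => scons (e 1%nat) (scons (e O) (fun k => e (S (S k))))) (fun E => E));
      [exact HQ| |intros; sterm].
    intros [|[|k]]; simpl; term.
  - intros e E; split.
    + intros (x & Hx & HP); apply (H (scons x e) E) in HP; destruct HP as [y Hy]; eauto.
    + intros (y & x & Hx & HP); exists x; split; [exact Hx|]; apply (H (scons x e) E); eauto.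
Qed.

Lemma Sig_and (P Q : env -> senv -> Prop) : Sig P -> Sig Q -> Sig (fun e E => P e E /\ Q e E).
Proof.
  intros HP (Q' & HQ & H).
  apply (Sig_ext _ (fun e E => exists x, P e E /\ Q' (scons x e) E)).
  { intros e E; rewrite H; split; [intros [HH [x Hx]]; exists x; auto|intros [x [HH Hx]]; split; [|exists x]; auto]. }
  apply Sig_ex; destruct HP as (P' & HP & H').
  exists (fun e E => P' (scons (e O) (fun k => e (S (S k)))) E /\ Q' (fun k => e (S k)) E); split.
  - def.
    + apply (Def_subst0 P' (fun e => scons (e O) (fun k => e (S (S k)))) (fun E => E)); [exact HP| |intros; sterm].
      intros [|k]; simpl; term.
    + apply (Def_subst0 Q' (fun e k => e (S k)) (fun E => E)); [exact HQ|intros; term|intros; sterm].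
  - intros e E; simpl; rewrite (H' (fun k => e (S k)) E).
    replace (scons (e O) (fun k => e (S k))) with e.
    { split; [intros [[y Hy] Hx]; exists y; auto|intros [y [Hy Hx]]; split; [exists y|]; auto]. }
    apply functional_extensionality; intros [|k]; reflexivity.
Qed.

Lemma Sig_imp (P Q : env -> senv -> Prop) : Def Delta00 P -> Sig Q -> Sig (fun e E => P e E -> Q e E).
Proof.
  intros HP HQ; apply (Sig_ext _ (fun e E => ~ P e E \/ Q e E)).
  { intros e E; destruct (classic (P e E)); tauto. }
  apply Sig_or; [apply Sig_Def; def|exact HQ].
Qed.

(** Sigma01 induction on [n] collects the bounds. The premise is too complex for the induction
    formula, so it stays outside for a fixed [N], and only [n <= N] is carried along. *)
Lemma collection0 (P : num M -> num M -> Prop) : Def Delta00 (fun e _ => P (e O) (e 1%nat)) ->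
  forall n, (forall i, i < n -> exists x, P i x) ->
  exists b, forall i, i < n -> exists x, x < b /\ P i x.
Proof.
  intros HP n; revert n.
  enough (H : forall N n, n <= N -> (forall i, i < N -> exists x, P i x) ->
     exists b, forall i, i < n -> exists x, x < b /\ P i x).
  { intros n; apply H, le_refl. }
  intros N n Hn HN; revert n Hn.
  apply (ind_sig (fun n => n <= N -> exists b, forall i, i < n -> exists x, x < b /\ P i x)).
  - apply Sig_imp; [def|].
    exists (fun e E => forall i, i < e 1%nat -> exists x, x < e O /\ P i x); split.
    + def. apply (Def_subst0 _ (fun e k => match k with O => e 1%nat | _ => e O end) (fun E => E) HP).
      * intros [|k]; term.
      * intros; sterm.
    + reflexivity.
  - intros _; exists 0; intros i []%nlt_0.
  - intros n IH Hn; destruct IH as [b Hb].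
    { apply lt_le; apply le_lt_succ; exact Hn. }
    destruct (HN n) as [x Hx]; [apply le_lt_succ; exact Hn|].
    exists (b + x + 1); intros i [Hi| ->]%lt_succ.
    + destruct (Hb i Hi) as (y & Hy & Hiy); exists y; split; [|exact Hiy].
      eapply lt_le_trans; [exact Hy|]; apply le_iff; exists (x + 1); ring.
    + exists x; split; [apply le_addl|exact Hx].
Qed.

(** Collection exchanges the bounded universal quantifier with the existential one. *)
Lemma Sig_ball f (P : num M -> env -> senv -> Prop) : Term f ->
  Sig (fun e E => P (e O) (fun k => e (S k)) E) -> Sig (fun e E => forall x, x < f e -> P x e E).
Proof.
  intros Hf (Q & HQ & H).
  exists (fun e E => forall x, x < f (fun k => e (S k)) -> exists y, y < e O /\
    Q (scons y (scons x (fun k => e (S k)))) E); split.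
  - def.
    apply (Def_subst0 Q (fun e => scons (e O) (scons (e 1%nat) (fun k => e (S (S (S k)))))) (fun E => E));
      [exact HQ| |intros; sterm].
    intros [|[|k]]; simpl; term.
  - intros e E; split.
    + intros HP.
      destruct (collection0 (fun x y => Q (scons y (scons x e)) E)) with (n := f e) as [b Hb];
        [| |exists b; exact Hb].
      * apply (Def_subst_Delta00 Delta00 Q (fun e' => scons (e' 1%nat) (scons (e' O) e)) (fun _ _ => E)).
        -- exact HQ.
        -- intros [|[|k]]; simpl; term.
        -- apply SDef_STerm; [exact _|intros; sterm].
      * intros i Hi; apply (H (scons i e) E), HP, Hi.
    + intros [b Hb] x Hx; destruct (Hb x Hx) as (y & _ & Hy).
      apply (H (scons x e) E); eauto.
Qed.

End Arithmetic.

(** * Coding of finite sequences *)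

Ltac sig :=
  cbv beta;
  lazymatch goal with
  | |- Term _ => term
  | |- STerm _ => sterm
  | |- Def _ _ => def
  | |- _ =>
  first
  [ assumption
  | solve [apply Sig_Def; def]
  | match goal with
    | |- Sig (fun e E => exists x, lt x _ /\ _) => apply Sig_bex; sig
    | |- Sig (fun e E => forall x, lt x _ -> _) => apply Sig_ball; sig
    | |- Sig (fun e E => (@?A e E) /\ (@?B e E)) => apply (Sig_and A B); sig
    | |- Sig (fun e E => (@?A e E) \/ (@?B e E)) => apply (Sig_or A B); sig
    | |- Sig (fun e E => (@?A e E) -> (@?B e E)) => apply (Sig_imp A B); sig
    | |- Sig (fun e E => exists x : num _, _) => apply Sig_ex; sig
    end
  | idtac ]
  end.

Section Coding.
Context {M : L2_structure} {HM : RCA0 M}.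
Local Open Scope L2_scope.
Local Notation env := (nat -> num M).
Local Notation senv := (nat -> nset M).
Local Notation "x <= y" := (lt x (add y one)) : L2_scope.
Implicit Types (x y z a b c d i l m n q s t u v w : num M).

Add Ring num_ring' : (num_semiring (M := M)).

(** * Pairing, division with remainder and the Chinese remainder theorem *)

Lemma le_square x : x <= x * x.
Proof.
  apply le_iff; destruct (zero_or_succ x) as [->|[y ->]]; [exists 0|exists (y * (y + 1))]; ring.
Qed.

Lemma pair_fst_le x y : x <= pair x y.
Proof. apply le_addl. Qed.

Lemma pair_snd_le x y : y <= pair x y.
Proof.
  unfold pair; eapply le_trans; [apply (le_addl y x)|].
  eapply le_trans; [apply le_square|apply le_addr].
Qed.

(** With s = x + y the code lies between the square of s and that square plus s, hence below the
    next square; so the code determines s. *)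
Lemma pair_sum_inj_aux x y x' y' : pair x y = pair x' y' -> ~ x + y < x' + y'.
Proof.
  unfold pair; intros H [k Hk]%lt_iff; rewrite Hk in H.
  apply (lt_irrefl x), lt_iff.
  (* Expanding the square of [x + y + k + 1] in [H] yields x = x + w + 1 for this witness w. *)
  exists (x + (1 + 1) * y + (1 + 1) * (x + y) * k + k * k + (1 + 1) * k + x').
  apply (add_cancel _ _ ((x + y) * (x + y))).
  transitivity ((x + y) * (x + y) + x); [ring|rewrite H; ring].
Qed.

Lemma pair_inj x y x' y' : pair x y = pair x' y' -> x = x' /\ y = y'.
Proof.
  intros H; assert (Hs : x + y = x' + y').
  { destruct (trichotomy (x + y) (x' + y')) as [Hl|[Hl|Hl]]; [|exact Hl|].
    - apply pair_sum_inj_aux in H; tauto.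
    - symmetry in H; apply pair_sum_inj_aux in H; tauto. }
  unfold pair in H; rewrite Hs in H.
  assert (Hx : x = x').
  { exact (add_cancel_l _ _ _ H). }
  split; [exact Hx|]; subst x'; exact (add_cancel_l _ _ _ Hs).
Qed.

Lemma pair_lt_fst x x' y : x < x' -> pair x y < pair x' y.
Proof.
  rewrite !lt_iff; intros [k ->]; unfold pair.
  exists ((1 + 1) * (x + y) * (k + 1) + k * k + k + k + (k + 1)); ring.
Qed.

Lemma division a d : 0 < d -> exists q r, a = q * d + r /\ r < d.
Proof.
  intros Hd; enough (H : exists q, q <= a /\ exists r, r < d /\ a = q * d + r).
  { destruct H as (q & _ & r & ? & ?); exists q, r; auto. }
  revert a; apply ind0; [def| |].
  - exists 0; split; [apply le_refl|]; exists 0; split; [exact Hd|ring].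
  - intros n (q & Hq & r & Hr & E).
    apply le_lt_succ, lt_succ in Hr; destruct Hr as [Hr|Hr].
    + exists q; split; [apply lt_le; exact Hq|]; exists (r + 1); split; [exact Hr|].
      rewrite E; ring.
    + exists (q + 1); split; [apply add_lt_mono; exact Hq|]; exists 0; split; [exact Hd|].
      rewrite E, <- Hr; ring.
Qed.

Lemma mod_unique_aux d p q x y : x < d -> p * d + x = q * d + y -> ~ p < q.
Proof.
  intros Hx H [k ->]%lt_iff; apply (lt_irrefl d).
  eapply le_lt_trans; [|exact Hx]; apply le_iff; exists (k * d + y).
  apply (add_cancel_l _ _ (p * d)); rewrite H; ring.
Qed.

Lemma mod_unique d p q x y : x < d -> y < d -> p * d + x = q * d + y -> x = y.
Proof.
  intros Hx Hy H; destruct (trichotomy p q) as [Hl|[->|Hl]].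
  - apply mod_unique_aux in H; tauto.
  - exact (add_cancel_l _ _ _ H).
  - symmetry in H; apply mod_unique_aux in H; tauto.
Qed.

Lemma remainder_unique a d x y : remainder a d x -> remainder a d y -> x = y.
Proof.
  intros [Hx [p Hp]] [Hy [q Hq]]; apply (mod_unique d p q); auto.
  rewrite <- Hp, <- Hq; reflexivity.
Qed.

Lemma remainder_exists a d : 0 < d -> exists x, remainder a d x.
Proof.
  intros Hd; destruct (division a d Hd) as (q & r & E & Hr); exists r; split; eauto.
Qed.

Lemma remainder_le a d x : remainder a d x -> x <= a.
Proof. intros [_ [q ->]]; apply le_addl. Qed.

(** Multiples of [d] are added on both sides because numbers cannot be subtracted. *)
Definition cong d x y : Prop := exists u v, x + u * d = y + v * d.

Lemma cong_refl d x : cong d x x.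
Proof. exists 0, 0; reflexivity. Qed.

Lemma cong_sym d x y : cong d x y -> cong d y x.
Proof. intros (u & v & H); exists v, u; auto. Qed.

Lemma cong_trans d x y z : cong d x y -> cong d y z -> cong d x z.
Proof.
  intros (u & v & H) (u' & v' & H'); exists (u + u'), (v + v').
  transitivity (x + u * d + u' * d); [ring|].
  transitivity (y + u' * d + v * d); [rewrite H; ring|rewrite H'; ring].
Qed.

Lemma cong_add d x y x' y' : cong d x y -> cong d x' y' -> cong d (x + x') (y + y').
Proof.
  intros (u & v & H) (u' & v' & H'); exists (u + u'), (v + v').
  transitivity ((x + u * d) + (x' + u' * d)); [ring|rewrite H, H'; ring].
Qed.

Lemma cong_mul d x y x' y' : cong d x y -> cong d x' y' -> cong d (x * x') (y * y').
Proof.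
  intros (u & v & H) (u' & v' & H').
  exists (x * u' + u * x' + u * u' * d), (y * v' + v * y' + v * v' * d).
  transitivity ((x + u * d) * (x' + u' * d)); [ring|rewrite H, H'; ring].
Qed.

Lemma cong_multiple d x y : cong d (x + y * d) x.
Proof. exists 0, y; ring. Qed.

Lemma cong_remainder a d x : cong d a x -> x < d -> remainder a d x.
Proof.
  intros (u & v & H) Hx; split; [exact Hx|].
  destruct (division a d) as (q & r & E & Hr).
  { apply lt_0_neq; intros ->; exact (nlt_0 _ Hx). }
  exists q; rewrite E; f_equal; apply (mod_unique d (q + u) v); auto.
  rewrite (add_comm _ x), <- H, E; ring.
Qed.

(* With d = a(i+1) + 1, a = (k+1)c and k + 1 the distance of i and j, the inverse is
   explicit: a(i+1) = -1 and a(j+1) + 1 = a(k+1) or -a(k+1) modulo d. *)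
Lemma coprime_moduli a n : (forall i, i < n -> exists c, a = (i + 1) * c) ->
  forall i j, i < n -> j < n -> i <> j ->
  exists u, cong (a * (i + 1) + 1) ((a * (j + 1) + 1) * u) 1.
Proof.
  intros Ha i j Hi Hj Hij; destruct (trichotomy i j) as [H|[H|H]]; [|tauto|].
  - apply lt_iff in H; destruct H as [k ->].
    destruct (Ha k) as [c Hc].
    { eapply le_lt_trans; [|exact Hj]; apply le_iff; exists (i + 1); ring. }
    exists ((i + 1) * (i + 1) * c), (1 + 1), (a * (i + 1) + 1 + (i + 1) * (i + 1) * c).
    transitivity ((a * (i + 1) + 1) * ((i + 1) * (i + 1) * c)
      + (a * (i + 1)) * (((k + 1) * c) * (i + 1)) + (1 + 1) * (a * (i + 1) + 1)); [ring|].
    rewrite <- Hc; ring.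
  - apply lt_iff in H; destruct H as [k ->].
    destruct (Ha k) as [c Hc].
    { eapply le_lt_trans; [|exact Hi]; apply le_iff; exists (j + 1); ring. }
    set (I := j + k + 1 + 1) in *; set (y := a * I).
    exists (y * (I * I * c)), (y * y + 1), (y * (I * I * c) + y).
    transitivity ((a * (j + 1) + 1) * (y * (I * I * c)) + y * y * (a * I) + 1 + y * (y + 1));
      [unfold y; ring|].
    rewrite Hc at 2.
    transitivity ((a * (j + 1) + 1 + a * (k + 1)) * (y * (I * I * c)) + 1 + y * (y + 1));
      [unfold y; ring|unfold y, I; ring].
Qed.

(** [a] plays the part of the factorial of [n]: it makes the moduli a(i+1) + 1 with i < n pairwise
    coprime. *)
Lemma common_multiple n : exists a, 0 < a /\ forall i, i < n -> exists c, a = (i + 1) * c.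
Proof.
  revert n; apply ind_sig; [sig| |].
  - exists 1; split; [apply lt_0_1|intros i []%nlt_0].
  - intros n (a & Ha & H); exists (a * (n + 1)); split.
    + apply lt_iff in Ha; destruct Ha as [k ->]; apply lt_iff; exists (k * n + n + k); ring.
    + intros i [Hi| ->]%lt_succ; [|exists a; ring].
      destruct (H i Hi) as [c ->]; exists (c * (n + 1)); ring.
Qed.

(** The invariant carries, besides the solution [b], a common multiple [m] of the moduli already
    treated that is invertible modulo each remaining one. Inverses appear as witnesses, so the
    invariant is Sigma01. *)
Lemma chinese_remainder (R : num M -> num M -> Prop) a N :
  Def Delta00 (fun e _ => R (e O) (e 1%nat)) ->
  (forall i, i < N -> exists c, a = (i + 1) * c) ->
  (forall i, i < N -> exists x, R i x) ->
  exists b, forall i, i < N -> exists x, R i x /\ cong (a * (i + 1) + 1) b x.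
Proof.
  intros HR Ha HRx.
  enough (H : forall n, n <= N -> exists b m,
    (forall i, i < n -> exists x, R i x /\ cong (a * (i + 1) + 1) b x) /\
    (forall i, i < n -> exists c, m = c * (a * (i + 1) + 1)) /\
    (forall i, i < N -> n <= i -> exists u, cong (a * (i + 1) + 1) (m * u) 1)).
  { destruct (H N (le_refl N)) as (b & _ & Hb & _); exists b; exact Hb. }
  apply (ind_sig (fun n => n <= N -> _)).
  { unfold cong; sig; apply Sig_Def.
    apply (Def_subst0 _ (fun e k => match k with O => e 1%nat | _ => e O end) (fun E => E) HR).
    - intros [|k]; term.
    - intros; sterm. }
  - intros _; exists 0, 1; repeat split.
    + intros i []%nlt_0.
    + intros i []%nlt_0.
    + intros i _ _; exists 1; rewrite mul_1l; apply cong_refl.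
  - intros n IH Hn; destruct IH as (b & m & Hb & Hm & Hu); [apply lt_le, le_lt_succ, Hn|].
    apply le_lt_succ in Hn.
    destruct (Hu n Hn (le_refl n)) as [u Hu'], (HRx n Hn) as [x Hx].
    (* The old congruences survive because their moduli divide [m]. Modulo the new modulus, [m * u]
       is 1 and [a * (n + 1)] is -1, so the sum is b + x - b. *)
    exists (b + (m * u) * (x + a * (n + 1) * b)), (m * (a * (n + 1) + 1)).
    split; [|split].
    + intros i [Hi| ->]%lt_succ.
      * destruct (Hb i Hi) as (y & Hy & Hc); exists y; split; [exact Hy|].
        eapply cong_trans; [|exact Hc].
        destruct (Hm i Hi) as [c ->].
        eapply cong_trans; [|apply (cong_multiple _ b (c * u * (x + a * (n + 1) * b)))].
        replace (c * (a * (i + 1) + 1) * u * (x + a * (n + 1) * b)) with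
          (c * u * (x + a * (n + 1) * b) * (a * (i + 1) + 1)) by ring.
        apply cong_refl.
      * exists x; split; [exact Hx|].
        eapply cong_trans;
          [apply cong_add; [apply cong_refl|apply cong_mul; [exact Hu'|apply cong_refl]]|].
        exists 0, b; ring.
    + intros i [Hi| ->]%lt_succ; [|eauto].
      destruct (Hm i Hi) as [c ->]; exists (c * (a * (n + 1) + 1)); ring.
    + intros i Hi Hni; destruct (Hu i Hi) as [w Hw]; [apply lt_le, le_lt_succ, Hni|].
      destruct (coprime_moduli a N Ha i n Hi Hn) as [z Hz].
      { intros ->; apply le_lt_succ, lt_irrefl in Hni; exact Hni. }
      exists (w * z).
      replace (m * (a * (n + 1) + 1) * (w * z)) with ((m * w) * ((a * (n + 1) + 1) * z)) by ring.
      eapply cong_trans; [apply cong_mul; eassumption|].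
      rewrite mul_1l; apply cong_refl.
Qed.

Lemma seq_len_inj s l l' : seq_len s l -> seq_len s l' -> l = l'.
Proof. intros (a & b & ->) (a' & b' & H); apply pair_inj in H; apply H. Qed.

Lemma seq_entry_len s l i x : seq_len s l -> seq_entry s i x -> i < l.
Proof.
  intros (a & b & ->) (l' & a' & b' & H & Hi & _); apply pair_inj in H; destruct H as [-> _]; exact Hi.
Qed.

Lemma seq_entry_inj s i x y : seq_entry s i x -> seq_entry s i y -> x = y.
Proof.
  intros (l & a & b & -> & _ & H) (l' & a' & b' & E & _ & H').
  apply pair_inj in E; destruct E as [_ E]; apply pair_inj in E; destruct E as [<- <-].
  eapply remainder_unique; eassumption.
Qed.

Lemma seq_entry_exists s l i : seq_len s l -> i < l -> exists x, seq_entry s i x.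
Proof.
  intros (a & b & ->) Hi; destruct (remainder_exists b (a * (i + 1) + 1)) as [x Hx].
  { apply le_0l. }
  exists x, l, a, b; auto.
Qed.

Lemma seq_len_le s l : seq_len s l -> l <= s.
Proof. intros (a & b & ->); apply pair_fst_le. Qed.

Lemma seq_entry_le s i x : seq_entry s i x -> i <= s /\ x <= s.
Proof.
  intros (l & a & b & -> & Hi & Hx); split.
  - eapply le_trans; [apply lt_le; exact Hi|apply pair_fst_le].
  - apply remainder_le in Hx; eapply le_trans; [exact Hx|].
    eapply le_trans; [apply (pair_snd_le a)|apply pair_snd_le].
Qed.

Lemma seq_entry_has_len s i x : seq_entry s i x -> exists l, seq_len s l /\ i < l.
Proof. intros (l & a & b & -> & Hi & _); exists l; split; [exists a, b; reflexivity|exact Hi]. Qed.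

(** * Definability of the coding predicates, with quantifiers bounded by the codes *)

Section DefCoding.
Context (C : form -> Prop) {HC : form_class C}.
Implicit Types f g h : env -> num M.

Lemma Def_remainder f g h : Term f -> Term g -> Term h ->
  Def C (fun e _ => remainder (f e) (g e) (h e)).
Proof.
  intros; apply (Def_ext C _ (fun e _ => h e < g e /\ exists q, q <= f e /\ f e = q * g e + h e)).
  - intros e _; split.
    + intros [Hx [q Hq]]; split; [exact Hx|]; exists q; split; [|exact Hq].
      rewrite Hq; destruct (zero_or_succ (g e)) as [E|[y E]]; rewrite E in *.
      * apply nlt_0 in Hx; tauto.
      * apply le_iff; exists (q * y + h e); ring.
    + intros (Hx & q & _ & Hq); split; eauto.
  - def.
Qed.

Lemma Def_seq_len f g : Term f -> Term g -> Def C (fun e _ => seq_len (f e) (g e)).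
Proof.
  intros; apply (Def_ext C _ (fun e _ => exists a, a <= f e /\ exists b, b <= f e /\
     f e = pair (g e) (pair a b))).
  - intros e _; split.
    + intros (a & b & E); exists a; split; [|exists b; split; [|exact E]]; rewrite E.
      * eapply le_trans; [apply (pair_fst_le a b)|apply pair_snd_le].
      * eapply le_trans; [apply (pair_snd_le a b)|apply pair_snd_le].
    + intros (a & _ & b & _ & E); exists a, b; exact E.
  - def.
Qed.

Lemma Def_seq_entry f g h : Term f -> Term g -> Term h ->
  Def C (fun e _ => seq_entry (f e) (g e) (h e)).
Proof.
  intros; apply (Def_ext C _ (fun e _ => exists l, l <= f e /\ exists a, a <= f e /\ exists b, b <= f e /\
     (f e = pair l (pair a b) /\ g e < l /\ remainder b (a * (g e + 1) + 1) (h e)))).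
  - intros e _; split.
    + intros (l & a & b & E & H2); exists l; split; [|exists a; split; [|exists b; split; [|auto]]]; rewrite E.
      * apply pair_fst_le.
      * eapply le_trans; [apply (pair_fst_le a b)|apply pair_snd_le].
      * eapply le_trans; [apply (pair_snd_le a b)|apply pair_snd_le].
    + intros (l & _ & a & _ & b & _ & E); exists l, a, b; exact E.
  - def; apply Def_remainder; def.
Qed.

Lemma Def_same_seq f g : Term f -> Term g -> Def C (fun e _ => same_seq (f e) (g e)).
Proof.
  intros; apply (Def_ext C _ (fun e _ =>
    (forall l, l <= f e + g e -> (seq_len (f e) l <-> seq_len (g e) l)) /\
    (forall i, i <= f e + g e -> forall x, x <= f e + g e -> (seq_entry (f e) i x <-> seq_entry (g e) i x)))).
  - intros e _; split; [intros [H1 H2]; split; auto|].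
    intros [H1 H2]; split.
    + intros l; split; intros Hl; apply H1; try exact Hl.
      * eapply le_trans; [apply seq_len_le, Hl|apply le_addr].
      * eapply le_trans; [apply seq_len_le, Hl|apply le_addl].
    + intros i x; split; intros Hx; destruct (seq_entry_le _ _ _ Hx);
        apply H2; try exact Hx; (eapply le_trans; [eassumption|]); first [apply le_addr|apply le_addl].
  - def; first [apply Def_seq_len|apply Def_seq_entry]; def.
Qed.

Lemma Def_is_seq f : Term f -> Def C (fun e _ => is_seq (f e)).
Proof.
  intros; apply (Def_ext C _ (fun e _ =>
    (exists l, l <= f e /\ seq_len (f e) l) /\ forall t, t < f e -> ~ same_seq (f e) t)).
  - intros e _; unfold is_seq; split; intros [H1 H2]; (split; [|exact H2]).
    + destruct H1 as [l Hl]; exists l; split; [apply seq_len_le|]; exact Hl.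
    + destruct H1 as (l & _ & Hl); exists l; exact Hl.
  - def; first [apply Def_seq_len|apply Def_same_seq]; def.
Qed.

Lemma Def_is_empty_seq f : Term f -> Def C (fun e _ => is_empty_seq (f e)).
Proof. intros; unfold is_empty_seq; def; first [apply Def_is_seq|apply Def_seq_len]; def. Qed.

Lemma Def_is_snoc f g h : Term f -> Term g -> Term h ->
  Def C (fun e _ => is_snoc (f e) (g e) (h e)).
Proof.
  intros; apply (Def_ext C _ (fun e _ => is_seq (f e) /\ is_seq (h e) /\
    exists l, l <= f e /\ (seq_len (f e) l /\ seq_len (h e) (l + 1) /\ seq_entry (h e) l (g e) /\
    forall i, i < l -> forall x, x <= f e + h e -> (seq_entry (h e) i x <-> seq_entry (f e) i x)))).
  - intros e _; unfold is_snoc; split.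
    + intros (H3 & H4 & l & H5 & H6 & H7 & H8); repeat split; try apply H3; try apply H4.
      exists l; repeat split; auto; [apply seq_len_le, H5| |]; apply H8; auto.
    + intros (H3 & H4 & l & _ & H5 & H6 & H7 & H8); repeat split; try apply H3; try apply H4.
      exists l; repeat split; auto; intros Hx; destruct (seq_entry_le _ _ _ Hx);
        apply H8; try exact Hx; auto; (eapply le_trans; [eassumption|]); first [apply le_addr|apply le_addl].
  - def; first [apply Def_seq_len|apply Def_seq_entry|apply Def_is_seq]; def.
Qed.

Lemma Def_seq_initial f g : Term f -> Term g -> Def C (fun e _ => seq_initial (f e) (g e)).
Proof.
  intros; apply (Def_ext C _ (fun e _ => is_seq (f e) /\ is_seq (g e) /\
    exists l, l <= f e /\ exists k, k <= g e /\ (seq_len (f e) l /\ seq_len (g e) k /\ (l < k \/ l = k) /\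
    forall i, i < l -> forall x, x <= f e + g e -> (seq_entry (g e) i x <-> seq_entry (f e) i x)))).
  - intros e _; unfold seq_initial; split.
    + intros (H3 & H4 & l & k & H5 & H6 & H7 & H8); split; [exact H3|]; split; [exact H4|].
      exists l; split; [apply seq_len_le, H5|]; exists k; split; [apply seq_len_le, H6|].
      repeat split; auto; apply H8; auto.
    + intros (H3 & H4 & l & _ & k & _ & H5 & H6 & H7 & H8); split; [exact H3|]; split; [exact H4|].
      exists l, k; repeat split; auto; intros Hx; destruct (seq_entry_le _ _ _ Hx);
        apply H8; try exact Hx; auto; (eapply le_trans; [eassumption|]); first [apply le_addr|apply le_addl].
  - def; first [apply Def_seq_len|apply Def_seq_entry|apply Def_is_seq]; def.
Qed.

End DefCoding.
End Coding.

Ltac def_user ::= first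
  [ apply Def_seq_entry; def | apply Def_seq_len; def | apply Def_is_seq; def | apply Def_same_seq; def
  | apply Def_is_snoc; def | apply Def_seq_initial; def | apply Def_is_empty_seq; def ].

(** * Finite sequences, functions and paths *)

Section Sequences.
Context {M : L2_structure} {HM : RCA0 M}.
Local Open Scope L2_scope.
Local Notation env := (nat -> num M).
Local Notation senv := (nat -> nset M).
Local Notation "x <= y" := (lt x (add y one)) : L2_scope.
Implicit Types (x y z a b c d i l m n q s t u v w : num M).

Add Ring num_ring'' : (num_semiring (M := M)).

Lemma le_0_inv x : x <= 0 -> x = 0.
Proof. intros [[]%nlt_0|H]%lt_succ; exact H. Qed.

Lemma delta1_comprehension (P : num M -> Prop) :
  Sig (fun e _ => P (e O)) -> Sig (fun e _ => ~ P (e O)) -> exists X, forall n, n \in X <-> P n.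
Proof.
  intros (Q & HQ & H) (Q' & HQ' & H').
  destruct (Def2_open2 _ _ _ HQ HQ') as (p & p' & a & B & Hp & Hp' & Hs).
  destruct HM as (_ & _ & Hcomp).
  set (e0 := fun _ : nat => 0 : num M).
  assert (HP : forall n, sat (scons n (join e0 a)) (join B B) (FExN p) <-> P n).
  { intros n; rewrite (H (scons n e0) B); simpl.
    split; intros [y Hy]; exists y; apply Hs; exact Hy. }
  assert (HP' : forall n, sat (scons n (join e0 a)) (join B B) (FAllN (FNot p')) <-> P n).
  { intros n; assert (Hn := H' (scons n e0) B); simpl in Hn |- *; split.
    - intros HH; apply NNPP; intros [y HQy]%Hn; apply (HH y), Hs, HQy.
    - intros HPn y Hsat; apply Hn; [exists y; apply Hs, Hsat|exact HPn]. }
  destruct (Hcomp (FExN p) (FAllN (FNot p'))) with (e := join e0 a) (E := join B B) as [X HX].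
  - exists p; auto.
  - exists (FNot p'); split; [constructor; exact Hp'|reflexivity].
  - intros n; rewrite HP, HP'; reflexivity.
  - exists X; intros n; rewrite HX; apply HP.
Qed.

(** Chosen by epsilon, so that a set can be named before its existence is shown; the definability
    obligation is met when membership is used. *)
Definition the_set (P : num M -> Prop) : nset M :=
  epsilon (nset_inhabited M) (fun X => forall n, n \in X <-> P n).

Lemma mem_the_set0 P n : Def Delta00 (fun e _ => P (e O)) -> n \in the_set P <-> P n.
Proof.
  intros H; unfold the_set; revert n.
  apply (epsilon_spec (nset_inhabited M) (fun X => forall n, n \in X <-> P n)).
  apply delta1_comprehension; apply Sig_Def; def.
Qed.

Lemma is_seq_ext s t l : is_seq s -> is_seq t -> seq_len s l -> seq_len t l ->
  (forall i x, i < l -> seq_entry s i x -> seq_entry t i x) -> s = t.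
Proof.
  intros Hs Ht Ls Lt H.
  assert (H' : forall i x, i < l -> seq_entry t i x -> seq_entry s i x).
  { intros i x Hi Hx; destruct (seq_entry_exists s l i Ls Hi) as [y Hy].
    rewrite (seq_entry_inj _ _ _ _ Hx (H i y Hi Hy)); exact Hy. }
  assert (Hst : same_seq s t).
  { split.
    - intros k; split; intros Hk;
        [rewrite (seq_len_inj _ _ _ Hk Ls)|rewrite (seq_len_inj _ _ _ Hk Lt)]; assumption.
    - intros i x; split; intros Hx.
      + apply H; [exact (seq_entry_len _ _ _ _ Ls Hx)|exact Hx].
      + apply H'; [exact (seq_entry_len _ _ _ _ Lt Hx)|exact Hx]. }
  destruct (trichotomy s t) as [Hl|[Hl|Hl]]; [|exact Hl|].
  - exfalso; apply (proj2 Ht s Hl); destruct Hst as [H1 H2]; split; intros; symmetry; auto.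
  - exfalso; exact (proj2 Hs t Hl Hst).
Qed.

Lemma same_seq_trans s t u : same_seq s t -> same_seq t u -> same_seq s u.
Proof. intros [H1 H2] [H3 H4]; split; intros; [rewrite H1|rewrite H2]; auto. Qed.

Lemma normal_code s l : seq_len s l -> exists t, is_seq t /\ same_seq s t /\ t <= s.
Proof.
  intros Hl; destruct (least0 (same_seq s)) with (n := s) as (t & Ht & Hle & Hmin).
  - def.
  - split; reflexivity.
  - exists t; split; [|auto]; split.
    + exists l; apply Ht, Hl.
    + intros u Hu Htu; apply (Hmin u Hu); eapply same_seq_trans; eassumption.
Qed.

(** Goedel's beta lemma, followed by the passage to the least code. *)
Lemma seq_comprehension (R : num M -> num M -> Prop) l :
  Def Delta00 (fun e _ => R (e O) (e 1%nat)) ->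
  (forall i, i < l -> exists x, R i x) ->
  (forall i x y, i < l -> R i x -> R i y -> x = y) ->
  exists t, is_seq t /\ seq_len t l /\ forall i x, seq_entry t i x <-> i < l /\ R i x.
Proof.
  intros HR Hex Huni.
  destruct (collection0 R HR l Hex) as [B HB].
  destruct (common_multiple l) as (a0 & Ha0 & Hdiv).
  (* The factor [B + 1] makes every modulus exceed the entries, which are below [B], so that a
     congruence determines a remainder. *)
  set (a := a0 * (B + 1)).
  assert (Hdiv' : forall i, i < l -> exists c, a = (i + 1) * c).
  { intros i Hi; destruct (Hdiv i Hi) as [c Hc]; exists (c * (B + 1)); unfold a; rewrite Hc; ring. }
  destruct (chinese_remainder R a l HR Hdiv' Hex) as [b Hb].
  assert (Hlen : seq_len (pair l (pair a b)) l) by (exists a, b; reflexivity).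
  assert (Hent : forall i x, seq_entry (pair l (pair a b)) i x <-> i < l /\ R i x).
  { assert (H : forall i x, i < l -> R i x -> seq_entry (pair l (pair a b)) i x).
    { intros i x Hi Hx; destruct (Hb i Hi) as (y & Hy & Hc).
      rewrite <- (Huni i x y Hi Hx Hy) in Hc.
      exists l, a, b; split; [reflexivity|]; split; [exact Hi|].
      apply cong_remainder; [exact Hc|].
      destruct (HB i Hi) as (z & Hz & Hiz); rewrite <- (Huni i x z Hi Hx Hiz) in Hz.
      eapply lt_trans; [exact Hz|].
      apply lt_iff in Ha0; destruct Ha0 as [k Hk]; unfold a; rewrite Hk.
      apply le_iff; exists (k * (B + 1) + 1 + (0 + k + 1) * (B + 1) * i); ring. }
    intros i x; split; [|intros []; auto].
    intros Hx; assert (Hi := seq_entry_len _ _ _ _ Hlen Hx); split; [exact Hi|].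
    destruct (Hex i Hi) as [y Hy].
    rewrite (seq_entry_inj _ _ _ _ Hx (H i y Hi Hy)); exact Hy. }
  destruct (normal_code _ _ Hlen) as (t & Ht & [H1 H2] & _).
  exists t; split; [exact Ht|]; split; [apply H1, Hlen|].
  intros i x; rewrite <- H2; apply Hent.
Qed.

Lemma empty_seq_exists : exists s : num M, is_empty_seq s.
Proof.
  destruct (seq_comprehension (fun _ _ => False) 0) as (s & Hs & Hl & _).
  - def.
  - intros i []%nlt_0.
  - intros i x y []%nlt_0.
  - exists s; split; assumption.
Qed.

Lemma empty_seq_unique s t : is_empty_seq s -> is_empty_seq t -> s = t.
Proof.
  intros [Hs Ls] [Ht Lt]; apply (is_seq_ext s t 0); auto.
  intros i x []%nlt_0.
Qed.

Lemma snoc_exists s n : is_seq s -> exists t, is_snoc s n t.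
Proof.
  intros Hs; destruct (proj1 Hs) as [l Hl].
  destruct (seq_comprehension (fun i x => (i < l /\ seq_entry s i x) \/ (i = l /\ x = n)) (l + 1))
    as (t & Ht & Lt & H).
  - def.
  - intros i [Hi| ->]%lt_succ; [|exists n; auto].
    destruct (seq_entry_exists s l i Hl Hi) as [x Hx]; exists x; auto.
  - intros i x y _ [[Hi Hx]|[-> ->]] [[Hi' Hy]|[E ->]]; auto.
    + eapply seq_entry_inj; eassumption.
    + subst i; exfalso; exact (lt_irrefl _ Hi).
    + exfalso; exact (lt_irrefl _ Hi').
  - exists t; split; [exact Hs|]; split; [exact Ht|]; exists l; split; [exact Hl|].
    split; [exact Lt|]; split.
    + apply H; split; [apply le_refl|auto].
    + intros i x Hi; rewrite H; split.
      * intros [_ [[_ Hx]|[-> _]]]; [exact Hx|exfalso; exact (lt_irrefl _ Hi)].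
      * intros Hx; split; [apply lt_le|]; auto.
Qed.

Lemma snoc_entry s n t l i x : is_snoc s n t -> seq_len s l ->
  seq_entry t i x <-> (i < l /\ seq_entry s i x) \/ (i = l /\ x = n).
Proof.
  intros (Hs & Ht & l' & Hl' & Lt & Hn & H) Hl; rewrite (seq_len_inj _ _ _ Hl' Hl) in *.
  split.
  - intros Hx; assert (Hi := seq_entry_len _ _ _ _ Lt Hx).
    apply lt_succ in Hi; destruct Hi as [Hi| ->].
    + left; split; [exact Hi|]; apply H; assumption.
    + right; split; [reflexivity|]; eapply seq_entry_inj; eassumption.
  - intros [[Hi Hx]|[-> ->]]; [apply H; assumption|exact Hn].
Qed.

Lemma snoc_len s n t l : is_snoc s n t -> seq_len s l -> seq_len t (l + 1).
Proof.
  intros (Hs & Ht & l' & Hl' & Lt & Hn & H) Hl; rewrite (seq_len_inj _ _ _ Hl' Hl) in *; exact Lt.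
Qed.

Lemma snoc_entry_le s n t : is_snoc s n t -> n <= t.
Proof. intros (_ & _ & l & _ & _ & H & _); apply seq_entry_le in H; apply H. Qed.

Lemma prefix_exists s l n : is_seq s -> seq_len s l -> n <= l ->
  exists t, seq_initial t s /\ seq_len t n.
Proof.
  intros Hs Hl Hn.
  destruct (seq_comprehension (fun i x => seq_entry s i x) n) as (t & Ht & Lt & H).
  - def.
  - intros i Hi; apply (seq_entry_exists s l); [exact Hl|eapply lt_le_trans; eassumption].
  - intros i x y _; apply seq_entry_inj.
  - exists t; split; [|exact Lt]; split; [exact Ht|]; split; [exact Hs|].
    exists n, l; split; [exact Lt|]; split; [exact Hl|]; split; [apply lt_succ, Hn|].
    intros i x Hi; rewrite H; tauto.
Qed.

Lemma seq_initial_entry s t l i x : seq_initial s t -> seq_len s l -> i < l ->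
  seq_entry s i x <-> seq_entry t i x.
Proof.
  intros (_ & _ & l' & k & Hl' & _ & _ & H) Hl Hi; rewrite (seq_len_inj _ _ _ Hl' Hl) in *.
  symmetry; auto.
Qed.

Lemma seq_initial_sub s t i x : seq_initial s t -> seq_entry s i x -> seq_entry t i x.
Proof.
  intros H Hx; destruct (seq_entry_has_len _ _ _ Hx) as (l & Hl & Hi).
  apply (seq_initial_entry s t l); assumption.
Qed.

Lemma seq_initial_len s t l k : seq_initial s t -> seq_len s l -> seq_len t k -> l <= k.
Proof.
  intros (_ & _ & l' & k' & Hl' & Hk' & H & _) Hl Hk.
  rewrite (seq_len_inj _ _ _ Hl Hl'), (seq_len_inj _ _ _ Hk Hk'); apply lt_succ, H.
Qed.

Lemma seq_initial_intro s t l k : is_seq s -> is_seq t -> seq_len s l -> seq_len t k -> l <= k ->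
  (forall i x, i < l -> seq_entry s i x -> seq_entry t i x) -> seq_initial s t.
Proof.
  intros Hs Ht Hl Hk Hlk H; split; [exact Hs|]; split; [exact Ht|]; exists l, k.
  split; [exact Hl|]; split; [exact Hk|]; split; [apply lt_succ, Hlk|].
  intros i x Hi; split; [|apply H, Hi].
  intros Hx; destruct (seq_entry_exists s l i Hl Hi) as [y Hy].
  rewrite (seq_entry_inj _ _ _ _ Hx (H i y Hi Hy)); exact Hy.
Qed.

Lemma seq_initial_refl s : is_seq s -> seq_initial s s.
Proof.
  intros Hs; destruct (proj1 Hs) as [l Hl]; apply (seq_initial_intro s s l l); auto using le_refl.
Qed.

Lemma seq_initial_trans s t u : seq_initial s t -> seq_initial t u -> seq_initial s u.
Proof.
  intros H H'; assert (Hs := proj1 H); assert (Ht := proj1 H'); assert (Hu := proj1 (proj2 H')).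
  destruct (proj1 Hs) as [l Hl], (proj1 Ht) as [k Hk], (proj1 Hu) as [m Hm].
  apply (seq_initial_intro s u l m); auto.
  - exact (le_trans l k m (seq_initial_len s t l k H Hl Hk) (seq_initial_len t u k m H' Hk Hm)).
  - intros i x _ Hx; eapply seq_initial_sub; [exact H'|]; eapply seq_initial_sub; eassumption.
Qed.

Lemma seq_initial_eq s t l : seq_initial s t -> seq_len s l -> seq_len t l -> s = t.
Proof.
  intros H Hs Ht; apply (is_seq_ext s t l); auto; [apply H|apply H|].
  intros i x _; apply seq_initial_sub, H.
Qed.

Lemma seq_initial_unique s t u l : seq_initial s u -> seq_initial t u ->
  seq_len s l -> seq_len t l -> s = t.
Proof.
  intros H H' Hs Ht; apply (is_seq_ext s t l); auto; [apply H|apply H'|].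
  intros i x Hi Hx; apply (seq_initial_entry t u l); auto; exact (seq_initial_sub s u i x H Hx).
Qed.

Lemma seq_initial_linear s t u l k : seq_initial s u -> seq_initial t u ->
  seq_len s l -> seq_len t k -> l <= k -> seq_initial s t.
Proof.
  intros H H' Hs Ht Hlk; apply (seq_initial_intro s t l k); auto; [apply H|apply H'|].
  intros i x Hi Hx; apply (seq_initial_entry t u k); auto;
    [eapply lt_le_trans; eassumption|exact (seq_initial_sub s u i x H Hx)].
Qed.

Lemma snoc_initial s n t : is_snoc s n t -> seq_initial s t.
Proof.
  intros H; destruct (proj1 (proj1 H)) as [l Hl].
  apply (seq_initial_intro s t l (l + 1)); [apply H|apply H|exact Hl|eapply snoc_len; eassumption| |].
  - apply lt_le, le_refl.
  - intros i x Hi Hx; apply (snoc_entry s n t l); auto.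
Qed.

Lemma initial_snoc s t l : seq_initial s t -> seq_len s l -> seq_len t (l + 1) ->
  exists n, is_snoc s n t.
Proof.
  intros H Hs Ht; destruct (seq_entry_exists t (l + 1) l Ht (le_refl l)) as [n Hn].
  exists n; split; [apply H|]; split; [apply H|]; exists l; repeat split; auto;
    intros; apply (seq_initial_entry s t l); auto.
Qed.

(* The same pair (a, b) describes every initial segment, with a smaller length. *)
Lemma seq_initial_le s t : seq_initial s t -> s <= t.
Proof.
  intros H; destruct (proj1 (proj1 H)) as [l Hl].
  destruct (proj1 (proj1 (proj2 H))) as (k & a & b & Hk).
  assert (Lt : seq_len t k) by (exists a, b; exact Hk).
  assert (Hlk := seq_initial_len _ _ _ _ H Hl Lt).
  assert (Lu : seq_len (pair l (pair a b)) l) by (exists a, b; reflexivity).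
  destruct (normal_code _ _ Lu) as (u & Hu & [H1 H2] & Hle).
  assert (Hsu : s = u).
  { apply (is_seq_ext s u l); auto; [apply H|apply H1, Lu|].
    intros i x Hi Hx; apply H2; apply (seq_initial_sub _ _ _ _ H) in Hx; rewrite Hk in Hx.
    destruct Hx as (k' & a' & b' & E & _ & Hr).
    apply pair_inj in E; destruct E as [_ E]; apply pair_inj in E; destruct E as [<- <-].
    exists l, a, b; auto. }
  subst u; eapply le_trans; [exact Hle|]; rewrite Hk.
  apply lt_succ in Hlk; destruct Hlk as [Hlk| ->]; [apply lt_le, pair_lt_fst, Hlk|apply le_refl].
Qed.

(** * Functions as sets of pairs, with their restrictions, sections and graphs *)

Lemma fun_value (F : nset M) n : is_fun F -> exists x, pair n x \in F.
Proof. intros [_ H]; destruct (H n) as (x & Hx & _); exists x; exact Hx. Qed.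

Lemma fun_unique (F : nset M) n x y : is_fun F -> pair n x \in F -> pair n y \in F -> x = y.
Proof. intros [_ H] Hx Hy; destruct (H n) as (z & _ & Hz); rewrite <- (Hz x), <- (Hz y); auto. Qed.

Lemma restriction_exists (F : nset M) n : is_fun F -> exists s, is_restriction F n s.
Proof.
  intros HF; destruct (seq_comprehension (fun i x => pair i x \in F) n) as (s & Hs & Hl & H).
  - def.
  - intros i _; apply fun_value, HF.
  - intros i x y _; apply fun_unique, HF.
  - exists s; split; [exact Hs|]; split; [exact Hl|].
    intros i x Hi; rewrite H; tauto.
Qed.

Lemma restriction_entry (F : nset M) n s i x : is_restriction F n s ->
  seq_entry s i x <-> i < n /\ pair i x \in F.
Proof.
  intros (Hs & Hl & H); split.
  - intros Hx; assert (Hi := seq_entry_len _ _ _ _ Hl Hx); split; [|apply H]; assumption.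
  - intros [Hi Hx]; apply H; assumption.
Qed.

Lemma restriction_unique (F : nset M) n s t : is_restriction F n s -> is_restriction F n t -> s = t.
Proof.
  intros (Hs & Ls & H) (Ht & Lt & H'); apply (is_seq_ext s t n); auto.
  intros i x Hi Hx; apply H', H; auto.
Qed.

Lemma restriction_initial (F : nset M) n k s t :
  is_restriction F n s -> is_restriction F k t -> n <= k -> seq_initial s t.
Proof.
  intros (Hs & Ls & H) (Ht & Lt & H') Hnk; apply (seq_initial_intro s t n k); auto.
  intros i x Hi Hx; apply H'; [eapply lt_le_trans; eassumption|apply H; auto].
Qed.

Lemma initial_restriction (F : nset M) k s t l :
  seq_initial s t -> seq_len s l -> is_restriction F k t -> is_restriction F l s.
Proof.
  intros H Hl HF; split; [apply H|]; split; [exact Hl|]; intros i x Hi.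
  rewrite (seq_initial_entry s t l i x H Hl Hi), (restriction_entry F k t i x HF).
  split; [tauto|]; intros Hx; split; [|exact Hx].
  eapply lt_le_trans; [exact Hi|]; eapply seq_initial_len; [exact H|exact Hl|apply HF].
Qed.

Lemma fun_section_exists (F : nset M) i : exists H, fun_section F i H.
Proof.
  exists (the_set (fun p => exists n, n <= p /\ exists m, m <= p /\ (p = pair n m /\ pair (pair n i) m \in F))).
  intros p; rewrite mem_the_set0 by def; split.
  - intros (n & _ & m & _ & H); exists n, m; exact H.
  - intros (n & m & -> & H); exists n; split; [apply pair_fst_le|]; exists m; split; [apply pair_snd_le|auto].
Qed.

Lemma fun_section_mem (F : nset M) i H n m : fun_section F i H ->
  pair n m \in H <-> pair (pair n i) m \in F.
Proof.
  intros HS; split.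
  - intros (n' & m' & E & HH)%HS; apply pair_inj in E; destruct E as [-> ->]; exact HH.
  - intros HH; apply HS; exists n, m; auto.
Qed.

Lemma fun_section_fun (F : nset M) i H : is_fun F -> fun_section F i H -> is_fun H.
Proof.
  intros HF HS; split.
  - intros p (n & m & E & _)%HS; exists n, m; exact E.
  - intros n; destruct (fun_value F (pair n i) HF) as [m Hm]; exists m; split.
    + apply (fun_section_mem F i H); assumption.
    + intros y Hy; apply (fun_section_mem F i H) in Hy; [|exact HS].
      eapply fun_unique; eassumption.
Qed.

(** A total single-valued Sigma01 graph is Delta01: a value is wrong iff some other value is
    attained. *)
Lemma function_of_graph (R : num M -> num M -> Prop) :
  Sig (fun e _ => R (e O) (e 1%nat)) -> (forall n, exists m, R n m) ->
  (forall n x y, R n x -> R n y -> x = y) ->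
  exists F, is_fun F /\ forall n m, pair n m \in F <-> R n m.
Proof.
  intros HR Hex Huni.
  assert (HR' : forall f g, Term f -> Term g -> Sig (fun e _ => R (f e) (g e))).
  { intros f g Hf Hg.
    apply (Sig_subst (fun e _ => R (e O) (e 1%nat))
      (fun e k => match k with O => f e | _ => g e end) (fun E => E) HR); [|intros; sterm].
    intros [|k]; assumption. }
  destruct (delta1_comprehension (fun p => exists n, n <= p /\ exists m, m <= p /\ (p = pair n m /\ R n m)))
    as [F HF].
  - sig; apply HR'; term.
  - apply (Sig_ext _ (fun e _ => forall n, n <= e O -> forall m, m <= e O -> e O = pair n m ->
      exists m', m <> m' /\ R n m')); [|sig; apply HR'; term].
    intros e _; split.
    + intros H n Hn m Hm E; destruct (Hex n) as [m' Hm']; exists m'; split; [|exact Hm'].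
      intros ->; apply H; exists n; split; [exact Hn|]; exists m'; auto.
    + intros H (n & Hn & m & Hm & E & Hnm); destruct (H n Hn m Hm E) as (m' & Hne & Hm').
      apply Hne, (Huni n); assumption.
  - assert (Hmem : forall n m, pair n m \in F <-> R n m).
    { intros n m; rewrite HF; split.
      - intros (n' & _ & m' & _ & E & H); apply pair_inj in E; destruct E as [-> ->]; exact H.
      - intros H; exists n; split; [apply pair_fst_le|]; exists m; split; [apply pair_snd_le|auto]. }
    exists F; split; [split|exact Hmem].
    + intros p (n & _ & m & _ & E & _)%HF; exists n, m; exact E.
    + intros n; destruct (Hex n) as [m Hm]; exists m; split; [apply Hmem, Hm|].
      intros m' Hm'%Hmem; apply (Huni n); assumption.
Qed.

(** [pair] is not onto, for instance 3 is no pair, so arguments that are not pairs get the default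
    value 0. *)
Lemma binary_function_of_graph (R : num M -> num M -> num M -> Prop) :
  Sig (fun e _ => R (e O) (e 1%nat) (e 2%nat)) -> (forall n i, exists m, R n i m) ->
  (forall n i x y, R n i x -> R n i y -> x = y) ->
  exists F, is_fun F /\ forall n i m, pair (pair n i) m \in F <-> R n i m.
Proof.
  intros HR Hex Huni.
  destruct (function_of_graph (fun q m =>
    (exists n, n <= q /\ exists i, i <= q /\ (q = pair n i /\ R n i m)) \/
    ((forall n, n <= q -> forall i, i <= q -> q <> pair n i) /\ m = 0))) as (F & HF & HFm).
  - sig.
    apply (Sig_subst (fun e _ => R (e O) (e 1%nat) (e 2%nat))
      (fun e k => match k with O => e 1%nat | 1%nat => e O | _ => e 3%nat end) (fun E => E) HR);
      [|intros; sterm].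
    intros [|[|k]]; term.
  - intros q; destruct (classic (exists n i, q = pair n i)) as [(n & i & ->)|Hno].
    + destruct (Hex n i) as [m Hm]; exists m; left.
      exists n; split; [apply pair_fst_le|]; exists i; split; [apply pair_snd_le|auto].
    + exists 0; right; split; [|reflexivity]; intros n _ i _ ->; apply Hno; eauto.
  - intros q x y [(n & Hn & i & Hi & E & Hx)|[Hq ->]] [(n' & Hn' & i' & Hi' & E' & Hy)|[Hq' ->]]; auto.
    + rewrite E in E'; apply pair_inj in E'; destruct E' as [<- <-]; eapply Huni; eassumption.
    + exfalso; exact (Hq' n Hn i Hi E).
    + exfalso; exact (Hq n' Hn' i' Hi' E').
  - exists F; split; [exact HF|]; intros n i m; rewrite HFm; split.
    + intros [(n' & _ & i' & _ & E & H)|[Hq _]].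
      * apply pair_inj in E; destruct E as [-> ->]; exact H.
      * exfalso; apply (Hq n (pair_fst_le _ _) i (pair_snd_le _ _)); reflexivity.
    + intros H; left; exists n; split; [apply pair_fst_le|]; exists i; split; [apply pair_snd_le|auto].
Qed.

(* Minimizing the codes of the nodes, not their last entries, keeps [leftmost] Delta00. *)
Section UniformPath.
Variable P : nset M.
Hypothesis P_empty : forall i, exists s, is_empty_seq s /\ pair i s \in P.
Hypothesis P_child : forall i s, pair i s \in P -> exists n t, is_snoc s n t /\ pair i t \in P.

(** The bounds on [u], [v] and [n] keep this Delta00 and lose nothing, by [seq_initial_le] and
    [snoc_entry_le]. *)
Definition leftmost i t : Prop :=
  is_seq t /\ forall u, u <= t -> forall v, v <= t -> seq_initial v t ->
    (exists n, n <= v /\ is_snoc u n v) ->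
    pair i v \in P /\ forall w, w < v -> ~ (pair i w \in P /\ exists n, n <= w /\ is_snoc u n w).

Lemma leftmost_elim i t u n v : leftmost i t -> seq_initial v t -> is_snoc u n v ->
  pair i v \in P /\ forall w m, pair i w \in P -> is_snoc u m w -> v <= w.
Proof.
  intros [_ H] Hv Hu.
  destruct (H u) with (v := v) as [H1 H2].
  - apply seq_initial_le; eapply seq_initial_trans; [eapply snoc_initial; exact Hu|exact Hv].
  - apply seq_initial_le, Hv.
  - exact Hv.
  - exists n; split; [eapply snoc_entry_le; exact Hu|exact Hu].
  - split; [exact H1|]; intros w m Hw Hm; apply nlt_le; intros Hlt; apply (H2 w Hlt).
    split; [exact Hw|]; exists m; split; [eapply snoc_entry_le; exact Hm|exact Hm].
Qed.

Lemma seq_cases t : is_seq t -> is_empty_seq t \/ exists u n, is_snoc u n t.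
Proof.
  intros Ht; destruct (proj1 Ht) as [l Hl]; destruct (zero_or_succ l) as [->|[k ->]].
  - left; split; assumption.
  - right; destruct (prefix_exists t (k + 1) k Ht Hl) as (u & Hu & Lu); [apply lt_le, le_refl|].
    exists u; apply (initial_snoc u t k); assumption.
Qed.

Lemma leftmost_mem i t : leftmost i t -> pair i t \in P.
Proof.
  intros H; destruct (seq_cases t (proj1 H)) as [Ht|(u & n & Hu)].
  - destruct (P_empty i) as (s & Hs & HP); rewrite (empty_seq_unique t s Ht Hs); exact HP.
  - eapply leftmost_elim; [exact H|apply seq_initial_refl, H|exact Hu].
Qed.

Lemma leftmost_initial i s t : leftmost i t -> seq_initial s t -> leftmost i s.
Proof.
  intros H Hs; split; [apply Hs|]; intros u _ v _ Hv (n & _ & Hn).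
  destruct (leftmost_elim i t u n v H) as [H1 H2]; [eapply seq_initial_trans; eassumption|exact Hn|].
  split; [exact H1|]; intros w Hw (HP & m & _ & Hm); apply (nlt_le w v); [|exact Hw].
  eapply H2; eassumption.
Qed.

Lemma leftmost_exists i l : exists t, leftmost i t /\ seq_len t l.
Proof.
  revert l; apply ind_sig.
  { unfold leftmost; sig. }
  - destruct (P_empty i) as (s & [Hs Ls] & _); exists s; split; [|exact Ls]; split; [exact Hs|].
    intros u _ v _ Hv (n & _ & Hn); exfalso.
    destruct (proj1 (proj1 Hn)) as [k Hk].
    assert (Hle := seq_initial_len _ _ _ _ Hv (snoc_len _ _ _ _ Hn Hk) Ls).
    apply le_0_inv, succ_neq0 in Hle; exact Hle.
  - intros l (t & Ht & Lt).
    destruct (P_child i t (leftmost_mem i t Ht)) as (n & v & Hv & HPv).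
    destruct (least0 (fun v => pair i v \in P /\ exists n, n <= v /\ is_snoc t n v)) with (n := v)
      as (v' & (HP' & n' & _ & Hn') & _ & Hmin).
    { def. }
    { split; [exact HPv|]; exists n; split; [eapply snoc_entry_le; exact Hv|exact Hv]. }
    assert (Lv := snoc_len _ _ _ _ Hn' Lt).
    exists v'; split; [|exact Lv]; split; [apply Hn'|].
    intros u _ w _ Hw (m & _ & Hm); destruct (proj1 (proj1 Hm)) as [k Hk].
    assert (Lw := snoc_len _ _ _ _ Hm Hk).
    assert (Hle := seq_initial_len _ _ _ _ Hw Lw Lv).
    apply le_lt_succ in Hle; apply lt_succ in Hle; destruct Hle as [Hle|E].
    + assert (Hwt : seq_initial w t).
      { eapply seq_initial_linear; [exact Hw|eapply snoc_initial; exact Hn'|exact Lw|exact Lt|].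
        apply (proj1 (le_lt_succ k l)), Hle. }
      destruct (leftmost_elim i t u m w Ht Hwt Hm) as [H1 H2]; split; [exact H1|].
      intros z Hz (HPz & p & _ & Hp); apply (nlt_le z w); [|exact Hz]; eapply H2; eassumption.
    + subst k.
      assert (Ew : w = v') by (eapply seq_initial_eq; eassumption); subst w.
      assert (Eu : u = t).
      { eapply seq_initial_unique; [eapply snoc_initial; exact Hm|eapply snoc_initial; exact Hn'|exact Hk|exact Lt]. }
      subst u; split; [exact HP'|exact Hmin].
Qed.

(** The induction compares initial segments of equal length; their codes are bounded by [s] and [t],
    which makes the induction formula Delta00. *)
Lemma leftmost_unique i s t l : leftmost i s -> leftmost i t -> seq_len s l -> seq_len t l -> s = t.
Proof.
  intros Hs Ht Ls Lt.
  enough (H : forall n, n <= l -> forall u, u <= s -> forall v, v <= t ->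
     seq_initial u s -> seq_initial v t -> seq_len u n -> seq_len v n -> u = v).
  { apply (H l (le_refl l) s (le_refl s) t (le_refl t)); auto; apply seq_initial_refl; [apply Hs|apply Ht]. }
  match goal with |- forall n, @?A n => apply (ind0 A) end; [def| |].
  - intros _ u _ v _ Hu Hv Lu Lv; apply empty_seq_unique; split; auto; [apply Hu|apply Hv].
  - intros n IH Hn u _ v _ Hu Hv Lu Lv.
    destruct (prefix_exists u (n + 1) n) as (u' & Hu' & Lu'); [apply Hu|exact Lu|apply lt_le, le_refl|].
    destruct (prefix_exists v (n + 1) n) as (v' & Hv' & Lv'); [apply Hv|exact Lv|apply lt_le, le_refl|].
    assert (Hus := seq_initial_trans _ _ _ Hu' Hu); assert (Hvt := seq_initial_trans _ _ _ Hv' Hv).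
    assert (E : u' = v').
    { apply IH; auto using seq_initial_le; apply lt_le, le_lt_succ, Hn. }
    subst v'.
    destruct (initial_snoc u' u n Hu' Lu' Lu) as [x Hx], (initial_snoc u' v n Hv' Lu' Lv) as [y Hy].
    destruct (leftmost_elim i s u' x u Hs Hu Hx) as [H1 H2].
    destruct (leftmost_elim i t u' y v Ht Hv Hy) as [H3 H4].
    apply le_antisym; eauto.
Qed.

Definition leftmost_value n i m : Prop := exists t, leftmost i t /\ seq_entry t n m.

Lemma leftmost_value_exists n i : exists m, leftmost_value n i m.
Proof.
  destruct (leftmost_exists i (n + 1)) as (t & Ht & Lt).
  destruct (seq_entry_exists t (n + 1) n Lt (le_refl n)) as [m Hm]; exists m, t; auto.
Qed.

Lemma leftmost_value_entry n i m t l : leftmost_value n i m -> leftmost i t -> seq_len t l -> n < l ->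
  seq_entry t n m.
Proof.
  intros (s & Hs & Hm) Ht Lt Hn; destruct (seq_entry_has_len _ _ _ Hm) as (k & Ls & Hk).
  apply le_lt_succ in Hn, Hk.
  destruct (prefix_exists s k (n + 1)) as (s' & Hs' & Ls'); auto; [apply Hs|].
  destruct (prefix_exists t l (n + 1)) as (t' & Ht' & Lt'); auto; [apply Ht|].
  assert (E : s' = t').
  { eapply leftmost_unique; [eapply leftmost_initial; [exact Hs|exact Hs']
      |eapply leftmost_initial; [exact Ht|exact Ht']|exact Ls'|exact Lt']. }
  subst t'; apply (seq_initial_sub s'); [exact Ht'|].
  apply (seq_initial_entry s' s (n + 1)); auto; apply le_refl.
Qed.

(** No choice principle is involved: leftmost nodes exist and are unique for every [i], so their
    entries form a Sigma01 graph in [n] and [i] together. *)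
Lemma uniform_path : exists F, is_fun F /\ forall i H, fun_section F i H ->
  forall n s, is_restriction H n s -> pair i s \in P.
Proof.
  destruct (binary_function_of_graph leftmost_value) as (F & HF & HFm).
  - unfold leftmost_value, leftmost; sig.
  - apply leftmost_value_exists.
  - intros n i x y Hx Hy; destruct Hx as (t & Ht & Hx).
    destruct (seq_entry_has_len _ _ _ Hx) as (l & Ll & Hl).
    eapply seq_entry_inj; [exact Hx|]; eapply leftmost_value_entry; eassumption.
  - exists F; split; [exact HF|]; intros i H HH n s Hs.
    destruct (leftmost_exists i n) as (t & Ht & Lt).
    replace s with t; [apply leftmost_mem, Ht|].
    symmetry; apply (is_seq_ext s t n); [apply Hs|apply Ht|apply Hs|exact Lt|].
    intros k x Hk Hx; apply (restriction_entry H n s k x Hs) in Hx; destruct Hx as [_ Hx].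
    apply (fun_section_mem F i H k x HH), HFm in Hx.
    eapply leftmost_value_entry; eassumption.
Qed.

End UniformPath.

Lemma path_exists (P : nset M) :
  (exists s, is_empty_seq s /\ s \in P) ->
  (forall s, s \in P -> exists n t, is_snoc s n t /\ t \in P) ->
  exists F, is_fun F /\ forall n s, is_restriction F n s -> s \in P.
Proof.
  intros H0 HS; set (P' := the_set (fun p => exists i, i <= p /\ exists s, s <= p /\ (p = pair i s /\ s \in P))).
  assert (HP' : forall i s, pair i s \in P' <-> s \in P).
  { intros i s; unfold P'; rewrite mem_the_set0 by def; split.
    - intros (i' & _ & s' & _ & E & Hs); apply pair_inj in E; destruct E as [_ ->]; exact Hs.
    - intros Hs; exists i; split; [apply pair_fst_le|]; exists s; split; [apply pair_snd_le|auto]. }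
  destruct (uniform_path P') as (F & HF & HFP).
  - intros i; destruct H0 as (s & Hs & Hm); exists s; rewrite HP'; auto.
  - intros i s Hs%HP'; destruct (HS s Hs) as (n & t & Ht & Hm); exists n, t; rewrite HP'; auto.
  - destruct (fun_section_exists F 0) as [G HG]; exists G; split; [eapply fun_section_fun; eassumption|].
    intros n s Hs; apply (HP' 0), (HFP 0 G HG n s Hs).
Qed.

Lemma in_body_mem (F T : nset M) n s : in_body F T -> is_restriction F n s -> s \in T.
Proof. intros H Hs; destruct (H n) as (t & Ht & Hm); rewrite (restriction_unique F n s t); auto. Qed.

(** The nodes of [T] that are compatible with [s] and dominate [g] beyond [s] form a tree without
    leaves, since every node of [T] has arbitrarily large successors. *)
Lemma laver_dominating_path (T g : nset M) s l : is_laver_tree T -> s \in T -> seq_len s l -> is_fun g ->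
  exists F, is_fun F /\ in_body F T /\ is_restriction F l s /\
    forall k a b, pair k a \in g -> pair (k + l) b \in F -> a <= b.
Proof.
  intros ((HT1 & HT2) & (s0 & Hs0 & Hs0T) & HT3) HsT Ls Hg.
  assert (Hs := HT1 s HsT).
  set (P := the_set (fun t => t \in T /\ (forall k, k <= t -> forall x, x <= t -> seq_entry t k x ->
    (k < l -> seq_entry s k x)) /\ (forall k, k <= t -> forall x, x <= t -> seq_entry t (k + l) x ->
      exists y, y <= x /\ pair k y \in g))).
  assert (HP : forall t, t \in P <-> t \in T /\ (forall k x, seq_entry t k x -> k < l -> seq_entry s k x) /\
    (forall k x, seq_entry t (k + l) x -> exists y, y <= x /\ pair k y \in g)).
  { intros t; unfold P; rewrite mem_the_set0 by def; split; intros (H1 & H2 & H3); split; auto; split; auto.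
    - intros k x Hx; destruct (seq_entry_le _ _ _ Hx); auto.
    - intros k x Hx; destruct (seq_entry_le _ _ _ Hx) as [Hk Hxt]; apply H3; auto.
      eapply le_trans; [apply (le_addr k l)|exact Hk]. }
  destruct (path_exists P) as (F & HF & HFP).
  - exists s0; split; [exact Hs0|]; apply HP; split; [exact Hs0T|].
    split; intros k x Hx; apply (seq_entry_len _ _ _ _ (proj2 Hs0)), nlt_0 in Hx; tauto.
  - intros t (Ht & Ht1 & Ht2)%HP; destruct (proj1 (HT1 t Ht)) as [k Lt].
    destruct (le_lt_dec l k) as [Hlk|Hkl].
    + apply le_iff in Hlk; destruct Hlk as [j Hj].
      destruct (fun_value g j Hg) as [y Hy].
      destruct (HT3 t Ht y) as (n & u & Hn & Hu & HuT); exists n, u; split; [exact Hu|]; apply HP.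
      split; [exact HuT|]; split.
      * intros i x Hx Hi; apply (snoc_entry t n u k i x Hu Lt) in Hx.
        destruct Hx as [[_ Hx]|[-> _]]; [apply Ht1; auto|].
        exfalso; rewrite Hj in Hi; apply (nlt_le (l + j) l); [apply le_addr|exact Hi].
      * intros i x Hx; apply (snoc_entry t n u k (i + l) x Hu Lt) in Hx.
        destruct Hx as [[_ Hx]|[E ->]]; [apply Ht2; auto|].
        exists y; split; [apply lt_le, Hn|].
        replace i with j; [exact Hy|]; apply (add_cancel_l _ _ l); rewrite <- Hj, <- E; ring.
    (* Inside the stem the next node is the initial segment of [s] of length [k + 1], on which the
       condition about [g] is vacuous. *)
    + assert (Hst : seq_initial t s).
      { apply (seq_initial_intro t s k l); auto; [apply lt_le, Hkl|].
        intros i x Hi Hx; apply Ht1; [exact Hx|eapply lt_trans; eassumption]. }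
      destruct (prefix_exists s l (k + 1)) as (u & Hu & Lu); auto; [apply (proj1 (le_lt_succ k l)), Hkl|].
      assert (Htu : seq_initial t u).
      { apply (seq_initial_linear t u s k (k + 1)); auto; apply lt_le, le_refl. }
      destruct (initial_snoc t u k Htu Lt Lu) as [n Hn]; exists n, u; split; [exact Hn|]; apply HP.
      split; [apply (HT2 u s); auto|]; split.
      * intros i x Hx _; eapply seq_initial_sub; eassumption.
      * intros i x Hx; assert (Hi := seq_entry_len _ _ _ _ Lu Hx); exfalso.
        apply (nlt_le (i + l) l); [apply le_addl|].
        eapply lt_le_trans; [exact Hi|]; apply (proj1 (le_lt_succ k l)), Hkl.
  - exists F; split; [exact HF|].
    assert (HB : in_body F T).
    { intros n; destruct (restriction_exists F n HF) as [t Ht]; exists t; split; [exact Ht|].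
      apply (HP t), (HFP n t Ht). }
    split; [exact HB|]; split.
    + destruct (restriction_exists F l HF) as [t Ht].
      replace s with t; [exact Ht|].
      apply (is_seq_ext t s l); [apply Ht|exact Hs|apply Ht|exact Ls|].
      intros i x Hi Hx; apply (proj1 (HP t) (HFP l t Ht)); auto.
    + intros k a b Ha Hb.
      destruct (restriction_exists F (k + l + 1) HF) as [t Ht].
      assert (Hx : seq_entry t (k + l) b).
      { apply (restriction_entry F _ t _ _ Ht); split; [apply le_refl|exact Hb]. }
      destruct (proj1 (HP t) (HFP _ t Ht)) as (_ & _ & H3).
      destruct (H3 k b Hx) as (y & Hy & Hyg); rewrite (fun_unique g k a y Hg Ha Hyg); exact Hy.
Qed.

End Sequences.

(** * From clopen Laver homogeneity to Sigma01 comprehension *)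

Section Jump.
Context {M : L2_structure} {HM : RCA0 M}.
Local Open Scope L2_scope.
Local Notation env := (nat -> num M).
Local Notation senv := (nat -> nset M).
Local Notation "x <= y" := (lt x (add y one)) : L2_scope.
Implicit Types (x y z a b c d i l m n q s t u v w : num M).

Add Ring num_ring3 : (num_semiring (M := M)).

(** Without a least element one could descend from [n] forever; [m + j <= n] records [j] steps of
    the descent in a Sigma01 formula, and j = n + 1 is absurd. *)
Lemma least_sig (P : num M -> Prop) : Sig (fun e _ => P (e O)) ->
  forall n, P n -> exists m, P m /\ forall k, k < m -> ~ P k.
Proof.
  intros HP n Hn; apply NNPP; intros Hno.
  enough (H : forall j, exists m, m + j <= n /\ P m).
  { destruct (H (n + 1)) as (m & Hm & _); apply (nlt_le (m + (n + 1)) (n + 1)).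
    - apply le_addl.
    - exact Hm. }
  apply ind_sig.
  - sig.
  - exists n; rewrite add_0r; split; [apply le_refl|exact Hn].
  - intros j (m & Hm & HPm); apply NNPP; intros H.
    apply Hno; exists m; split; [exact HPm|]; intros k Hk HPk; apply H; exists k; split; [|exact HPk].
    eapply le_trans; [|exact Hm]; apply lt_iff in Hk; destruct Hk as [x ->]; apply le_iff; exists x; ring.
Qed.

(* Among the positive [m] divisible by all moduli whose index has no witness
   below some [b], take the least: a later witness would yield a proper divisor. *)
Lemma strong_collection (P : num M -> num M -> Prop) :
  Def Delta00 (fun e _ => P (e O) (e 1%nat)) ->
  forall n, exists b, forall i, i < n -> (exists w, P i w) -> exists w, w < b /\ P i w.
Proof.
  intros HP n.
  destruct (common_multiple n) as (a & Ha & Hdiv).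
  (* Every modulus is at most [a * n + 1], so [m0] is a positive multiple of all of them and starts
     the search for the least one. *)
  destruct (common_multiple (a * n + 1)) as (m0 & Hm0 & Hdiv0).
  destruct (least_sig (fun m => 0 < m /\ exists b, forall i, i < n -> (forall w, w < b -> ~ P i w) ->
    exists c, m = c * (a * (i + 1) + 1))) with (n := m0) as (m & (Hm & b & Hb) & Hmin).
  - sig.
    apply (Def_subst0 _ (fun e k => match k with O => e 1%nat | _ => e O end) (fun E => E) HP).
    + intros [|k]; term.
    + intros; sterm.
  - split; [exact Hm0|]; exists 0; intros i Hi _; destruct (Hdiv0 (a * (i + 1))) as [c Hc].
    + apply mul_le_mono; [apply le_refl|]; apply (proj1 (le_lt_succ i n)), Hi.
    + exists c; rewrite Hc; ring.
  - exists b; intros i Hi [w Hw]; apply NNPP; intros Hno.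
    assert (Hno' : forall v, v < b -> ~ P i v) by (intros v Hv HPv; apply Hno; eauto).
    destruct (Hb i Hi Hno') as [c Hc].
    assert (Hc0 : c <> 0).
    { intros ->; rewrite mul_0l in Hc; rewrite Hc in Hm; exact (lt_irrefl _ Hm). }
    apply (Hmin c).
    + destruct (zero_or_succ c) as [->|[c' ->]]; [tauto|].
      apply lt_iff in Ha; destruct Ha as [k Hk]; rewrite Hc, Hk.
      apply lt_iff; exists (c' * ((0 + k + 1) * (i + 1)) + (k * i + k + i)); ring.
    + split; [apply lt_0_neq, Hc0|]; exists (b + w + 1); intros j Hj Hjw.
      destruct (Hb j Hj) as [c' Hc'].
      { intros v Hv; apply Hjw; eapply lt_trans; [exact Hv|].
        apply lt_iff; exists w; reflexivity. }
      (* The modulus of [j] divides [m], which is [c] times the modulus of [i], and it is coprime to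
         the latter; so it divides [c]. *)
      destruct (coprime_moduli a n Hdiv j i Hj Hi) as [u Hu].
      { intros ->; apply (Hjw w); [apply le_addl|exact Hw]. }
      set (d := a * (j + 1) + 1) in *.
      destruct (cong_remainder c d 0) as [_ [q Hq]]; [|apply le_0l|exists q; rewrite Hq; ring].
      apply (cong_trans _ _ (c * ((a * (i + 1) + 1) * u))).
      * apply cong_sym; eapply cong_trans; [apply cong_mul; [apply cong_refl|exact Hu]|].
        rewrite mul_comm, mul_1l; apply cong_refl.
      * replace (c * ((a * (i + 1) + 1) * u)) with (0 + (c' * u) * d); [apply cong_multiple|].
        transitivity ((c' * d) * u); [ring|]; rewrite <- Hc', Hc; ring.
Qed.

Definition zero_fun : nset M := the_set (fun p => exists n, n <= p /\ p = pair n 0).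

Lemma mem_zero_fun n m : pair n m \in zero_fun <-> m = 0.
Proof.
  unfold zero_fun; rewrite mem_the_set0 by def; split.
  - intros (n' & _ & E); apply pair_inj in E; apply E.
  - intros ->; exists n; split; [apply pair_fst_le|reflexivity].
Qed.

Lemma zero_fun_fun : is_fun zero_fun.
Proof.
  split.
  - intros p Hp; unfold zero_fun in Hp; rewrite mem_the_set0 in Hp by def.
    destruct Hp as (n & _ & ->); exists n, 0; reflexivity.
  - intros n; exists 0; split; [apply mem_zero_fun; reflexivity|].
    intros m Hm; symmetry; apply mem_zero_fun in Hm; exact Hm.
Qed.

Lemma laver_path (T : nset M) s l : is_laver_tree T -> s \in T -> seq_len s l ->
  exists F, is_fun F /\ in_body F T /\ is_restriction F l s.
Proof.
  intros HT Hs Ls; destruct (laver_dominating_path T zero_fun s l HT Hs Ls zero_fun_fun)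
    as (F & H1 & H2 & H3 & _); exists F; auto.
Qed.

Lemma restriction_mem (F : nset M) n s i x : is_restriction F n s -> seq_entry s i x -> pair i x \in F.
Proof. intros H Hx; apply (restriction_entry F n s i x H) in Hx; apply Hx. Qed.

Lemma snoc_last s n t l : is_snoc s n t -> seq_len s l -> seq_entry t l n.
Proof. intros H Hl; apply (snoc_entry s n t l); auto. Qed.

Lemma snoc_sub s n t i x : is_snoc s n t -> seq_entry s i x -> seq_entry t i x.
Proof. intros H; apply seq_initial_sub; eapply snoc_initial; exact H. Qed.

(** The later sections assume ACA_0 in this form only; arithmetical comprehension is derived from it
    by Skolem functions. *)
Definition sigma_comprehension : Prop := forall P : num M -> num M -> Prop,
  Def Delta00 (fun e _ => P (e O) (e 1%nat)) -> exists K, forall n, n \in K <-> exists w, P n w.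

Section OpenSet.
Variable P : num M -> num M -> Prop.
Hypothesis HP : Def Delta00 (fun e _ => P (e O) (e 1%nat)).

Lemma HP_subst f g : Term f -> Term g -> Def Delta00 (fun e _ => P (f e) (g e)).
Proof.
  intros Hf Hg; apply (Def_subst0 _ (fun e k => match k with O => f e | _ => g e end) (fun E => E) HP).
  - intros [|k]; assumption.
  - intros; sterm.
Qed.

Definition first_witness n m r : Prop :=
  exists i, i < n /\ ((forall w, w <= m -> ~ P i w) /\ exists w, w <= r /\ P i w).

Definition reads (R : num M -> num M -> num M -> Prop) s : Prop :=
  is_seq s /\ exists n, n <= s /\ exists m, m <= s /\ exists r, r <= s /\
    (seq_entry s 0 n /\ seq_entry s 1 m /\ seq_entry s (1 + 1) r /\ R n m r).

(** Three values of the function settle membership, so the open sets given by [R] and by its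
    negation are complementary. *)
Lemma in_open_reads R F n m r : (forall s, s \in the_set (reads R) <-> reads R s) -> is_fun F ->
  pair 0 n \in F -> pair 1 m \in F -> pair (1 + 1) r \in F ->
  in_open F (the_set (reads R)) <-> R n m r.
Proof.
  intros HR HF Hn Hm Hr; split.
  - intros (k & s & Hs & H%HR); destruct H as (_ & n' & _ & m' & _ & r' & _ & H1 & H2 & H3 & H4).
    rewrite (fun_unique F 0 n n'), (fun_unique F 1 m m'), (fun_unique F (1 + 1) r r'); auto;
      eapply restriction_mem; eassumption.
  - intros H; destruct (restriction_exists F (1 + 1 + 1) HF) as [s Hs]; exists (1 + 1 + 1), s.
    split; [exact Hs|]; apply HR; split; [apply Hs|].
    assert (H0 : seq_entry s 0 n).
    { apply (restriction_entry F _ s _ _ Hs); split; [apply le_0l|exact Hn]. }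
    assert (H1 : seq_entry s 1 m).
    { apply (restriction_entry F _ s _ _ Hs); split; [apply lt_le, le_refl|exact Hm]. }
    assert (H2 : seq_entry s (1 + 1) r).
    { apply (restriction_entry F _ s _ _ Hs); split; [apply le_refl|exact Hr]. }
    exists n; split; [apply (seq_entry_le s 0 n H0)|]; exists m; split; [apply (seq_entry_le s 1 m H1)|].
    exists r; split; [apply (seq_entry_le s _ r H2)|auto].
Qed.

Lemma sigma_comprehension_of_LL : LL_Delta01 M -> exists K, forall n, n \in K <-> exists w, P n w.
Proof.
  intros LL.
  assert (HA : forall s, s \in the_set (reads first_witness) <-> reads first_witness s).
  { intros s; apply mem_the_set0; unfold reads, first_witness; def; apply HP_subst; term. }
  assert (HB : forall s, s \in the_set (reads (fun n m r => ~ first_witness n m r)) <->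
     reads (fun n m r => ~ first_witness n m r) s).
  { intros s; apply mem_the_set0; unfold reads, first_witness; def; apply HP_subst; term. }
  destruct (LL (the_set (reads first_witness)) (the_set (reads (fun n m r => ~ first_witness n m r))))
    as (T & HT & Hhom).
  { split; [intros s Hs; apply HA in Hs; apply Hs|]; split; [intros s Hs; apply HB in Hs; apply Hs|].
    intros F HF; destruct (fun_value F 0 HF) as [n Hn], (fun_value F 1 HF) as [m Hm],
      (fun_value F (1 + 1) HF) as [r Hr].
    rewrite (in_open_reads _ F n m r HA), (in_open_reads _ F n m r HB); auto.
    split; [tauto|apply NNPP]. }
  assert (HT' := HT); destruct HT' as (_ & (s0 & Hs0 & Hs0T) & Hch).
  assert (Hnode : forall i k, exists n m s, i < n /\ k < m /\ s \in T /\ seq_len s (1 + 1) /\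
     seq_entry s 0 n /\ seq_entry s 1 m).
  { intros i k; destruct (Hch s0 Hs0T i) as (n & s1 & Hn & Hs1 & Hs1T).
    destruct (Hch s1 Hs1T k) as (m & s2 & Hm & Hs2 & Hs2T).
    assert (L1 : seq_len s1 1).
    { rewrite <- (add_0l 1); eapply snoc_len; [exact Hs1|apply Hs0]. }
    exists n, m, s2; repeat split; auto.
    - eapply snoc_len; eassumption.
    - eapply snoc_sub; [exact Hs2|]; eapply snoc_last; [exact Hs1|apply Hs0].
    - eapply snoc_last; eassumption. }
  destruct Hhom as [Hhom|Hhom].
  (* This colour cannot be homogeneous: by [strong_collection] all i < n that ever get a witness get
     one below some [b], and f(1) may be taken above [b]. *)
  - exfalso.
    destruct (Hch s0 Hs0T 0) as (n & s1 & _ & Hs1 & Hs1T).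
    destruct (strong_collection P HP n) as [b Hb].
    destruct (Hch s1 Hs1T b) as (m & s2 & Hm & Hs2 & Hs2T).
    assert (L1 : seq_len s1 1).
    { rewrite <- (add_0l 1); eapply snoc_len; [exact Hs1|apply Hs0]. }
    assert (L2 : seq_len s2 (1 + 1)) by (eapply snoc_len; eassumption).
    destruct (laver_path T s2 _ HT Hs2T L2) as (F & HF & HFT & HFs).
    destruct (fun_value F (1 + 1) HF) as [r Hr].
    assert (H := Hhom F HF HFT).
    rewrite (in_open_reads _ F n m r HA HF) in H; auto.
    + destruct H as (i & Hi & Hno & w & Hw & HPw).
      destruct (Hb i Hi) as (v & Hv & HPv); [eauto|].
      apply (Hno v); [|exact HPv]; apply lt_le; eapply lt_trans; eassumption.
    + eapply restriction_mem; [exact HFs|]; eapply snoc_sub; [exact Hs2|].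
      eapply snoc_last; [exact Hs1|apply Hs0].
    + eapply restriction_mem; [exact HFs|]; eapply snoc_last; eassumption.
  (* The complement is Sigma01 too: [i] is outside iff some node (n, m) of [T] with i < n sees no
     witness up to [m]. *)
  - apply delta1_comprehension.
    + apply Sig_ex, Sig_Def, HP_subst; term.
    + apply (Sig_ext _ (fun e _ => exists s, s \in T /\ seq_len s (1 + 1) /\ exists n, n <= s /\
        exists m, m <= s /\ (seq_entry s 0 n /\ seq_entry s 1 m /\ e O < n /\
        forall w, w <= m -> ~ P (e O) w))).
      2: { sig; apply Sig_Def; def; apply HP_subst; term. }
      intros e _; set (i := e O); split.
      * intros Hno; destruct (Hnode i 0) as (n & m & s & Hn & _ & HsT & Ls & H0 & H1).
        exists s; split; [exact HsT|]; split; [exact Ls|].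
        exists n; split; [apply (seq_entry_le s 0 n H0)|]; exists m; split; [apply (seq_entry_le s 1 m H1)|].
        repeat split; auto; intros w _ Hw; apply Hno; eauto.
      (* A later witness [w] would give the forbidden colour to a path of [T] whose third value
         exceeds [w]. *)
      * intros (s & HsT & Ls & n & _ & m & _ & H0 & H1 & Hi & Hno) [w Hw].
        destruct (Hch s HsT w) as (r & u & Hr & Hu & HuT).
        destruct (laver_path T u (1 + 1 + 1) HT HuT) as (F & HF & HFT & HFu).
        { eapply snoc_len; eassumption. }
        apply (Hhom F HF HFT), (in_open_reads _ F n m r HA HF).
        -- eapply restriction_mem; [exact HFu|]; eapply snoc_sub; eassumption.
        -- eapply restriction_mem; [exact HFu|]; eapply snoc_sub; eassumption.
        -- eapply restriction_mem; [exact HFu|]; eapply snoc_last; eassumption.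
        -- exists i; split; [exact Hi|]; split; [exact Hno|]; exists w; split; [apply lt_le, Hr|exact Hw].
Qed.

End OpenSet.
End Jump.

(** * Skolem functions for arithmetical formulas *)

Lemma scons_eta {A} (e : nat -> A) : scons (e O) (fun k => e (S k)) = e.
Proof. apply functional_extensionality; intros [|k]; reflexivity. Qed.

Section Skolem.
Context {M : L2_structure} {HM : RCA0 M}.
Local Open Scope L2_scope.
Local Notation env := (nat -> num M).
Local Notation senv := (nat -> nset M).
Local Notation "x <= y" := (lt x (add y one)) : L2_scope.
Implicit Types (x y z a b c d i l m n q s t u w : num M) (v e : nat -> num M).

Add Ring num_ring4 : (num_semiring (M := M)).

Lemma SDef_scons C {HC : form_class C} (X : env -> senv -> nset M) G :
  (forall f r, Term f -> (forall j, Term (fun e => r e j)) -> Def C (fun e E => f e \in X (r e) E)) ->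
  SDef C G -> SDef C (fun e E => scons (X e E) (G e E)).
Proof. intros HX HG [|k] f r Hf Hr; simpl; [apply HX|apply HG]; assumption. Qed.

Lemma SDef_shift C {HC : form_class C} : SDef (M := M) C (fun _ E k => E (S k)).
Proof. apply SDef_STerm; [exact _|]; intros k; sterm. Qed.

Lemma SDef_id C {HC : form_class C} : SDef (M := M) C (fun _ E => E).
Proof. apply SDef_STerm; [exact _|]; intros k; sterm. Qed.

Lemma SDef_const C {HC : form_class C} (E : senv) : SDef C (fun _ _ => E).
Proof. apply SDef_STerm; [exact _|]; intros k; sterm. Qed.

Lemma Sig_sets (P : env -> senv -> Prop) r G : Sig P -> (forall k, Term (fun e => r e k)) ->
  SDef Delta00 G -> Sig (fun e E => P (r e) (G e E)).
Proof.
  intros (Q & HQ & H) Hr HG.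
  exists (fun e E => Q (scons (e O) (r (fun k => e (S k)))) (G (fun k => e (S k)) E)); split.
  - apply (Def_subst_Delta00 _ Q (fun e => scons (e O) (r (fun k => e (S k))))
      (fun e E => G (fun k => e (S k)) E)); [exact HQ| |].
    + intros k; apply (Term_scons (fun e => e O) (fun e => r (fun k => e (S k)))); [term|].
      intros j; apply (Term_shift (fun e => r e j)), Hr.
    + intros k f s Hf Hs; apply (HG k f (fun e j => s e (S j)) Hf); intros j; apply (Hs (S j)).
  - intros e E; apply H.
Qed.

Lemma double_inj x y : x + x = y + y -> x = y.
Proof.
  intros H; destruct (trichotomy x y) as [Hl|[Hl|Hl]]; auto; exfalso;
    apply lt_iff in Hl; destruct Hl as [k ->].
  - apply (lt_irrefl (x + x)), lt_iff; exists (k + k + 1); rewrite H at 1; ring.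
  - apply (lt_irrefl (y + y)), lt_iff; exists (k + k + 1); rewrite <- H at 1; ring.
Qed.

Lemma double_neq x y : x + x <> y + y + 1.
Proof.
  intros H; apply (succ_neq0 (0 : num M)); rewrite add_0l; symmetry.
  apply (mod_unique (1 + 1) x y); [apply le_0l|apply le_refl|].
  transitivity (x + x); [ring|rewrite H; ring].
Qed.

Lemma parity x : exists n, x = n + n \/ x = n + n + 1.
Proof.
  destruct (division x (1 + 1)) as (n & r & E & Hr); [apply le_0l|]; exists n.
  apply lt_succ in Hr; destruct Hr as [Hr| ->]; [left|right; rewrite E; ring].
  rewrite <- (add_0l 1) in Hr; apply le_0_inv in Hr; subst r; rewrite E; ring.
Qed.

(* Two functions are coded by one: on even and on odd arguments (j = 0, 1). *)
Definition half j (W : nset M) : nset M :=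
  the_set (fun p => exists n, n <= p /\ exists m, m <= p /\ (p = pair n m /\ pair (n + n + j) m \in W)).

Lemma mem_half j W p : p \in half j W <-> exists n, n <= p /\ exists m, m <= p /\
  (p = pair n m /\ pair (n + n + j) m \in W).
Proof. unfold half; rewrite mem_the_set0 by def; reflexivity. Qed.

Lemma pair_half j W n m : pair n m \in half j W <-> pair (n + n + j) m \in W.
Proof.
  rewrite mem_half; split.
  - intros (n' & _ & m' & _ & E & H); apply pair_inj in E; destruct E as [-> ->]; exact H.
  - intros H; exists n; split; [apply pair_fst_le|]; exists m; split; [apply pair_snd_le|auto].
Qed.

Lemma half_fun j W : is_fun W -> is_fun (half j W).
Proof.
  intros HW; split.
  - intros p (n & _ & m & _ & -> & _)%mem_half; exists n, m; reflexivity.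
  - intros n; destruct (fun_value W (n + n + j) HW) as [m Hm]; exists m; split.
    + apply pair_half, Hm.
    + intros m' Hm'%pair_half; eapply fun_unique; eassumption.
Qed.

Lemma Def_half C {HC : form_class C} j f g : Term f -> STerm g ->
  Def C (fun e E => f e \in half j (g E)).
Proof.
  intros Hf Hg; eapply Def_ext; [intros e E; apply mem_half|].
  def.
Qed.

Lemma fun_ext (F G : nset M) : is_fun F -> is_fun G ->
  (forall n m, pair n m \in F <-> pair n m \in G) -> F = G.
Proof.
  intros HF HG H; apply mem_ext; intros p; split; intros Hp.
  - destruct (proj1 HF p Hp) as (n & m & ->); apply H, Hp.
  - destruct (proj1 HG p Hp) as (n & m & ->); apply H, Hp.
Qed.

Lemma merge_functions F G : is_fun F -> is_fun G ->
  exists W, is_fun W /\ half 0 W = F /\ half 1 W = G.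
Proof.
  intros HF HG.
  destruct (function_of_graph (fun p m => exists n, n <= p /\
    ((p = n + n /\ pair n m \in F) \/ (p = n + n + 1 /\ pair n m \in G)))) as (W & HW & H).
  - sig.
  - intros p; destruct (parity p) as [n [->| ->]].
    + destruct (fun_value F n HF) as [m Hm]; exists m, n; split; [apply le_addr|auto].
    + destruct (fun_value G n HG) as [m Hm]; exists m, n; split; [|auto].
      apply le_iff; exists (n + 1); ring.
  - intros p x y (n & _ & [[-> Hx]|[-> Hx]]) (n' & _ & [[E Hy]|[E Hy]]).
    + apply double_inj in E; subst n'; eapply fun_unique; [exact HF| |]; eassumption.
    + apply double_neq in E; tauto.
    + symmetry in E; apply double_neq in E; tauto.
    + apply add_cancel, double_inj in E; subst n'; eapply fun_unique; [exact HG| |]; eassumption.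
  - exists W; split; [exact HW|]; split; apply fun_ext; auto using half_fun; intros n m;
      rewrite pair_half, H; split.
    + rewrite add_0r; intros (n' & _ & [[E Hm]|[E Hm]]).
      * apply double_inj in E; subst n'; exact Hm.
      * apply double_neq in E; tauto.
    + intros Hm; exists n; rewrite add_0r; split; [apply le_addr|auto].
    + intros (n' & _ & [[E Hm]|[E Hm]]).
      * symmetry in E; apply double_neq in E; tauto.
      * apply add_cancel, double_inj in E; subst n'; exact Hm.
    + intros Hm; exists n; split; [apply le_iff; exists (n + 1); ring|auto].
Qed.

Definition Pi (P : env -> senv -> Prop) : Prop := Sig (fun e E => ~ P e E).

(* [W] codes Skolem functions for all subformulas; being such a code is Pi01,
   and [W] reduces the predicate to the Delta00 condition [Q]. *)
Definition skolemizable (P : env -> senv -> Prop) : Prop :=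
  exists (Good : senv -> Prop) (Q : env -> senv -> Prop),
    Pi (fun _ E => Good E) /\ Def Delta00 Q /\
    (forall E, exists W, is_fun W /\ Good (scons W E)) /\
    (forall E W, is_fun W -> Good (scons W E) -> forall e, P e E <-> Q e (scons W E)).

Lemma skolemizable_ext P Q : (forall e E, P e E <-> Q e E) -> skolemizable Q -> skolemizable P.
Proof.
  intros H (G & R & HG & HR & Hex & HQ); exists G, R; split; [exact HG|]; split; [exact HR|].
  split; [exact Hex|]; intros E W HW HGW e; rewrite H; apply HQ; assumption.
Qed.

Lemma skolemizable_Delta00 P : Def Delta00 P -> skolemizable P.
Proof.
  intros HP; exists (fun _ => True), (fun e E => P e (fun k => E (S k))).
  split; [|split; [|split]].
  - apply Sig_Def; def.
  - apply (Def_subst0 P (fun e => e) (fun E k => E (S k)) HP); intros k; [term|sterm].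
  - intros E; exists zero_fun; split; [apply zero_fun_fun|exact I].
  - reflexivity.
Qed.

Lemma skolemizable_not P : skolemizable P -> skolemizable (fun e E => ~ P e E).
Proof.
  intros (G & R & HG & HR & Hex & HQ); exists G, (fun e E => ~ R e E).
  split; [exact HG|]; split; [def|]; split; [exact Hex|].
  intros E W HW HGW e; rewrite (HQ E W HW HGW e); reflexivity.
Qed.

Lemma SDef_half C {HC : form_class C} j :
  SDef C (fun (_ : env) (E : senv) => scons (half j (E O)) (fun k => E (S k))).
Proof.
  apply (SDef_scons C (fun _ E => half j (E O)) (fun _ E k => E (S k))).
  - intros f r Hf _; apply (Def_half C j f (fun E => E O)); [exact Hf|sterm].
  - apply SDef_shift; exact _.
Qed.

Lemma Def_in_half j (P : env -> senv -> Prop) r : Def Delta00 P -> (forall k, Term (fun e => r e k)) ->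
  Def Delta00 (fun e E => P (r e) (scons (half j (E O)) (fun k => E (S k)))).
Proof.
  intros HP Hr; apply (Def_subst_Delta00 _ P r (fun _ E => scons (half j (E O)) (fun k => E (S k))) HP Hr).
  apply SDef_half; exact _.
Qed.

Lemma Sig_in_half j (P : env -> senv -> Prop) : Sig P ->
  Sig (fun e E => P e (scons (half j (E O)) (fun k => E (S k)))).
Proof.
  intros HP; apply (Sig_sets P (fun e => e) (fun _ E => scons (half j (E O)) (fun k => E (S k))) HP).
  - intros; term.
  - apply SDef_half; exact _.
Qed.

Lemma skolemizable_and P Q : skolemizable P -> skolemizable Q -> skolemizable (fun e E => P e E /\ Q e E).
Proof.
  intros (G1 & R1 & HG1 & HR1 & Hex1 & HQ1) (G2 & R2 & HG2 & HR2 & Hex2 & HQ2).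
  exists (fun E => G1 (scons (half 0 (E O)) (fun k => E (S k))) /\ G2 (scons (half 1 (E O)) (fun k => E (S k)))),
    (fun e E => R1 e (scons (half 0 (E O)) (fun k => E (S k))) /\ R2 e (scons (half 1 (E O)) (fun k => E (S k)))).
  split; [|split; [|split]].
  - eapply Sig_ext; [|apply Sig_or; [apply (Sig_in_half 0 _ HG1)|apply (Sig_in_half 1 _ HG2)]].
    intros e E; simpl; split; [apply not_and_or|tauto].
  - apply Def_and; [exact _| |].
    + apply (Def_in_half 0 R1 (fun e => e)); [exact HR1|intros; term].
    + apply (Def_in_half 1 R2 (fun e => e)); [exact HR2|intros; term].
  - intros E; destruct (Hex1 E) as (W1 & HW1 & HG1'), (Hex2 E) as (W2 & HW2 & HG2').
    destruct (merge_functions W1 W2 HW1 HW2) as (W & HW & E1 & E2); exists W; split; [exact HW|].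
    simpl; rewrite E1, E2; split; assumption.
  - intros E W HW [HG1' HG2'] e.
    rewrite (HQ1 E _ (half_fun 0 W HW) HG1' e), (HQ2 E _ (half_fun 1 W HW) HG2' e); reflexivity.
Qed.

(** [N] is a standard number; the tuple will serve as the argument of a Skolem function for a
    formula whose variables are bounded by [N]. *)
Fixpoint tup (N : nat) (e : env) : num M :=
  match N with O => 0 | S N => pair (e O) (tup N (fun k => e (S k))) end.

Lemma Term_tup N r : (forall k, Term (fun e => r e k)) -> Term (fun e => tup N (r e)).
Proof.
  revert r; induction N; intros r Hr; simpl; [term|].
  apply Term_pair; [apply Hr|apply (IHN (fun e k => r e (S k))); intros k; apply Hr].
Qed.

Lemma tup_inj N : forall e e', tup N e = tup N e' -> forall k, (k < N)%nat -> e k = e' k.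
Proof.
  induction N; intros e e' H k Hk; [lia|]; simpl in H; apply pair_inj in H; destruct H as [H0 H].
  destruct k; [exact H0|]; apply (IHN _ _ H k); lia.
Qed.

Lemma tup_agree N : forall e e', (forall k, (k < N)%nat -> e k = e' k) -> tup N e = tup N e'.
Proof.
  induction N; intros e e' H; simpl; [reflexivity|].
  rewrite (H O) by lia; f_equal; apply IHN; intros k Hk; apply H; lia.
Qed.

Definition cat (N : nat) (v e : env) (k : nat) : num M :=
  if Nat.ltb k N then v k else e (k - N)%nat.

Lemma cat_lt N v e k : (k < N)%nat -> cat N v e k = v k.
Proof. intros H; unfold cat; apply Nat.ltb_lt in H; rewrite H; reflexivity. Qed.

Lemma cat_ge N v e k : cat N v e (k + N)%nat = e k.
Proof.
  unfold cat; replace (Nat.ltb (k + N) N) with false by (symmetry; apply Nat.ltb_ge; lia).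
  f_equal; lia.
Qed.

(** A quantifier over environments is not one of the model, but only [N] values of [v] matter, so it
    amounts to [N] number quantifiers, added one at a time. *)
Lemma Sig_exists_block N (P : env -> senv -> Prop) : Sig P ->
  Sig (fun e E => exists v : env, P (cat N v e) E).
Proof.
  intros HP; induction N.
  - apply (Sig_ext _ P); [|exact HP]; intros e E.
    assert (H : forall v, cat 0 v e = e).
    { intros v; apply functional_extensionality; intros k.
      rewrite <- (Nat.add_0_r k) at 1; apply cat_ge. }
    split; [intros [v Hv]; rewrite H in Hv; exact Hv|intros H'; exists e; rewrite H; exact H'].
  - apply (Sig_ext _ (fun e E => exists x, exists v : env, P (cat N v (scons x e)) E)).
    + assert (H : forall v e, cat (S N) v e = cat N v (scons (v N) e)).
      { intros v e; apply functional_extensionality; intros k.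
        destruct (Nat.lt_trichotomy k N) as [H|[->|H]].
        - rewrite !cat_lt by lia; reflexivity.
        - rewrite cat_lt by lia; symmetry; exact (cat_ge N v (scons (v N) e) 0).
        - replace k with ((k - S N) + S N)%nat at 1 by lia; rewrite cat_ge.
          replace k with (S (k - S N) + N)%nat at 2 by lia; rewrite cat_ge; reflexivity. }
      intros e E; split.
      * intros [v Hv]; exists (v N), v; rewrite <- H; exact Hv.
      * intros (x & v & Hv); exists (fun k => if Nat.ltb k N then v k else x).
        rewrite H, Nat.ltb_irrefl.
        replace (cat N (fun k => if Nat.ltb k N then v k else x) (scons x e)) with (cat N v (scons x e)); [exact Hv|].
        apply functional_extensionality; intros k; unfold cat; destruct (Nat.ltb k N); reflexivity.
    + apply Sig_ex; eapply Sig_ext; [|exact IHN].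
      intros e E; rewrite scons_eta; reflexivity.
Qed.

Section WithComprehension.
Hypothesis SCA : sigma_comprehension (M := M).

Lemma sig_comprehension (P : num M -> Prop) :
  Sig (fun e _ => P (e O)) -> exists K, forall n, n \in K <-> P n.
Proof.
  intros (Q & HQ & H); destruct (nset_inhabited M) as [X].
  destruct (SCA (fun n w => Q (scons w (scons n (fun _ => 0))) (fun _ => X))) as [K HK].
  - apply (Def_subst_Delta00 _ Q (fun e => scons (e 1%nat) (scons (e O) (fun _ => 0))) (fun _ _ _ => X) HQ).
    + intros [|[|k]]; simpl; term.
    + apply SDef_const; exact _.
  - exists K; intros n; rewrite HK; symmetry; apply (H (scons n (fun _ => 0))).
Qed.

Lemma Sig_fix_sets (P : env -> senv -> Prop) E r : Sig P -> (forall k, Term (fun e => r e k)) ->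
  Sig (fun e _ => P (r e) E).
Proof.
  intros HP Hr; apply (Sig_sets P r (fun _ _ => E) HP Hr).
  apply SDef_const; exact _.
Qed.

(* [g] maps (the code of) [v] to [0], or to [y + 1] with the least [y] satisfying [Q]. *)
Lemma skolem_function N (Q : env -> Prop) : Def Delta00 (fun e _ => Q e) ->
  (forall e e', (forall k, (k < N)%nat -> e k = e' k) -> Q e <-> Q e') ->
  exists g, is_fun g /\ forall v m, pair (tup N v) m \in g ->
    (m = 0 -> forall x, ~ Q (scons x v)) /\ (forall y, m = y + 1 -> Q (scons y v)).
Proof.
  intros HQ HN.
  assert (HN' : forall x v v', tup N v = tup N v' -> Q (scons x v) <-> Q (scons x v')).
  { intros x v v' H; apply HN; intros [|k] Hk; simpl; [reflexivity|].
    apply (tup_inj N v v' H); lia. }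
  destruct (sig_comprehension (fun p => exists c, c <= p /\ exists y, y <= p /\ (p = pair c y /\
    exists v : env, c = tup N v /\ Q (scons y v)))) as [KQ HKQ].
  (* Variables below [N] hold the tuple, variable [N] its code, and variable [S N] the candidate
     value. *)
  { set (P := fun (e : env) (_ : senv) => e N = tup N e /\ Q (scons (e (S N)) e)).
    assert (HP : Sig P).
    { apply Sig_Def; unfold P; apply (Def_and _ (fun e _ => e N = tup N e)).
      - apply Def_eq; [exact _|term|apply (Term_tup N (fun e => e)); intros; term].
      - apply (Def_subst0 (fun e _ => Q e) (fun e => scons (e (S N)) e) (fun E => E) HQ).
        + intros k; apply (Term_scons (fun e => e (S N)) (fun e => e)); [term|intros; term].
        + intros; sterm. }
    assert (HPc : forall f g, Term f -> Term g ->
      Sig (fun e (_ : senv) => exists v : env, f e = tup N v /\ Q (scons (g e) v))).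
    { intros f g Hf Hg.
      destruct (nset_inhabited M) as [X].
      apply (Sig_ext _ (fun e _ => exists v : env, P (cat N v (scons (f e) (scons (g e) e))) (fun _ => X))).
      - intros e _; unfold P.
        assert (Hc : forall v, cat N v (scons (f e) (scons (g e) e)) N = f e) by (intros v; exact (cat_ge N v (scons (f e) (scons (g e) e)) 0)).
        assert (Hc' : forall v, cat N v (scons (f e) (scons (g e) e)) (S N) = g e) by (intros v; exact (cat_ge N v (scons (f e) (scons (g e) e)) 1)).
        assert (Ht : forall v, tup N (cat N v (scons (f e) (scons (g e) e))) = tup N v).
        { intros v; apply tup_agree; intros k Hk; apply cat_lt, Hk. }
        split; intros [v [H1 H2]]; exists v; rewrite Hc, Hc', Ht in *; split; auto.
        + apply (HN' _ _ v (Ht v)), H2.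
        + apply (HN' _ _ v (Ht v)), H2.
      - apply (Sig_fix_sets _ (fun _ => X) (fun e => scons (f e) (scons (g e) e)) (Sig_exists_block N P HP)).
        intros [|[|k]]; simpl; term. }
    sig; apply HPc; term. }
  assert (HK : forall c y, pair c y \in KQ <-> exists v : env, c = tup N v /\ Q (scons y v)).
  { intros c y; rewrite HKQ; split.
    - intros (c' & _ & y' & _ & E & H); apply pair_inj in E; destruct E as [-> ->]; exact H.
    - intros H; exists c; split; [apply pair_fst_le|]; exists y; split; [apply pair_snd_le|auto]. }
  (* With the set of satisfying pairs and its domain at hand, the graph of the minimizing function
     needs bounded quantifiers only. *)
  destruct (sig_comprehension (fun c => exists y, pair c y \in KQ)) as [KE HKE]; [sig|].
  destruct (function_of_graph (fun c m => (m = 0 /\ ~ c \in KE) \/ exists y, y <= m /\ (m = y + 1 /\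
    pair c y \in KQ /\ forall z, z < y -> ~ pair c z \in KQ))) as (g & Hg & Hgm).
  - sig.
  - intros c; destruct (classic (c \in KE)) as [H|H]; [|exists 0; auto].
    apply HKE in H; destruct H as [y0 Hy0].
    destruct (least0 (fun y => pair c y \in KQ)) with (n := y0) as (y & Hy & _ & Hmin); [def|exact Hy0|].
    exists (y + 1); right; exists y; split; [apply lt_le, le_refl|auto].
  - intros c x y [[-> Hx]|(u & _ & -> & Hu & Hmin)] [[-> Hy]|(w & _ & -> & Hw & Hmin')]; auto.
    + exfalso; apply Hx, HKE; eauto.
    + exfalso; apply Hy, HKE; eauto.
    + destruct (trichotomy u w) as [H|[->|H]]; [exfalso|reflexivity|exfalso].
      * exact (Hmin' u H Hu).
      * exact (Hmin w H Hw).
  - exists g; split; [exact Hg|]; intros v m Hm%Hgm; split.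
    + intros -> x Hx; destruct Hm as [[_ H]|(y & _ & E & _)]; [|symmetry in E; exact (succ_neq0 _ E)].
      apply H, HKE; exists x; apply HK; exists v; auto.
    + intros y ->; destruct Hm as [[E _]|(y' & _ & E & Hy & _)]; [exfalso; exact (succ_neq0 _ E)|].
      apply succ_inj in E; subst y'; apply HK in Hy; destruct Hy as (v' & E & Hv').
      apply (HN' _ _ _ E), Hv'.
Qed.

(** Half 1 of the code is a Skolem function for the new quantifier, with value 0 if there is no
    witness; the formula then says that a value differs from 0. Correctness of the function is Pi01
    because [R] is already Delta00. *)
Lemma skolemizable_ex P : skolemizable P -> skolemizable (fun e E => exists x, P (scons x e) E).
Proof.
  intros (G & R & HG & HR & Hex & HQ).
  destruct (Def_agree _ _ HR) as [N HN].
  set (sub := fun E : senv => scons (half 0 (E O)) (fun k => E (S k))).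
  exists (fun E => G (sub E) /\ forall v m, pair (tup N v) m \in half 1 (E O) ->
      (m = 0 -> forall x, ~ R (scons x v) (sub E)) /\ (forall y, m = y + 1 -> R (scons y v) (sub E))),
    (fun e E => ~ pair (tup N e) 0 \in half 1 (E O)).
  split; [|split; [|split]].
  - apply (Sig_ext _ (fun e E => ~ G (sub E) \/ exists v : env, exists m,
      pair (tup N (cat N v e)) m \in half 1 (E O) /\
      ((m = 0 /\ exists x, R (scons x (cat N v e)) (sub E)) \/
       (exists y, m = y + 1 /\ ~ R (scons y (cat N v e)) (sub E))))).
    + intros e E.
      assert (Ht : forall v, tup N (cat N v e) = tup N v).
      { intros v; apply tup_agree; intros k Hk; apply cat_lt, Hk. }
      assert (HRc : forall x v, R (scons x (cat N v e)) (sub E) <-> R (scons x v) (sub E)).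
      { intros x v; apply HN; intros [|k] Hk; simpl; [reflexivity|]; apply cat_lt; lia. }
      split.
      * intros [H|H]%not_and_or; [left; exact H|right]; apply not_all_ex_not in H; destruct H as [v H].
        exists v; apply not_all_ex_not in H; destruct H as [m H]; exists m; rewrite Ht.
        apply imply_to_and in H; destruct H as [Hm H]; split; [exact Hm|].
        apply not_and_or in H; destruct H as [H|H]; [left|right].
        -- apply imply_to_and in H; destruct H as [Hm0 H]; split; [exact Hm0|].
           apply not_all_not_ex in H; destruct H as [x Hx]; exists x; apply HRc, Hx.
        -- apply not_all_ex_not in H; destruct H as [y H]; exists y.
           apply imply_to_and in H; rewrite HRc; exact H.
      * intros [H|(v & m & Hm & H)] [HGE HH]; [exact (H HGE)|]; rewrite Ht in Hm.
        destruct (HH v m Hm) as [H1 H2]; destruct H as [[Hm0 [x Hx]]|(y & Hy & HRy)].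
        -- exact (H1 Hm0 x (proj1 (HRc x v) Hx)).
        -- apply HRy, HRc, H2, Hy.
    + apply Sig_or; [exact (Sig_in_half 0 _ HG)|].
      apply (Sig_exists_block N (fun e E => exists m, pair (tup N e) m \in half 1 (E O) /\
        ((m = 0 /\ exists x, R (scons x e) (sub E)) \/ (exists y, m = y + 1 /\ ~ R (scons y e) (sub E))))).
      assert (HRs : forall r, (forall k, Term (fun e => r e k)) ->
        Def Delta00 (fun e E => R (r e) (sub E))).
      { intros r Hr; apply (Def_in_half 0 R r HR Hr). }
      apply Sig_ex, Sig_and.
      * apply Sig_Def, Def_half; [exact _| |sterm]; apply Term_pair; [|term].
        apply (Term_tup N (fun e k => e (S k))); intros; term.
      * sig; apply Sig_Def; def; apply HRs; intros [|k]; simpl; term.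
  - apply Def_not; [exact _|]; apply Def_half; [exact _| |sterm]; apply Term_pair; [|term].
    apply (Term_tup N (fun e => e)); intros; term.
  - intros E; destruct (Hex E) as (W & HW & HGW).
    destruct (skolem_function N (fun e => R e (scons W E))) as (g & Hg & Hgv).
    + apply (Def_subst_Delta00 _ R (fun e => e) (fun _ _ => scons W E) HR); [intros; term|].
      apply SDef_const; exact _.
    + intros e e' H; apply HN, H.
    + destruct (merge_functions W g HW Hg) as (V & HV & E1 & E2); exists V; split; [exact HV|].
      unfold sub; simpl; rewrite E1, E2; split; assumption.
  - intros E W HW [HGW HH] e; simpl.
    assert (Hx : (exists x, P (scons x e) E) <-> exists x, R (scons x e) (sub (scons W E))).
    { split; intros [x Hx]; exists x; apply (HQ E _ (half_fun 0 W HW) HGW); exact Hx. }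
    rewrite Hx; split.
    + intros [x HRx] H0; apply (proj1 (HH e 0 H0) eq_refl x HRx).
    + intros H0; destruct (fun_value _ (tup N e) (half_fun 1 W HW)) as [m Hm].
      destruct (zero_or_succ m) as [->|[y ->]]; [tauto|].
      exists y; apply (proj2 (HH e _ Hm) y eq_refl).
Qed.

(** The induction on the formula takes place outside the model. Disjunction, implication and the
    universal quantifier reduce classically to negation, conjunction and the existential
    quantifier. *)
Lemma skolemizable_form p : arithmetical p -> skolemizable (fun e E => sat e E p).
Proof.
  induction p; simpl; intros Hp; try tauto.
  - apply skolemizable_Delta00, Def_eq; [exact _| |]; apply (Term_eval _ (fun e => e)); intros; term.
  - apply skolemizable_Delta00, Def_lt; [exact _| |]; apply (Term_eval _ (fun e => e)); intros; term.
  - apply skolemizable_Delta00, Def_mem; [exact _| |sterm]; apply (Term_eval _ (fun e => e)); intros; term.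
  - apply skolemizable_not; auto.
  - apply skolemizable_and; tauto.
  - eapply skolemizable_ext; [|apply skolemizable_not, skolemizable_and; apply skolemizable_not;
      [apply IHp1|apply IHp2]; tauto].
    intros e E; simpl; tauto.
  - eapply skolemizable_ext; [|apply skolemizable_not, skolemizable_and; [apply IHp1; tauto|];
      apply skolemizable_not, IHp2; tauto].
    intros e E; simpl; tauto.
  - eapply skolemizable_ext; [|apply skolemizable_not, (skolemizable_ex (fun e E => ~ sat e E p)),
      skolemizable_not, IHp, Hp].
    intros e E; simpl; split; [intros H [x Hx]; apply Hx, H|].
    intros H x; apply NNPP; intros Hx; apply H; eauto.
  - apply (skolemizable_ex (fun e E => sat e E p)), IHp, Hp.
Qed.

Lemma STerm_shift (f : senv -> nset M) : STerm f -> STerm (fun E => f (fun k => E (S k))).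
Proof.
  intros (k & B & H); destruct (even_or_odd k) as [[j ->]|[j ->]].
  - destruct (STerm_var (M := M) (S j)) as (k & B' & H'); exists k, B'; intros E; rewrite H, join_even; apply H'.
  - destruct (STerm_const (B j)) as (k & B' & H'); exists k, B'; intros E; rewrite H, join_odd; apply H'.
Qed.

Lemma skolemizable_arith P : Def arithmetical P -> skolemizable P.
Proof.
  intros (p & a & B & Hp & HP); apply (skolemizable_ext _ _ HP).
  destruct (skolemizable_form p Hp) as (G & R & HG & HR & Hex & HQ).
  assert (HB : forall k, STerm (M := M) (fun E => join E B k)).
  { intros k; destruct (even_or_odd k) as [[j ->]|[j ->]].
    - destruct (STerm_var (M := M) j) as (k & B' & H'); exists k, B'; intros E; rewrite join_even; apply H'.
    - destruct (STerm_const (B j)) as (k & B' & H'); exists k, B'; intros E; rewrite join_odd; apply H'. }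
  assert (HB' : forall k, STerm (M := M) (fun E => scons (E O) (join (fun k => E (S k)) B) k)).
  { intros k; apply (STerm_scons (fun E => E O) (fun E => join (fun k => E (S k)) B)); [sterm|].
    intros j; apply (STerm_shift (fun E => join E B j)), HB. }
  exists (fun E => G (scons (E O) (join (fun k => E (S k)) B))),
    (fun e E => R (join e a) (scons (E O) (join (fun k => E (S k)) B))).
  split; [|split; [|split]].
  - apply (Sig_subst _ (fun e => e) (fun E => scons (E O) (join (fun k => E (S k)) B)) HG); [intros; term|exact HB'].
  - apply (Def_subst0 R (fun e => join e a) (fun E => scons (E O) (join (fun k => E (S k)) B)) HR); [|exact HB'].
    intros k; apply Term_joined; intros; term.
  - intros E; exact (Hex (join E B)).
  - intros E W HW HGW e; apply (HQ (join E B) W HW HGW).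
Qed.

(** Relative to one fixed good code the predicate is Delta00, so Delta01 comprehension suffices. *)
Lemma arithmetical_comprehension (P : num M -> Prop) :
  Def arithmetical (fun e _ => P (e O)) -> exists X, forall n, n \in X <-> P n.
Proof.
  intros HP; destruct (skolemizable_arith _ HP) as (G & R & HG & HR & Hex & HQ).
  destruct (nset_inhabited M) as [X0].
  destruct (Hex (fun _ => X0)) as (W & HW & HGW).
  destruct (delta1_comprehension (fun n => R (fun _ => n) (scons W (fun _ => X0)))) as [X HX].
  - apply Sig_Def; apply (Def_subst_Delta00 _ R (fun e _ => e O) (fun _ _ => scons W (fun _ => X0)) HR);
      [intros; term|apply SDef_const; exact _].
  - apply Sig_Def, Def_not; [exact _|].
    apply (Def_subst_Delta00 _ R (fun e _ => e O) (fun _ _ => scons W (fun _ => X0)) HR);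
      [intros; term|apply SDef_const; exact _].
  - exists X; intros n; rewrite HX; symmetry; apply (HQ (fun _ => X0) W HW HGW (fun _ => n)).
Qed.

End WithComprehension.
End Skolem.

Lemma ACA0_of_LL_Delta01 (M : L2_structure) : RCA0 M -> LL_Delta01 M -> ACA0 M.
Proof.
  intros HM LL; split; [exact HM|]; intros p Hp e E.
  apply (arithmetical_comprehension (fun P HP => sigma_comprehension_of_LL P HP LL)).
  apply (sat_subst_arith p Hp (fun e' => scons (e' O) e) (fun _ _ => E) (fun e => e)).
  - intros [|k]; simpl; term.
  - intros; term.
  - apply SDef_const; exact _.
Qed.

(** * Normal form for Sigma11 predicates, and Koenig's lemma *)

Fixpoint tsub (t u : term) : term :=
  match u with
  | TVar O => t
  | TVar (S k) => TVar k
  | TZero => TZero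
  | TOne => TOne
  | TAdd r s => TAdd (tsub t r) (tsub t s)
  | TMul r s => TMul (tsub t r) (tsub t s)
  end.

Lemma eval_tsub {M : L2_structure} (e : nat -> num M) t u :
  eval e (tsub t u) = eval (scons (eval e t) e) u.
Proof. induction u as [[|k]| | | |]; simpl; congruence. Qed.

Section NormalForm.
Context {M : L2_structure} {HM : RCA0 M}.
Local Open Scope L2_scope.
Local Notation env := (nat -> num M).
Local Notation senv := (nat -> nset M).
Local Notation "x <= y" := (lt x (add y one)) : L2_scope.
Implicit Types (x y z a b c d i l m n q s t u v w : num M) (e : nat -> num M).

Add Ring num_ring5 : (num_semiring (M := M)).

Lemma eval_mono (t : term) : forall e e', (forall k, e k <= e' k) -> eval e t <= eval e' t.
Proof.
  induction t; intros e e' H; simpl; auto using le_refl, add_le_mono, mul_le_mono.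
Qed.

(** The use principle. At a bounded quantifier the bound is substituted for the variable in the term
    that limits the use, which is sound since terms are monotone. *)
Lemma Delta00_use p : Delta00 p -> exists u : term, forall e (E E' : senv),
  (forall k n, n < eval e u -> n \in E k <-> n \in E' k) -> sat e E p <-> sat e E' p.
Proof.
  induction 1 as [s t|s t|t k|p _ [u Hu]|p q _ [u Hu] _ [w Hw]|p q _ [u Hu] _ [w Hw]
    |p q _ [u Hu] _ [w Hw]|t p _ [u Hu]|t p _ [u Hu]].
  - exists TZero; reflexivity.
  - exists TZero; reflexivity.
  - exists (TAdd t TOne); intros e E E' H; simpl; apply H, le_refl.
  - exists u; intros e E E' H; simpl; rewrite (Hu e E E' H); reflexivity.
  - exists (TAdd u w); intros e E E' H; simpl in *.
    rewrite (Hu e E E'), (Hw e E E'); [reflexivity| |]; intros k n Hn; apply H;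
      (eapply lt_le_trans; [exact Hn|]); first [apply le_addr|apply le_addl].
  - exists (TAdd u w); intros e E E' H; simpl in *.
    rewrite (Hu e E E'), (Hw e E E'); [reflexivity| |]; intros k n Hn; apply H;
      (eapply lt_le_trans; [exact Hn|]); first [apply le_addr|apply le_addl].
  - exists (TAdd u w); intros e E E' H; simpl in *.
    rewrite (Hu e E E'), (Hw e E E'); [reflexivity| |]; intros k n Hn; apply H;
      (eapply lt_le_trans; [exact Hn|]); first [apply le_addr|apply le_addl].
  - exists (tsub t u); intros e E E' H; simpl.
    assert (HH : forall x, x < eval e t -> sat (scons x e) E p <-> sat (scons x e) E' p).
    { intros x Hx; apply Hu; intros k n Hn; apply H; rewrite eval_tsub.
      eapply lt_le_trans; [exact Hn|]; apply eval_mono; intros [|j]; simpl; [apply lt_le, Hx|apply le_refl]. }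
    split; intros Hs x Hx; rewrite eval_lift in Hx; apply (HH x Hx), Hs; rewrite eval_lift; exact Hx.
  - exists (tsub t u); intros e E E' H; simpl.
    assert (HH : forall x, x < eval e t -> sat (scons x e) E p <-> sat (scons x e) E' p).
    { intros x Hx; apply Hu; intros k n Hn; apply H; rewrite eval_tsub.
      eapply lt_le_trans; [exact Hn|]; apply eval_mono; intros [|j]; simpl; [apply lt_le, Hx|apply le_refl]. }
    split; intros (x & Hx & Hs); exists x; (split; [exact Hx|]); rewrite eval_lift in Hx; apply (HH x Hx), Hs.
Qed.

Lemma Def_use (P : env -> senv -> Prop) : Def Delta00 P -> exists u : env -> num M, Term u /\ forall e (E E' : senv),
  (forall k n, n < u e -> n \in E k <-> n \in E' k) -> P e E <-> P e E'.
Proof.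
  intros (p & a & B & Hp & HP); destruct (Delta00_use p Hp) as [u Hu].
  exists (fun e => eval (join e a) u); split; [exists u, a; reflexivity|].
  intros e E E' H; rewrite !HP; apply Hu; intros k n Hn.
  destruct (even_or_odd k) as [[j ->]|[j ->]]; rewrite ?join_even, ?join_odd; [auto|reflexivity].
Qed.

Section Arithmetical.
Hypothesis SCA : sigma_comprehension (M := M).

Lemma mem_the_set P n : Def arithmetical (fun e _ => P (e O)) -> n \in the_set P <-> P n.
Proof.
  intros H; unfold the_set; revert n.
  apply (epsilon_spec (nset_inhabited M) (fun X => forall n, n \in X <-> P n)).
  apply (arithmetical_comprehension SCA), H.
Qed.

Lemma arithmetical_collection (P : num M -> num M -> Prop) :
  Def arithmetical (fun e _ => P (e O) (e 1%nat)) ->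
  forall n, (forall i, i < n -> exists x, P i x) -> exists b, forall i, i < n -> exists x, x < b /\ P i x.
Proof.
  intros HP n Hn.
  set (X := the_set (fun p => exists i, i <= p /\ exists x, x <= p /\ (p = pair i x /\ P i x))).
  assert (HX : forall i x, pair i x \in X <-> P i x).
  { intros i x; unfold X; rewrite mem_the_set.
    - split; [|intros H; exists i; split; [apply pair_fst_le|]; exists x; split; [apply pair_snd_le|auto]].
      intros (i' & _ & x' & _ & E & H); apply pair_inj in E; destruct E as [-> ->]; exact H.
    - def; apply (Def_subst_arith _ (fun e k => match k with O => e 1%nat | _ => e O end) (fun _ E => E) HP).
      + intros [|k]; term.
      + apply SDef_id; exact _. }
  destruct (collection0 (fun i x => pair i x \in X)) with (n := n) as [b Hb].
  - def.
  - intros i Hi; destruct (Hn i Hi) as [x Hx]; exists x; apply HX, Hx.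
  - exists b; intros i Hi; destruct (Hb i Hi) as (x & Hx & Hix); exists x; split; [exact Hx|apply HX, Hix].
Qed.

(** Padding with zeros lets Delta00 conditions on functions be tested on finite sequences; below the
    use the padding does no harm. *)
Definition zero_ext s : nset M :=
  the_set (fun p => exists n, n <= p /\ exists m, m <= p /\ (p = pair n m /\
    (seq_entry s n m \/ ((forall y, y <= s -> ~ seq_entry s n y) /\ m = 0)))).

Lemma mem_zero_ext s p : p \in zero_ext s <-> exists n, n <= p /\ exists m, m <= p /\ (p = pair n m /\
    (seq_entry s n m \/ ((forall y, y <= s -> ~ seq_entry s n y) /\ m = 0))).
Proof. unfold zero_ext; rewrite mem_the_set0 by def; reflexivity. Qed.

Lemma Def_zero_ext C {HC : form_class C} f g : Term f -> Term g -> Def C (fun e (_ : senv) => f e \in zero_ext (g e)).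
Proof. intros; eapply Def_ext; [intros e E; apply mem_zero_ext|]; def. Qed.

Lemma zero_ext_restriction s l : is_seq s -> seq_len s l -> is_restriction (zero_ext s) l s.
Proof.
  intros Hs Hl; split; [exact Hs|]; split; [exact Hl|]; intros i x Hi; rewrite mem_zero_ext; split.
  - intros Hx; exists i; split; [apply pair_fst_le|]; exists x; split; [apply pair_snd_le|auto].
  - intros (i' & _ & x' & _ & E & H); apply pair_inj in E; destruct E as [<- <-].
    destruct H as [H|[H _]]; [exact H|].
    destruct (seq_entry_exists s l i Hl Hi) as [y Hy]; exfalso.
    apply (H y); [apply (seq_entry_le _ _ _ Hy)|exact Hy].
Qed.

(** A pair below [l] has its argument below [l], where the sequence records the value of [F]. *)
Lemma zero_ext_agree (F : nset M) s l : (forall p, p \in F -> exists n m, p = pair n m) ->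
  is_restriction F l s -> forall n, n < l -> n \in zero_ext s <-> n \in F.
Proof.
  intros HF Hs n Hn.
  assert (Hz := zero_ext_restriction s l (proj1 Hs) (proj1 (proj2 Hs))).
  split; intros H.
  - assert (H' := H); rewrite mem_zero_ext in H'; destruct H' as (a & Ha & b & _ & -> & _).
    assert (Hal : a < l) by (eapply le_lt_trans; [apply pair_fst_le|exact Hn]).
    apply Hs; [exact Hal|]; apply Hz; assumption.
  - destruct (HF n H) as (a & b & ->).
    assert (Hal : a < l) by (eapply le_lt_trans; [apply pair_fst_le|exact Hn]).
    apply Hz; [exact Hal|]; apply Hs; assumption.
Qed.

Lemma zero_ext_pairs s p : p \in zero_ext s -> exists n m, p = pair n m.
Proof. rewrite mem_zero_ext; intros (n & _ & m & _ & -> & _); exists n, m; reflexivity. Qed.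

(** The even part of a function is read as a characteristic function in which every nonzero value
    means membership; so each path decodes to a set without further conditions. *)
Definition decode (F : nset M) : nset M := the_set (fun n => ~ pair (n + n) 0 \in F).

Lemma mem_decode F n : n \in decode F <-> ~ pair (n + n) 0 \in F.
Proof. unfold decode; rewrite mem_the_set0 by def; reflexivity. Qed.

Definition is_path (T : nset M) i (F : nset M) : Prop :=
  forall n s, is_restriction F n s -> pair i s \in T.

Definition is_tree_family (T : nset M) : Prop :=
  (forall i s, pair i s \in T -> is_seq s) /\
  (forall i s t, pair i t \in T -> seq_initial s t -> pair i s \in T).

(** Kleene's normal form. A path codes a witness [X] on even arguments and Skolem functions for the
    arithmetical matrix on odd ones, which leaves a Pi01 condition on the path. *)
Lemma Sigma11_normal_form (P : num M -> nset M -> Prop) :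
  Def arithmetical (fun e E => P (e O) (E O)) ->
  exists T, is_tree_family T /\
    (forall i X, P i X -> exists F, is_fun F /\ is_path T i F) /\
    (forall i F, is_fun F -> is_path T i F -> P i (decode F)).
Proof.
  intros HP; destruct (skolemizable_arith SCA _ HP) as (G & R & (Q & HQ & HG) & HR & Hex & HPR).
  destruct (nset_inhabited M) as [X0].
  set (ex := fun F : nset M => scons (half 1 F) (scons (decode F) (fun _ => X0))).
  set (K := fun z i F => ~ Q (scons z (fun _ => 0)) (ex F) /\ R (fun _ => i) (ex F)).
  assert (HKspec : forall i F, (forall z, K z i F) <-> G (ex F) /\ R (fun _ => i) (ex F)).
  { intros i F; specialize (HG (fun _ => 0) (ex F)); unfold K; split.
    - intros H; split; [|apply (H 0)]; apply NNPP; intros HnG; apply HG in HnG.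
      destruct HnG as [z Hz]; exact (proj1 (H z) Hz).
    - intros [H1 H2] z; split; [|exact H2]; intros Hz; apply HG; [exists z; exact Hz|exact H1]. }
  assert (HK : Def Delta00 (fun e E => K (e O) (e 1%nat) (E O))).
  { assert (HS : SDef Delta00 (fun (_ : env) (E : senv) => ex (E O))).
    { apply (SDef_scons Delta00 (fun _ E => half 1 (E O))).
      - intros f r Hf _; apply (Def_half Delta00 1 f (fun E => E O)); [exact Hf|sterm].
      - apply (SDef_scons Delta00 (fun _ E => decode (E O)) (fun _ E _ => X0)).
        + intros f r Hf _; eapply Def_ext; [intros e E; apply mem_decode|]; def.
        + apply SDef_const; exact _. }
    unfold K; apply (Def_and _ (fun e E => ~ Q (scons (e O) (fun _ => 0)) (ex (E O)))
      (fun e E => R (fun _ => e 1%nat) (ex (E O)))); [apply Def_not; [exact _|]|].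
    - apply (Def_subst_Delta00 _ Q (fun e => scons (e O) (fun _ => 0)) (fun _ E => ex (E O)) HQ); [|exact HS].
      intros [|k]; simpl; term.
    - apply (Def_subst_Delta00 _ R (fun e _ => e 1%nat) (fun _ E => ex (E O)) HR); [intros; term|exact HS]. }
  destruct (Def_use _ HK) as (u & Hu & Huse).
  (* The part of a function that the test with number [z] consults. *)
  set (U := fun z i => u (scons z (fun _ => i))).
  assert (HuseK : forall z i F F', (forall n, n < U z i -> n \in F <-> n \in F') -> K z i F <-> K z i F').
  { intros z i F F' H; apply (Huse (scons z (fun _ => i)) (fun _ => F) (fun _ => F')); auto. }
  (* A sequence stays in the tree until it fails a test that it is long enough to answer. *)
  set (T := the_set (fun p => exists i s, p = pair i s /\ is_seq s /\
    forall z l, seq_len s l -> U z i <= l -> K z i (zero_ext s))).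
  assert (HT : forall i s, pair i s \in T <-> is_seq s /\
     forall z l, seq_len s l -> U z i <= l -> K z i (zero_ext s)).
  { intros i s; unfold T; rewrite mem_the_set.
    - split; [|intros H; exists i, s; auto].
      intros (i' & s' & E & H); apply pair_inj in E; destruct E as [-> ->]; exact H.
    - unfold U; def.
      + apply (Term_subst u (fun e => scons (e 1%nat) (fun _ => e 3%nat)) Hu); intros [|k]; simpl; term.
      + apply (Def_subst_Delta00 _ _ (fun e k => match k with O => e 1%nat | _ => e 3%nat end)
          (fun e _ _ => zero_ext (e 2%nat)) HK).
        * intros [|k]; term.
        * intros k f r Hf Hr; apply Def_zero_ext; [exact _|exact Hf|apply Hr]. }
  exists T; split; [split|split].
  - intros i s Hs%HT; apply Hs.
  - intros i s t [Ht Hz]%HT Hst; apply HT; split; [apply Hst|]; intros z l Hl HU.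
    destruct (proj1 Ht) as [k Hk]; assert (Hlk := seq_initial_len _ _ _ _ Hst Hl Hk).
    apply (HuseK z i (zero_ext s) (zero_ext t)).
    + intros n Hn; apply (zero_ext_agree (zero_ext t) s l).
      * apply zero_ext_pairs.
      * eapply initial_restriction; [exact Hst|exact Hl|apply (zero_ext_restriction t k Ht Hk)].
      * eapply lt_le_trans; eassumption.
    + apply (Hz z k Hk); eapply le_trans; eassumption.
  - intros i X HX; destruct (Hex (scons X (fun _ => X0))) as (W & HW & HGW).
    assert (HRW : R (fun _ => i) (scons W (scons X (fun _ => X0)))) by (apply (HPR _ W HW HGW (fun _ => i)), HX).
    destruct (function_of_graph (fun n m => (m = 0 /\ ~ n \in X) \/ (m = 1 /\ n \in X))) as (V & HV & HVm).
    { sig. }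
    { intros n; destruct (classic (n \in X)); [exists 1|exists 0]; auto. }
    { intros n x y [[-> H]|[-> H]] [[-> H']|[-> H']]; tauto. }
    destruct (merge_functions V W HV HW) as (F & HF & E0 & E1); exists F; split; [exact HF|].
    assert (HexF : ex F = scons W (scons X (fun _ => X0))).
    { unfold ex; rewrite E1; do 2 f_equal; apply mem_ext; intros n; rewrite mem_decode.
      rewrite <- (add_0r (n + n)), <- (pair_half 0 F), E0, HVm; split.
      - intros H; apply NNPP; intros Hn; apply H; auto.
      - intros Hn [[_ H]|[H _]]; [tauto|].
        rewrite <- (add_0l 1) in H; symmetry in H; exact (succ_neq0 _ H). }
    intros k s Hs; apply HT; split; [apply Hs|]; intros z l Hl HU.
    rewrite (seq_len_inj _ _ _ Hl (proj1 (proj2 Hs))) in *.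
    apply (HuseK z i (zero_ext s) F).
    + intros n Hn; apply (zero_ext_agree F s k); [apply HF|exact Hs|eapply lt_le_trans; eassumption].
    + revert z HU; enough (forall z, K z i F) by auto; apply HKspec; rewrite HexF; split; assumption.
  - intros i F HF Hpath.
    assert (HKF : forall z, K z i F).
    { intros z; destruct (restriction_exists F (U z i) HF) as [s Hs].
      assert (H := Hpath _ s Hs); apply HT in H; destruct H as [_ H].
      apply (HuseK z i (zero_ext s) F).
      - intros n Hn; apply (zero_ext_agree F s (U z i)); [apply HF|exact Hs|exact Hn].
      - apply (H z (U z i)); [apply Hs|apply le_refl]. }
    apply HKspec in HKF; destruct HKF as [HGF HRF].
    apply (HPR (scons (decode F) (fun _ => X0)) (half 1 F) (half_fun 1 F HF) HGF (fun _ => i)), HRF.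
Qed.

(* Vacuously true if [s] is shorter than [l]: nothing is refuted before stage [l]. *)
Definition below (T : nset M) i l s : Prop :=
  forall k, seq_len s (k + l) -> exists t, pair i t \in T /\ seq_len t k /\
    forall j x y, seq_entry t j x -> seq_entry s (j + l) y -> x <= y.

(** An arithmetical substitute for a path bounded by the values of [F] from position [l] on;
    Koenig's lemma recovers a path from it. *)
Definition alive (T : nset M) i l (F : nset M) : Prop :=
  forall n s, is_restriction F n s -> below T i l s.

(** Death is permanent: the node that serves the longer sequence can be cut down to serve the
    shorter one. *)
Lemma below_initial T i l s t : is_tree_family T -> below T i l t -> seq_initial s t -> below T i l s.
Proof.
  intros [HT1 HT2] Ht Hst k Hk; destruct (proj1 (proj1 (proj2 Hst))) as [n Hn].
  assert (Hle := seq_initial_len _ _ _ _ Hst Hk Hn).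
  apply le_iff in Hle; destruct Hle as [d ->].
  destruct (Ht (k + d)) as (r & Hr & Lr & Hb).
  { replace (k + d + l) with (k + l + d) by ring; exact Hn. }
  destruct (prefix_exists r (k + d) k) as (r' & Hr' & Lr'); [apply (HT1 i), Hr|exact Lr|apply le_addr|].
  exists r'; split; [eapply HT2; eassumption|]; split; [exact Lr'|].
  intros j x y Hx Hy; apply (Hb j x y); eapply seq_initial_sub; eassumption.
Qed.

Lemma path_alive T i F : is_path T i F -> alive T i 0 F.
Proof.
  intros HF n s Hs k Hk; rewrite add_0r in Hk.
  exists s; split; [apply (HF n), Hs|]; split; [exact Hk|].
  intros j x y Hx Hy; rewrite add_0r in Hy; rewrite (seq_entry_inj _ _ _ _ Hx Hy); apply le_refl.
Qed.

Lemma alive_dominated T i l F G : is_fun G -> alive T i 0 G ->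
  (forall j x y, pair j x \in G -> pair (j + l) y \in F -> x <= y) -> alive T i l F.
Proof.
  intros HG Ha H n s Hs k Hk.
  assert (Hn := seq_len_inj _ _ _ Hk (proj1 (proj2 Hs))); subst n.
  destruct (restriction_exists G k HG) as [r Hr].
  destruct (Ha k r Hr k) as (t & Ht & Lt & Hb); [rewrite add_0r; apply Hr|].
  exists t; split; [exact Ht|]; split; [exact Lt|]; intros j x y Hx Hy.
  assert (Hj := seq_entry_len _ _ _ _ Lt Hx).
  destruct (seq_entry_exists r k j (proj1 (proj2 Hr)) Hj) as [z Hz].
  apply (le_trans x z y).
  - apply (Hb j); [exact Hx|rewrite add_0r; exact Hz].
  - apply (H j); eapply restriction_mem; eassumption.
Qed.

(** The nodes with dominated extensions of every length form an arithmetical subtree without leaves,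
    in which [uniform_path] finds paths for all [i] simultaneously. *)
Lemma uniform_koenig T l F : is_tree_family T -> is_fun F ->
  (forall i H, fun_section F i H -> alive T i l H) ->
  exists G, is_fun G /\ forall i H, fun_section G i H -> is_path T i H.
Proof.
  intros [HT1 HT2] HF Halive.
  set (dom := fun i t => forall j x y, seq_entry t j x -> pair (pair (j + l) i) y \in F -> x <= y).
  assert (Hdom : forall i s t, dom i t -> seq_initial s t -> dom i s).
  { intros i s t Ht Hst j x y Hx; apply Ht; eapply seq_initial_sub; eassumption. }
  set (ext := fun i t k => exists r, pair i r \in T /\ seq_len r k /\ seq_initial t r /\ dom i r).
  assert (Hlong : forall i k, exists r, pair i r \in T /\ seq_len r k /\ dom i r).
  { intros i k; destruct (fun_section_exists F i) as [H HH].
    destruct (restriction_exists H (k + l) (fun_section_fun F i H HF HH)) as [s Hs].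
    destruct (Halive i H HH _ s Hs k) as (r & Hr & Lr & Hb); [apply Hs|].
    exists r; split; [exact Hr|]; split; [exact Lr|]; intros j x y Hx Hy.
    apply (Hb j x y Hx), (restriction_entry H _ s _ _ Hs); split.
    - apply add_lt_mono; eapply seq_entry_len; eassumption.
    - apply (fun_section_mem F i H); assumption. }
  set (P := the_set (fun p => exists i t, p = pair i t /\ pair i t \in T /\
    forall m k, seq_len t m -> m <= k -> ext i t k)).
  assert (HP : forall i t, pair i t \in P <-> pair i t \in T /\ forall m k, seq_len t m -> m <= k -> ext i t k).
  { intros i t; unfold P; rewrite mem_the_set by (unfold ext, dom; def); split.
    - intros (i' & t' & E & H); apply pair_inj in E; destruct E as [-> ->]; exact H.
    - intros H; exists i, t; auto. }
  destruct (uniform_path P) as (G & HG & HGP).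
  - intros i; destruct (empty_seq_exists (M := M)) as [s Hs]; exists s; split; [exact Hs|].
    assert (Hinit : forall r k, is_seq r -> seq_len r k -> seq_initial s r).
    { intros r k Hr Lr; apply (seq_initial_intro s r 0 k); auto; try apply Hs; [apply le_0l|].
      intros j x []%nlt_0. }
    apply HP; split.
    + destruct (Hlong i 0) as (r & Hr & Lr & _); apply (HT2 i s r Hr), (Hinit r 0); [apply (HT1 i), Hr|exact Lr].
    + intros m k _ _; destruct (Hlong i k) as (r & Hr & Lr & Hd); exists r; repeat split; auto;
        apply (Hinit r k); auto; apply (HT1 i), Hr.
  - intros i t [Ht Hext]%HP; apply NNPP; intros Hno.
    destruct (proj1 (HT1 i t Ht)) as [k Lt].
    destruct (fun_value F (pair (k + l) i) HF) as [b Hb].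
    (* If each candidate child m <= b had lost its extensions at some length, one bound [B] would
       serve for all of them; but a dominated extension of [t] of length k + 1 + B passes through
       such a child. *)
    destruct (arithmetical_collection (fun m n => k + 1 <= n /\ forall c, is_snoc t m c -> ~ ext i c n))
      with (n := b + 1) as [B HB].
    + unfold ext, dom; def.
    + intros m _; destruct (snoc_exists t m (HT1 i t Ht)) as [c Hc].
      assert (Lc := snoc_len _ _ _ _ Hc Lt).
      assert (Huniq : forall c', is_snoc t m c' -> c' = c).
      { intros c' Hc'; apply (is_seq_ext c' c (k + 1)); [apply Hc'|apply Hc|eapply snoc_len; eassumption|exact Lc|].
        intros j x _ Hx; apply (snoc_entry t m c k j x Hc Lt), (snoc_entry t m c' k j x Hc' Lt), Hx. }
      apply NNPP; intros Hn; apply Hno; exists m, c; split; [exact Hc|]; apply HP.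
      assert (Hextc : forall n, k + 1 <= n -> ext i c n).
      { intros n Hkn; apply NNPP; intros He; apply Hn; exists n; split; [exact Hkn|].
        intros c' Hc'; rewrite (Huniq c' Hc'); exact He. }
      split.
      * destruct (Hextc (k + 1) (le_refl _)) as (r & Hr & _ & Hcr & _); eapply HT2; eassumption.
      * intros m' n Lm Hmn; rewrite (seq_len_inj _ _ _ Lm Lc) in Hmn; apply Hextc, Hmn.
    + destruct (Hext k (k + 1 + B) Lt) as (r & Hr & Lr & Htr & Hd).
      { apply le_iff; exists (1 + B); ring. }
      destruct (prefix_exists r (k + 1 + B) (k + 1)) as (c & Hc & Lc); [apply (HT1 i), Hr|exact Lr|apply le_addr|].
      assert (Htc : seq_initial t c) by (apply (seq_initial_linear t c r k (k + 1)); auto; apply lt_le, le_refl).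
      destruct (initial_snoc t c k Htc Lt Lc) as [m Hm].
      assert (Hmb : m <= b).
      { apply (Hd k m b); [|exact Hb]; eapply seq_initial_sub; [exact Hc|]; eapply snoc_last; eassumption. }
      destruct (HB m Hmb) as (n & HnB & Hkn & Hn); apply (Hn c Hm).
      destruct (prefix_exists r (k + 1 + B) n) as (r' & Hr' & Lr'); [apply (HT1 i), Hr|exact Lr| |].
      { apply lt_le; eapply lt_le_trans; [exact HnB|apply le_addl]. }
      exists r'; split; [eapply HT2; eassumption|]; split; [exact Lr'|]; split; [|eapply Hdom; eassumption].
      apply (seq_initial_linear c r' r (k + 1) n); auto.
  - exists G; split; [exact HG|]; intros i H HH n s Hs; apply HP, (HGP i H HH n s Hs).
Qed.

Lemma koenig T i l F : is_tree_family T -> is_fun F -> alive T i l F ->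
  exists G, is_fun G /\ is_path T i G.
Proof.
  intros HT HF Ha.
  set (T' := the_set (fun p => exists j s, p = pair j s /\ pair i s \in T)).
  assert (HT' : forall j s, pair j s \in T' <-> pair i s \in T).
  { intros j s; unfold T'; rewrite mem_the_set by def; split.
    - intros (j' & s' & E & H); apply pair_inj in E; destruct E as [_ ->]; exact H.
    - intros H; exists j, s; auto. }
  destruct (binary_function_of_graph (fun n _ m => pair n m \in F)) as (F' & HF' & HFm).
  - sig.
  - intros n _; apply fun_value, HF.
  - intros n _ x y; apply fun_unique, HF.
  - destruct (uniform_koenig T' l F') as (G & HG & HGp).
    + split; [intros j s Hs%HT'; eapply (proj1 HT); exact Hs|].
      intros j s t Ht%HT' Hst; apply HT'; eapply (proj2 HT); eassumption.
    + exact HF'.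
    + intros j H HH.
      assert (E : H = F).
      { apply fun_ext; [apply (fun_section_fun F' j H HF' HH)|exact HF|].
        intros n m; rewrite (fun_section_mem F' j H n m HH), HFm; reflexivity. }
      subst H; intros n s Hs k Hk; destruct (Ha n s Hs k Hk) as (t & Ht & Htt); exists t.
      split; [apply HT', Ht|exact Htt].
    + destruct (fun_section_exists G 0) as [H HH]; exists H; split; [eapply fun_section_fun; eassumption|].
      intros n s Hs; apply (HT' 0), (HGp 0 H HH n s Hs).
Qed.

Lemma Sigma11_induction (P : num M -> nset M -> Prop) : Sigma11_IND M ->
  Def arithmetical (fun e E => P (e O) (E O)) ->
  (exists X, P 0 X) -> (forall n, (exists X, P n X) -> exists X, P (n + 1) X) -> forall n, exists X, P n X.
Proof.
  intros IND (p & a & B & Hp & HP) H0 HS n; destruct (nset_inhabited M) as [X0].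
  set (q := FExS (ren ren_open ren_open p)).
  assert (Hq : forall n, sat (scons n (join (fun _ => 0) a)) (join (fun _ => X0) B) q <-> exists X, P n X).
  { intros m; simpl; split; intros [X HX]; exists X.
    - apply (HP (scons m (fun _ => 0)) (scons X (fun _ => X0))).
      rewrite sat_ren, !join_open in HX; exact HX.
    - rewrite sat_ren, !join_open; apply HP; exact HX. }
  apply Hq, (IND q); [eexists; split; [|reflexivity]; apply fc_ren, Hp| |].
  - apply Hq, H0.
  - intros m Hm; apply Hq, HS, Hq, Hm.
Qed.

Lemma Def_is_restriction X f g : STerm X -> Term f -> Term g ->
  Def arithmetical (fun e E => is_restriction (X E) (f e) (g e)).
Proof. intros; unfold is_restriction; def. Qed.

Lemma Def_is_fun X : STerm X -> Def arithmetical (fun (e : env) E => is_fun (X E)).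
Proof. intros; unfold is_fun, unique; def. Qed.

Lemma Def_below T f g h : Term f -> Term g -> Term h ->
  Def arithmetical (fun e (_ : senv) => below T (f e) (g e) (h e)).
Proof. intros; unfold below; def. Qed.

Lemma Def_alive T X f g : STerm X -> Term f -> Term g ->
  Def arithmetical (fun e E => alive T (f e) (g e) (X E)).
Proof. intros; unfold alive; def; [apply Def_is_restriction|apply Def_below]; def. Qed.

(* The only use of Sigma11 induction. *)
Lemma bounded_domination (P : num M -> nset M -> Prop) : Sigma11_IND M ->
  Def arithmetical (fun e E => P (e O) (E O)) ->
  (forall i F G, is_fun F -> is_fun G -> P i F ->
     (forall j x y, pair j x \in F -> pair j y \in G -> x <= y) -> P i G) ->
  (forall i, exists F, is_fun F /\ P i F) ->
  forall n, exists F, is_fun F /\ forall i, i < n -> P i F.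
Proof.
  intros IND HP Hmono Hex; apply (Sigma11_induction (fun n F => is_fun F /\ forall i, i < n -> P i F) IND).
  - def; apply Def_is_fun; sterm.
  - exists zero_fun; split; [apply zero_fun_fun|intros i []%nlt_0].
  - intros n (F & HF & HFP); destruct (Hex n) as (G & HG & HGP).
    (* The pointwise maximum: it is one of the two values and bounds both. *)
    destruct (function_of_graph (fun k m => exists x, x <= m /\ exists y, y <= m /\ (pair k x \in F /\ pair k y \in G /\
      (m = x \/ m = y)))) as (H & HH & HHm).
    + sig.
    + intros k; destruct (fun_value F k HF) as [x Hx], (fun_value G k HG) as [y Hy].
      destruct (le_lt_dec x y) as [Hxy|Hxy]; [exists y, x|exists x, x]; (split; [auto using le_refl|]);
        exists y; auto using le_refl, lt_le.
    + intros k m m' (x & Hxm & y & Hym & Hx & Hy & E) (x' & Hxm' & y' & Hym' & Hx' & Hy' & E').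
      rewrite (fun_unique F k x' x HF Hx' Hx), (fun_unique G k y' y HG Hy' Hy) in *.
      destruct E as [->| ->], E' as [->| ->]; auto using le_antisym.
    + exists H; split; [exact HH|]; intros i [Hi| ->]%lt_succ.
      * apply (Hmono i F H HF HH (HFP i Hi)); intros j x z Hx (x' & Hxz & y' & _ & Hx' & _)%HHm.
        rewrite (fun_unique F j x x' HF Hx Hx'); exact Hxz.
      * apply (Hmono n G H HG HH HGP); intros j y z Hy (x' & _ & y' & Hyz & _ & Hy' & _)%HHm.
        rewrite (fun_unique G j y y' HG Hy Hy'); exact Hyz.
Qed.

Lemma alive_mono T i F G : is_fun F -> alive T i 0 F ->
  (forall j x y, pair j x \in F -> pair j y \in G -> x <= y) -> alive T i 0 G.
Proof.
  intros HF Ha H; apply (alive_dominated T i 0 G F HF Ha); intros j x y; rewrite add_0r; apply H.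
Qed.

End Arithmetical.
End NormalForm.

(** * Comprehension and choice *)

Section Main.
Context {M : L2_structure} {HM : RCA0 M}.
Local Open Scope L2_scope.
Local Notation env := (nat -> num M).
Local Notation senv := (nat -> nset M).
Local Notation "x <= y" := (lt x (add y one)) : L2_scope.
Implicit Types (x y z a b c d i l m n q s t u v w : num M).

Add Ring num_ring6 : (num_semiring (M := M)).

Hypothesis SCA : sigma_comprehension (M := M).

Lemma laver_root_child (T : nset M) k : is_laver_tree T ->
  exists n s, k < n /\ s \in T /\ seq_len s 1 /\ seq_entry s 0 n.
Proof.
  intros (_ & (s0 & Hs0 & Hs0T) & Hch); destruct (Hch s0 Hs0T k) as (n & s & Hn & Hs & HsT).
  exists n, s; split; [exact Hn|]; split; [exact HsT|]; split.
  - rewrite <- (add_0l 1); eapply snoc_len; [exact Hs|apply Hs0].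
  - eapply snoc_last; [exact Hs|apply Hs0].
Qed.

Section Separation.
Hypothesis IND : Sigma11_IND M.
Hypothesis LL : LL_Delta01 M.
Variables (P : num M -> Prop) (T0 T1 : nset M).
Hypothesis T0_tree : is_tree_family T0.
Hypothesis T1_tree : is_tree_family T1.
Hypothesis T0_path : forall i, P i <-> exists F, is_fun F /\ is_path T0 i F.
Hypothesis T1_path : forall i, ~ P i <-> exists F, is_fun F /\ is_path T1 i F.

Lemma alive_T0 i l F : is_fun F -> alive T0 i l F -> P i.
Proof. intros HF Ha; apply T0_path, (koenig SCA T0 i l F); assumption. Qed.

Lemma alive_T1 i l F : is_fun F -> alive T1 i l F -> ~ P i.
Proof. intros HF Ha; apply T1_path, (koenig SCA T1 i l F); assumption. Qed.

(* At stage [s] of the reading that starts at position [l], one of the two trees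
   has died for each i <= n. *)
Definition decided n l s : Prop := forall i, i <= n -> ~ (below T0 i l s /\ below T1 i l s).

(** Minimality makes the end of a reading unique along each function. *)
Definition stage n l s : Prop :=
  decided n l s /\ forall t, seq_initial t s -> decided n l t -> t = s.

Definition agree n l l' s s' : Prop := forall i, i <= n -> (below T0 i l s <-> below T0 i l' s').

Lemma Def_decided f g h : Term f -> Term g -> Term h ->
  Def arithmetical (fun e (_ : senv) => decided (f e) (g e) (h e)).
Proof. intros; unfold decided; def; apply Def_below; def. Qed.

Lemma Def_stage f g h : Term f -> Term g -> Term h ->
  Def arithmetical (fun e (_ : senv) => stage (f e) (g e) (h e)).
Proof. intros; unfold stage; def; apply Def_decided; def. Qed.

(** On sequences shorter than [l] both conditions [below] hold vacuously, so nothing is decided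
    there. Hence the first reading sees f(0), and the second does not end before the first. *)
Lemma decided_len n l s k : decided n l s -> seq_len s k -> l <= k.
Proof.
  intros H Hk; apply nlt_le; intros Hlt; apply (H 0 (le_0l n)).
  assert (Hno : forall j, ~ seq_len s (j + l)).
  { intros j Hj; rewrite (seq_len_inj _ _ _ Hk Hj) in Hlt; apply (nlt_le (j + l) l); [apply le_addl|exact Hlt]. }
  split; intros j Hj; exfalso; exact (Hno j Hj).
Qed.

(** If both trees of some [i] stayed alive forever, Koenig's lemma would give each of them a path.
    Collection then finds one length at which all i <= n are decided. *)
Lemma stage_exists n l F : is_fun F -> exists k s, is_restriction F k s /\ stage n l s.
Proof.
  intros HF.
  destruct (arithmetical_collection SCA (fun i k => exists s, is_restriction F k s /\
    ~ (below T0 i l s /\ below T1 i l s))) with (n := n + 1) as [B HB].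
  - def; [apply Def_is_restriction|apply Def_below|apply Def_below]; def.
  - intros i _; apply NNPP; intros Hno.
    assert (H : forall k s, is_restriction F k s -> below T0 i l s /\ below T1 i l s).
    { intros k s Hs; apply NNPP; intros Hb; apply Hno; exists k, s; auto. }
    apply (alive_T1 i l F HF); [intros k s Hs; apply (H k s Hs)|].
    apply (alive_T0 i l F HF); intros k s Hs; apply (H k s Hs).
  - set (X := the_set (fun k => exists s, is_restriction F k s /\ decided n l s)).
    assert (HX : forall k, k \in X <-> exists s, is_restriction F k s /\ decided n l s).
    { intros k; apply (mem_the_set SCA); def; [apply Def_is_restriction|apply Def_decided]; def. }
    destruct (least0 (fun k => k \in X)) with (n := B) as (k & Hk & _ & Hmin).
    + def.
    + apply HX; destruct (restriction_exists F B HF) as [s Hs]; exists s; split; [exact Hs|].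
      intros i Hi [H0 H1]; destruct (HB i Hi) as (k & Hk & t & Ht & Hno); apply Hno.
      assert (Hts : seq_initial t s) by (eapply restriction_initial; [exact Ht|exact Hs|apply lt_le, Hk]).
      split; [apply (below_initial T0 i l t s)|apply (below_initial T1 i l t s)]; assumption.
    + apply HX in Hk; destruct Hk as (s & Hs & Hd); exists k, s; split; [exact Hs|]; split; [exact Hd|].
      intros t Ht Hdt; destruct (proj1 (proj1 Ht)) as [j Hj].
      assert (Htr := initial_restriction F k t s j Ht Hj Hs).
      assert (Hjk := seq_initial_len _ _ _ _ Ht Hj (proj1 (proj2 Hs))).
      apply lt_succ in Hjk; destruct Hjk as [Hjk| ->]; [|eapply restriction_unique; eassumption].
      exfalso; apply (Hmin j Hjk), HX; exists t; auto.
Qed.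

Lemma stage_unique n l F k k' s s' : is_restriction F k s -> is_restriction F k' s' ->
  stage n l s -> stage n l s' -> s = s'.
Proof.
  intros Hs Hs' [Hd Hm] [Hd' Hm']; destruct (le_lt_dec k k') as [H|H].
  - apply Hm'; [eapply restriction_initial; eassumption|exact Hd].
  - symmetry; apply Hm; [eapply restriction_initial; [exact Hs'|exact Hs|apply lt_le, H]|exact Hd'].
Qed.

Definition dominating n (g : nset M) : Prop :=
  is_fun g /\ forall i, i <= n -> alive T0 i 0 g \/ alive T1 i 0 g.

Lemma dominating_exists n : exists g, dominating n g.
Proof.
  apply (bounded_domination (fun i g => alive T0 i 0 g \/ alive T1 i 0 g) IND).
  - def; apply Def_alive; def.
  - intros i F G HF HG [H|H] Hle; [left|right]; exact (alive_mono _ i F G HF H Hle).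
  - intros i; destruct (classic (P i)) as [Hi|Hi]; [apply T0_path in Hi|apply T1_path in Hi];
      destruct Hi as (F & HF & HFp); exists F; split; auto using path_alive.
Qed.

(* Along a dominating function, the tree that survives is the one with a path. *)
Lemma dominated_guess n l g F k s : dominating n g -> is_fun F ->
  (forall j a b, pair j a \in g -> pair (j + l) b \in F -> a <= b) ->
  is_restriction F k s -> decided n l s -> forall i, i <= n -> (below T0 i l s <-> P i).
Proof.
  intros [Hg Ha] HF Hdom Hs Hd i Hi; split.
  - intros H0; destruct (Ha i Hi) as [H|H]; [exact (alive_T0 i 0 g Hg H)|].
    exfalso; apply (Hd i Hi); split; [exact H0|]; apply (alive_dominated T1 i l F g Hg H Hdom k s Hs).
  - intros HP; destruct (Ha i Hi) as [H|H]; [apply (alive_dominated T0 i l F g Hg H Hdom k s Hs)|].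
    exfalso; exact (alive_T1 i 0 g Hg H HP).
Qed.

(** [t] ends the first reading and its length [l] is where the second starts; [s] ends the second,
    so exactly one initial segment of each function carries its colour. *)
Definition reading (R : num M -> num M -> num M -> num M -> Prop) s : Prop :=
  is_seq s /\ exists n l t, seq_entry s 0 n /\ seq_initial t s /\ seq_len t l /\
    stage n 1 t /\ stage n l s /\ R n l t s.

Lemma in_open_reading R F n k k' t s : (forall s, s \in the_set (reading R) <-> reading R s) ->
  pair 0 n \in F -> is_fun F ->
  is_restriction F k t -> stage n 1 t -> is_restriction F k' s -> stage n k s ->
  in_open F (the_set (reading R)) <-> R n k t s.
Proof.
  intros HR Hn HF Ht Hst Hs Hss; split.
  - intros (j & u & Hu & H%HR); destruct H as (_ & n' & l & t' & Hn' & Htu & Ll & Hst' & Hsu & H).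
    rewrite (fun_unique F 0 n' n HF (restriction_mem F j u 0 n' Hu Hn') Hn) in *.
    assert (E : t' = t).
    { eapply (stage_unique n 1 F); [|exact Ht|exact Hst'|exact Hst].
      eapply initial_restriction; eassumption. }
    subst t'; rewrite (seq_len_inj _ _ _ Ll (proj1 (proj2 Ht))) in *.
    rewrite <- (stage_unique n k F j k' u s Hu Hs Hsu Hss); exact H.
  - intros H; exists k', s; split; [exact Hs|]; apply HR; split; [apply Hs|].
    assert (Hk := decided_len _ _ _ _ (proj1 Hst) (proj1 (proj2 Ht))).
    assert (Hk' := decided_len _ _ _ _ (proj1 Hss) (proj1 (proj2 Hs))).
    exists n, k, t; split.
    { apply (restriction_entry F k' s 0 n Hs); split; [|exact Hn].
      eapply lt_le_trans; [apply lt_0_1|eapply le_trans; eassumption]. }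
    split; [eapply restriction_initial; eassumption|]; split; [apply Ht|auto].
Qed.

Lemma separation : exists X, forall i, i \in X <-> P i.
Proof.
  set (A := fun n l t s => agree n 1 l t s).
  assert (HA : forall s, s \in the_set (reading A) <-> reading A s).
  { intros s; apply (mem_the_set SCA); unfold reading, A, agree; def;
      first [apply Def_stage|apply Def_below]; def. }
  assert (HB : forall s, s \in the_set (reading (fun n l t s => ~ A n l t s)) <->
     reading (fun n l t s => ~ A n l t s) s).
  { intros s; apply (mem_the_set SCA); unfold reading, A, agree; def;
      first [apply Def_stage|apply Def_below]; def. }
  destruct (LL (the_set (reading A)) (the_set (reading (fun n l t s => ~ A n l t s))))
    as (T & HT & Hhom).
  { split; [intros s Hs; apply HA in Hs; apply Hs|]; split; [intros s Hs; apply HB in Hs; apply Hs|].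
    intros F HF; destruct (fun_value F 0 HF) as [n Hn].
    destruct (stage_exists n 1 F HF) as (k & t & Ht & Hst), (stage_exists n k F HF) as (k' & s & Hs & Hss).
    rewrite (in_open_reading A F n k k' t s), (in_open_reading (fun n l t s => ~ A n l t s) F n k k' t s); auto.
    split; [tauto|apply NNPP]. }
  destruct Hhom as [Hhom|Hhom].
  - assert (Hcorrect : forall t n, t \in T -> seq_entry t 0 n -> stage n 1 t ->
      forall i, i <= n -> (below T0 i 1 t <-> P i)).
    { intros t n HtT Hn Hst i Hi; assert (Ht := proj1 (proj1 HT) t HtT); destruct (proj1 Ht) as [k Lt].
      destruct (dominating_exists n) as [g Hg].
      destruct (laver_dominating_path T g t k HT HtT Lt (proj1 Hg)) as (F & HF & HFT & HFt & Hdom).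
      destruct (stage_exists n k F HF) as (k' & s & Hs & Hss).
      assert (Hag := Hhom F HF HFT).
      rewrite (in_open_reading A F n k k' t s HA) in Hag; auto; [|exact (restriction_mem F k t 0 n HFt Hn)].
      rewrite (Hag i Hi); apply (dominated_guess n k g F k' s Hg HF Hdom Hs (proj1 Hss) i Hi). }
    (* First readings along [T] are correct, so membership is arithmetical in [T]; every [i] is
       covered because the root has a successor above [i]. *)
    exists (the_set (fun i => exists t n, t \in T /\ seq_entry t 0 n /\ i <= n /\ stage n 1 t /\ below T0 i 1 t)).
    intros i; rewrite (mem_the_set SCA) by (def; first [apply Def_stage|apply Def_below]; def); split.
    + intros (t & n & HtT & Hn & Hi & Hst & Hb); apply (Hcorrect t n HtT Hn Hst i Hi), Hb.
    + intros HP; destruct (laver_root_child T i HT) as (n & s & Hn & HsT & Ls & Hsn).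
      destruct (laver_path T s 1 HT HsT Ls) as (F & HF & HFT & HFs).
      destruct (stage_exists n 1 F HF) as (k & t & Ht & Hst).
      assert (HtT := in_body_mem F T k t HFT Ht).
      assert (Htn : seq_entry t 0 n).
      { apply (restriction_entry F k t 0 n Ht); split; [|exact (restriction_mem F 1 s 0 n HFs Hsn)].
        eapply lt_le_trans; [apply lt_0_1|]; apply (decided_len n 1 t); [apply Hst|apply Ht]. }
      exists t, n; repeat split; auto using lt_le; try apply Hst.
      apply (Hcorrect t n HtT Htn Hst i (lt_le _ _ Hn)), HP.
  (* Disagreement cannot be homogeneous: a path of [T] may dominate [g] during both readings, and
     then both are correct. *)
  - exfalso.
    destruct (laver_root_child T 0 HT) as (n & s1 & _ & Hs1T & Ls1 & Hn).
    destruct (dominating_exists n) as [g Hg].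
    destruct (laver_dominating_path T g s1 1 HT Hs1T Ls1 (proj1 Hg)) as (F1 & HF1 & HFT1 & HFs1 & Hdom1).
    destruct (stage_exists n 1 F1 HF1) as (k & t & Ht & Hst).
    assert (HtT := in_body_mem F1 T k t HFT1 Ht).
    destruct (laver_dominating_path T g t k HT HtT (proj1 (proj2 Ht)) (proj1 Hg)) as (F2 & HF2 & HFT2 & HFt2 & Hdom2).
    destruct (stage_exists n k F2 HF2) as (k' & s & Hs & Hss).
    apply (Hhom F2 HF2 HFT2), (in_open_reading A F2 n k k' t s HA); auto.
    + eapply restriction_mem; [exact HFt2|].
      apply (restriction_entry F1 k t 0 n Ht); split; [|exact (restriction_mem F1 1 s1 0 n HFs1 Hn)].
      eapply lt_le_trans; [apply lt_0_1|]; apply (decided_len n 1 t); [apply Hst|apply Ht].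
    + intros i Hi; rewrite (dominated_guess n 1 g F1 k t Hg HF1 Hdom1 Ht (proj1 Hst) i Hi).
      symmetry; apply (dominated_guess n k g F2 k' s Hg HF2 Hdom2 Hs (proj1 Hss) i Hi).
Qed.

End Separation.

Lemma Def_sat_fixed p (e : env) (E : senv) : arithmetical p ->
  Def arithmetical (fun e' E' => sat (scons (e' O) e) (scons (E' O) E) p).
Proof.
  intros Hp; apply (sat_subst_arith p Hp (fun e' => scons (e' O) e) (fun _ E' => scons (E' O) E) (fun e' => e')).
  - intros [|k]; simpl; term.
  - intros; term.
  - apply SDef_STerm; [exact _|]; intros [|k]; simpl; sterm.
Qed.

Lemma Delta11_comprehension : Sigma11_IND M -> LL_Delta01 M ->
  delta_comprehension_schema Sigma11 Pi11 M.
Proof.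
  intros IND LL p p' (q & Hq & ->) (q' & Hq' & ->) e E Hiff; simpl in Hiff |- *.
  destruct (Sigma11_normal_form SCA
    (fun i X => sat (scons i e) (scons X E) q) (Def_sat_fixed q e E Hq)) as (T0 & HT0 & H1 & H2).
  (* [T1] carries the counterexamples to the Pi11 form, that is, the witnesses for the
     complement. *)
  destruct (Sigma11_normal_form SCA
    (fun i X => ~ sat (scons i e) (scons X E) q') (Def_not _ _ (Def_sat_fixed q' e E Hq'))) as (T1 & HT1 & H3 & H4).
  apply (separation IND LL _ T0 T1 HT0 HT1).
  - intros i; split.
    + intros [X HX]; apply (H1 i X HX).
    + intros (F & HF & HFp); exists (decode F); apply (H2 i F HF HFp).
  - intros i; rewrite Hiff; split.
    + intros [X HX]%not_all_ex_not; apply (H3 i X HX).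
    + intros (F & HF & HFp) H; apply (H4 i F HF HFp), H.
Qed.

(** It is enough to choose bounds uniformly, since [uniform_koenig] turns them into paths. *)
Lemma uniform_path_choice (T : nset M) : Sigma11_IND M -> LL_Sigma01 M -> is_tree_family T ->
  (forall i, exists F, is_fun F /\ is_path T i F) ->
  exists G, is_fun G /\ forall i H, fun_section G i H -> is_path T i H.
Proof.
  intros IND LL HT Hex.
  set (A := fun s => is_seq s /\ exists n i, seq_entry s 0 n /\ i < n /\ ~ below T i 1 s).
  assert (HA : forall s, s \in the_set A <-> A s).
  { intros s; apply (mem_the_set SCA); unfold A; def; apply Def_below; def. }
  destruct (LL (the_set A)) as (L & HL & Hhom).
  { intros s Hs; apply HA in Hs; apply Hs. }
  destruct Hhom as [Hhom|Hhom].
  (* With first value [n] fixed, a path of [L] that dominates a common bound for all i < n never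
     sees one of these trees die. *)
  - exfalso; destruct (laver_root_child L 0 HL) as (n & s1 & _ & Hs1 & Ls1 & Hn).
    destruct (bounded_domination (fun i g => alive T i 0 g) IND) with (n := n) as (g & Hg & Ha).
    + apply Def_alive; def.
    + intros i F G HF HG H Hle; exact (alive_mono T i F G HF H Hle).
    + intros i; destruct (Hex i) as (F & HF & HFp); exists F; auto using path_alive.
    + destruct (laver_dominating_path L g s1 1 HL Hs1 Ls1 Hg) as (F & HF & HFL & HFs1 & Hdom).
      destruct (Hhom F HF HFL) as (k & s & Hs & H%HA); destruct H as (_ & n' & i & Hn' & Hi & Hno).
      assert (E : n' = n).
      { apply (fun_unique F 0); [exact HF|eapply restriction_mem; [exact Hs|exact Hn']
          |eapply restriction_mem; [exact HFs1|exact Hn]]. }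
      subst n'; exact (Hno (alive_dominated T i 1 F g Hg (Ha i Hi) Hdom k s Hs)).
  (* Paths of [L] with first value above [i], found uniformly in [i], avoid the colour and so keep
     the tree of [i] alive from position 1 on. *)
  - set (P := the_set (fun p => exists i s, p = pair i s /\ s \in L /\ forall x, seq_entry s 0 x -> i < x)).
    assert (HP : forall i s, pair i s \in P <-> s \in L /\ forall x, seq_entry s 0 x -> i < x).
    { intros i s; unfold P; rewrite (mem_the_set SCA) by def; split.
      - intros (i' & s' & E & H); apply pair_inj in E; destruct E as [-> ->]; exact H.
      - intros H; exists i, s; auto. }
    assert (HL' := HL); destruct HL' as ([HLs _] & (s0 & Hs0 & Hs0L) & Hch).
    destruct (uniform_path P) as (F & HF & HFP).
    + intros i; exists s0; split; [exact Hs0|]; apply HP; split; [exact Hs0L|].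
      intros x Hx; apply (seq_entry_len _ _ _ _ (proj2 Hs0)), nlt_0 in Hx; tauto.
    + intros i s [HsL Hi]%HP; destruct (Hch s HsL i) as (n & t & Hn & Ht & HtL).
      exists n, t; split; [exact Ht|]; apply HP; split; [exact HtL|]; intros x Hx.
      destruct (proj1 (HLs s HsL)) as [l Hl].
      apply (snoc_entry s n t l 0 x Ht Hl) in Hx; destruct Hx as [[_ Hx]|[_ ->]]; auto.
    + apply (uniform_koenig SCA T 1 F HT HF); intros i H HH n s Hs k Hk.
      assert (HHf := fun_section_fun F i H HF HH).
      apply NNPP; intros Hno; apply (Hhom H HHf).
      * intros j; destruct (restriction_exists H j HHf) as [t Ht]; exists t; split; [exact Ht|].
        apply (HP i), (HFP i H HH j t Ht).
      * exists n, s; split; [exact Hs|]; apply HA; split; [apply Hs|].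
        destruct (seq_entry_exists s (k + 1) 0 Hk) as [x Hx]; [apply le_0l|].
        exists x, i; split; [exact Hx|]; split; [apply (proj1 (HP i s) (HFP i H HH n s Hs)), Hx|].
        intros Hb; apply Hno, Hb, Hk.
Qed.

(** * From choosing paths to choice for Sigma11 formulas *)

Definition set_half j (X : nset M) : nset M := the_set (fun n => n + n + j \in X).

Lemma mem_set_half j X n : n \in set_half j X <-> n + n + j \in X.
Proof. unfold set_half; rewrite mem_the_set0 by def; reflexivity. Qed.

Lemma set_join X Y : exists Z, set_half 0 Z = X /\ set_half 1 Z = Y.
Proof.
  set (Z := the_set (fun p => exists n, n <= p /\ ((p = n + n /\ n \in X) \/ (p = n + n + 1 /\ n \in Y)))).
  assert (HZ : forall p, p \in Z <-> exists n, n <= p /\ ((p = n + n /\ n \in X) \/ (p = n + n + 1 /\ n \in Y))).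
  { intros p; unfold Z; rewrite mem_the_set0 by def; reflexivity. }
  exists Z; split; apply mem_ext; intros n; rewrite mem_set_half, HZ; split.
  - rewrite add_0r; intros (n' & _ & [[E H]|[E H]]).
    + apply double_inj in E; subst n'; exact H.
    + apply double_neq in E; tauto.
  - intros H; exists n; rewrite add_0r; split; [apply le_addr|auto].
  - intros (n' & _ & [[E H]|[E H]]).
    + symmetry in E; apply double_neq in E; tauto.
    + apply add_cancel, double_inj in E; subst n'; exact H.
  - intros H; exists n; split; [apply le_iff; exists (n + 1); ring|auto].
Qed.

Lemma SDef_set_half C {HC : form_class C} j (G : env -> senv -> senv) : SDef C G ->
  SDef C (fun e E => scons (set_half j (E O)) (G e E)).
Proof.
  intros HG; apply (SDef_scons C (fun _ E => set_half j (E O)) G); [|exact HG].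
  intros f r Hf _; eapply Def_ext; [intros e E; apply mem_set_half|]; def.
Qed.

Lemma Sigma11_choice : Sigma11_IND M -> LL_Sigma01 M -> choice_schema Sigma11 M.
Proof.
  intros IND LL p (q & Hq & ->) e E Hex; simpl in Hex |- *.
  (* The function and the set witness of the Sigma11 formula are chosen together, as the two halves
     of one set. *)
  set (P := fun i X => is_fun (set_half 0 X) /\
    sat (scons i e) (scons (set_half 1 X) (scons (set_half 0 X) E)) q).
  destruct (Sigma11_normal_form SCA P) as (T & HT & H1 & H2).
  { unfold P; apply (Def_and _ (fun _ E => is_fun (set_half 0 (E O)))).
    - apply (Def_subst_arith (fun _ E => is_fun (E O)) (fun e => e)
        (fun _ E => scons (set_half 0 (E O)) E)); [apply Def_is_fun; sterm|intros; term|].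
      apply SDef_set_half; [exact _|apply SDef_id; exact _].
    - apply (sat_subst_arith q Hq (fun e' => scons (e' O) e)
        (fun _ E' => scons (set_half 1 (E' O)) (scons (set_half 0 (E' O)) E)) (fun e' => e')).
      + intros [|k]; simpl; term.
      + intros; term.
      + apply SDef_set_half; [exact _|]; apply SDef_set_half; [exact _|apply SDef_const; exact _]. }
  destruct (uniform_path_choice T IND LL HT) as (G & HG & HGp).
  { intros i; destruct (Hex i) as (F & HF & Y & HY); destruct (set_join F Y) as (Z & E0 & E1).
    apply (H1 i Z); unfold P; rewrite E0, E1; auto. }
  assert (HPG : forall i H, fun_section G i H -> P i (decode H)).
  { intros i H HH; apply H2; [eapply fun_section_fun; eassumption|apply HGp, HH]. }
  (* The argument is doubled here for [set_half] and once more for [decode], which makes the chosen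
     functions Delta00 in [G]. *)
  set (d := fun n m => pair n m + pair n m).
  assert (Hmem : forall i H n m, fun_section G i H ->
    pair n m \in set_half 0 (decode H) <-> ~ pair (pair (d n m + d n m) i) 0 \in G).
  { intros i H n m HH; rewrite mem_set_half, mem_decode, add_0r, (fun_section_mem G i H _ _ HH); reflexivity. }
  destruct (binary_function_of_graph (fun n i m => ~ pair (pair (d n m + d n m) i) 0 \in G))
    as (F & HF & HFm).
  - unfold d; sig.
  - intros n i; destruct (fun_section_exists G i) as [H HH].
    destruct (fun_value _ n (proj1 (HPG i H HH))) as [m Hm]; exists m; apply (Hmem i H n m HH), Hm.
  - intros n i x y Hx Hy; destruct (fun_section_exists G i) as [H HH].
    apply (fun_unique _ n x y (proj1 (HPG i H HH))); apply (Hmem i H n _ HH); assumption.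
  - exists F; split; [exact HF|]; intros i; destruct (fun_section_exists G i) as [H HH].
    destruct (HPG i H HH) as [Hfun Hsat]; exists (set_half 0 (decode H)); split; [|eexists; exact Hsat].
    intros p; split.
    + intros Hp; destruct (proj1 Hfun p Hp) as (n & m & ->); exists n, m; split; [reflexivity|].
      apply HFm, (Hmem i H n m HH), Hp.
    + intros (n & m & -> & Hnm%HFm); apply (Hmem i H n m HH), Hnm.
Qed.

End Main.

Theorem theorem1p7 :
  (forall M : L2_structure, RCA0 M -> LL_Delta01 M -> ACA0 M) /\
  (forall M : L2_structure,
     RCA0 M -> Sigma11_IND M -> LL_Delta01 M -> Delta11_CA0 M) /\
  (forall M : L2_structure,
     RCA0 M -> Sigma11_IND M -> LL_Sigma01 M -> Sigma11_AC0 M).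
Proof.
  split; [exact ACA0_of_LL_Delta01|].
  split; intros M HM IND LL; (split; [exact HM|]).
  - apply Delta11_comprehension; [|exact IND|exact LL].
    intros P HP; apply sigma_comprehension_of_LL; assumption.
  (* A clopen code contains an open one, so Sigma01 comprehension is available here as well. *)
  - assert (LL' : LL_Delta01 M) by (intros A B HAB; apply LL, HAB).
    apply Sigma11_choice; [|exact IND|exact LL].
    intros P HP; apply sigma_comprehension_of_LL; assumption.
Qed.
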